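(* Let $d\ge2$, name the variables $z_1,\dots,z_{d-2},x,y$, and suppose that $f\in\mathbb{C}\langle\langle z_1,\dots,z_{d-2},x,y\rangle\rangle_{\ge2}$ satisfies $\mathrm{corank}(f)=2$ and $\mathrm{corank}_2(f)=2$. Write $q=z_1^2+\cdots+z_{d-2}^2$. (1) Then $f\cong g$ for some $g$ in one of the following families: (i) $q+xy^2$ (labelled $D_{\infty,\infty}$); (ii) $q+xy^2+x^{2m+1}$ with $m\ge1$ (labelled $D_{\infty,m}$); (iii) $q+xy^2+x^{2n}$ with $n\ge2$ (labelled $D_{n,\infty}$); (iv) $q+xy^2+x^{2n}+x^{2m+1}$ with $2n-2\ge m\ge n\ge2$ (labelled $D_{n,m}$); (v) $q+xy^2+x^{2m+1}+x^{2n}$ with $n>m\ge1$ (labelled $D_{n,m}$). The potentials in this list all have mutually non-isomorphic Jacobi algebras. (2) Furthermore, the potentials in (i) and (ii) have Jacobi algebras of $\mathfrak{J}$-dimension $1$, whilst those in (iii), (iv) and (v) have Jacobi algebras of $\mathfrak{J}$-dimension $0$.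
   Context: $\mathbb{C}\langle\langle x_1,\dots,x_d\rangle\rangle$ is the ring of formal power series in $d$ noncommuting variables over $\mathbb{C}$, with two-sided maximal ideal $\mathfrak{n}$ of series with zero constant term and the $\mathfrak{n}$-adic topology; the closure of a subset $S$ is $\bigcap_{i\ge0}(S+\mathfrak{n}^i)$. The subscript $\ge t$ denotes series all of whose homogeneous components of degree $<t$ vanish. The cyclic derivative $\delta_i$ is the $\mathbb{C}$-linear (termwise) map given on monomials by $\delta_i(x_{i_1}\cdots x_{i_t})=\sum_{j:\,i_j=i}x_{i_{j+1}}\cdots x_{i_t}x_{i_1}\cdots x_{i_{j-1}}$. The Jacobi algebra is $\mathrm{Jac}(f)=\mathbb{C}\langle\langle x_1,\dots,x_d\rangle\rangle/I$ where $I$ is the closure of the two-sided ideal $(\delta_1f,\dots,\delta_df)$. We write $f\cong g$ when $\mathrm{Jac}(f)\cong\mathrm{Jac}(g)$ as algebras. For $f$ of order $\ge2$, let $\mathfrak{J}$ be the Jacobson radical of $\mathrm{Jac}(f)$. Set $\mathrm{corank}_m(f)=\dim_{\mathbb{C}}\mathfrak{J}^m/\mathfrak{J}^{m+1}$ and $\mathrm{corank}(f)=\mathrm{corank}_1(f)$. The $\mathfrak{J}$-dimension of $\mathrm{Jac}(f)$ is the infimum of those real $r\ge0$ for which there is $c\in\mathbb{R}$ with $\dim_{\mathbb{C}}\mathrm{Jac}(f)/\mathfrak{J}^n\le cn^r$ for all $n\in\mathbb{N}$ (and is $\infty$ if no such $r$ exists). *)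

(* Defs.v *)
From HB Require Import structures.
From mathcomp Require Import all_boot all_order all_algebra.
From mathcomp Require Import generic_quotient ring_quotient.
From mathcomp Require Import all_classical all_reals.
From mathcomp Require Import ereal exp complex.

Set Implicit Arguments.
Unset Strict Implicit.
Unset Printing Implicit Defensive.
Import Order.TTheory GRing.Theory Num.Theory.
Local Open Scope classical_set_scope.
Local Open Scope ring_scope.

Section Ideals.
Variable A : pzRingType.
Implicit Types I J M N : set A.

Definition left_ideal I : Prop :=
  [/\ I 0, forall x y, I x -> I y -> I (x + y) & forall a x, I x -> I (a * x)].

Definition two_sided_ideal I : Prop :=
  left_ideal I /\ forall x a, I x -> I (x * a).

Definition ideal_gen (S : set A) : set A := smallest two_sided_ideal S.

Definition ideal_mul I J : set A := ideal_gen [set x * y | x in I & y in J].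

Definition ideal_pow I (n : nat) : set A := iter n (ideal_mul I) setT.

Definition maximal_left_ideal M : Prop :=
  [/\ left_ideal M, ~ M 1
    & forall N, left_ideal N -> ~ N 1 -> M `<=` N -> N = M].

Definition jacobson_radical : set A := \bigcap_(M in maximal_left_ideal) M.

Lemma ideal_gen_ideal (S : set A) : two_sided_ideal (ideal_gen S).
Proof.
split; first split.
- by move=> M [[[]]].
- move=> x y Ix Iy M MS; case: (MS) => [[[_ MD _] _] _].
  by apply: MD; [exact: Ix | exact: Iy].
- move=> a x Ix M MS; case: (MS) => [[[_ _ MM] _] _].
  by apply: MM; exact: Ix.
- move=> x a Ix M MS; case: (MS) => [[_ MM] _].
  by apply: MM; exact: Ix.
Qed.

Lemma two_sided_ideal_setT : two_sided_ideal setT.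
Proof. by []. Qed.

Lemma ideal_pow_ideal I n : two_sided_ideal (ideal_pow I n).
Proof.
case: n => [|n]; first exact: two_sided_ideal_setT.
exact: ideal_gen_ideal.
Qed.

Record ideal := Ideal {
  ideal_set : set A;
  ideal_setP : two_sided_ideal ideal_set }.

End Ideals.

(* The library only equips quotients by ideals with a ring structure when the
   ambient ring is commutative and the ideal is proper.  The quotient below may
   be the zero ring, which cannot be an [algType]; it is given its ring and its
   K-module structure separately. *)
Section QuotientAlgebra.
Variables (K : fieldType) (A : algType K) (I : ideal A).

Definition ideal_pred : {pred A} := fun x => `[< ideal_set I x >].

Lemma ideal_pred_zmod_closed : zmod_closed ideal_pred.
Proof.
have [[I0 ID IM] _] := ideal_setP I.
split=> [|x y]; rewrite !unfold_in; first exact/asboolP.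
move=> /asboolP Ix /asboolP Iy; apply/asboolP.
by apply: ID => //; rewrite -mulN1r; apply: IM.
Qed.

HB.instance Definition _ :=
  GRing.isZmodClosed.Build A ideal_pred ideal_pred_zmod_closed.

Definition ideal_quotient : Type := Quotient.quot ideal_pred.

HB.instance Definition _ := GRing.Zmodule.on ideal_quotient.
HB.instance Definition _ := Quotient.on ideal_quotient.

Local Open Scope quotient_scope.

Let Q : quotType A := ideal_quotient.

Definition quotient_proj (x : A) : ideal_quotient := \pi_Q x.

Lemma quotient_projP x y : quotient_proj x = quotient_proj y <-> ideal_set I (x - y).
Proof.
have E : (x - y \in ideal_pred) = (x == y %[mod Quotient.quot ideal_pred]).
  exact: Quotient.idealrBE.
split=> [xy|xy].
  by apply/asboolP; rewrite -[asbool _]/(x - y \in ideal_pred) E; apply/eqP.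
by apply/eqP; rewrite -[_ == _]E; apply/asboolP.
Qed.

Lemma quotient_projK (x : ideal_quotient) : quotient_proj (repr x) = x.
Proof. exact: reprK. Qed.

Lemma quotient_projD x y :
  quotient_proj (x + y) = quotient_proj x + quotient_proj y.
Proof. by rewrite /quotient_proj; apply: (raddfD (\pi_(Quotient.quot ideal_pred))). Qed.

Definition quotient_one : ideal_quotient := quotient_proj 1.
Definition quotient_mul (x y : ideal_quotient) : ideal_quotient :=
  quotient_proj (repr x * repr y).
Definition quotient_scale (a : K) (x : ideal_quotient) : ideal_quotient :=
  quotient_proj (a *: repr x).

Lemma quotient_projM x y :
  quotient_proj (x * y) = quotient_mul (quotient_proj x) (quotient_proj y).
Proof.
have [[_ ID IM] IMr] := ideal_setP I.
apply/quotient_projP.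
set x' := repr _; set y' := repr _.
have Hx : ideal_set I (x - x') by apply/quotient_projP; rewrite quotient_projK.
have Hy : ideal_set I (y - y') by apply/quotient_projP; rewrite quotient_projK.
have -> : x * y - x' * y' = (x - x') * y + x' * (y - y').
  by rewrite mulrBl mulrBr addrA subrK.
by apply: ID; [apply: IMr | apply: IM].
Qed.

Lemma quotient_projZ a x :
  quotient_proj (a *: x) = quotient_scale a (quotient_proj x).
Proof.
have [[_ _ IM] _] := ideal_setP I.
apply/quotient_projP; rewrite -scalerBr -mulr_algl; apply: IM.
by apply/quotient_projP; rewrite quotient_projK.
Qed.

Lemma quotient_mulA : associative quotient_mul.
Proof.
move=> x y z; rewrite -(quotient_projK x) -(quotient_projK y).
by rewrite -(quotient_projK z) -!quotient_projM mulrA.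
Qed.

Lemma quotient_mul1 : left_id quotient_one quotient_mul.
Proof.
by move=> x; rewrite -(quotient_projK x) -quotient_projM mul1r.
Qed.

Lemma quotient_mulr1 : right_id quotient_one quotient_mul.
Proof.
by move=> x; rewrite -(quotient_projK x) -quotient_projM mulr1.
Qed.

Lemma quotient_mulDl : left_distributive quotient_mul +%R.
Proof.
move=> x y z; rewrite -(quotient_projK x) -(quotient_projK y).
by rewrite -(quotient_projK z) -quotient_projD -!quotient_projM mulrDl quotient_projD.
Qed.

Lemma quotient_mulDr : right_distributive quotient_mul +%R.
Proof.
move=> x y z; rewrite -(quotient_projK x) -(quotient_projK y).
by rewrite -(quotient_projK z) -quotient_projD -!quotient_projM mulrDr quotient_projD.
Qed.

HB.instance Definition _ := GRing.Zmodule_isPzRing.Build ideal_quotient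
  quotient_mulA quotient_mul1 quotient_mulr1 quotient_mulDl quotient_mulDr.

Lemma quotient_scaleA a b x :
  quotient_scale a (quotient_scale b x) = quotient_scale (a * b) x.
Proof. by rewrite -(quotient_projK x) -!quotient_projZ scalerA. Qed.

Lemma quotient_scale1 : left_id 1 quotient_scale.
Proof. by move=> x; rewrite -(quotient_projK x) -quotient_projZ scale1r. Qed.

Lemma quotient_scaleDr : right_distributive quotient_scale +%R.
Proof.
move=> a x y; rewrite -(quotient_projK x) -(quotient_projK y).
by rewrite -quotient_projD -!quotient_projZ scalerDr quotient_projD.
Qed.

Lemma quotient_scaleDl x : {morph quotient_scale^~ x : a b / a + b}.
Proof.
by move=> a b; rewrite -(quotient_projK x) -!quotient_projZ scalerDl quotient_projD.
Qed.

HB.instance Definition _ := GRing.Zmodule_isLmodule.Build K ideal_quotient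
  quotient_scaleA quotient_scale1 quotient_scaleDr quotient_scaleDl.

Lemma quotient_scaleAl (a : K) (x y : ideal_quotient) :
  a *: (x * y) = (a *: x) * y.
Proof.
rewrite -(quotient_projK x) -(quotient_projK y).
change (quotient_scale a (quotient_mul (quotient_proj (repr x)) (quotient_proj (repr y)))
  = quotient_mul (quotient_scale a (quotient_proj (repr x))) (quotient_proj (repr y))).
by rewrite -quotient_projM -!quotient_projZ -quotient_projM scalerAl.
Qed.

Lemma quotient_scaleAr (a : K) (x y : ideal_quotient) :
  a *: (x * y) = x * (a *: y).
Proof.
rewrite -(quotient_projK x) -(quotient_projK y).
change (quotient_scale a (quotient_mul (quotient_proj (repr x)) (quotient_proj (repr y)))
  = quotient_mul (quotient_proj (repr x)) (quotient_scale a (quotient_proj (repr y)))).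
by rewrite -quotient_projM -!quotient_projZ -quotient_projM scalerAr.
Qed.

End QuotientAlgebra.

(* [ncseries K d] is K<<x_0, ..., x_(d-1)>>: a monomial is the word of its
   variables and a series maps each monomial to its coefficient. *)
Definition ncseries (K : fieldType) (d : nat) : Type := seq 'I_d -> K.

Section NCSeries.
Variables (K : fieldType) (d : nat).
Local Notation series := (ncseries K d).
Implicit Types f g h : series.

HB.instance Definition _ := GRing.Zmodule.copy series (seq 'I_d -> K).

Definition series_scale (a : K) f : series := fun w => a * f w.

Lemma series_scaleA a b f :
  series_scale a (series_scale b f) = series_scale (a * b) f.
Proof. by apply/funext => w; rewrite /series_scale mulrA. Qed.

Lemma series_scale1 : left_id 1 series_scale.
Proof. by move=> f; apply/funext => w; rewrite /series_scale mul1r. Qed.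

Lemma series_scaleDr : right_distributive series_scale +%R.
Proof. by move=> a f g; apply/funext => w; apply: mulrDr. Qed.

Lemma series_scaleDl f : {morph series_scale^~ f : a b / a + b}.
Proof. by move=> a b; apply/funext => w; apply: mulrDl. Qed.

HB.instance Definition _ := GRing.Zmodule_isLmodule.Build K series
  series_scaleA series_scale1 series_scaleDr series_scaleDl.

Definition series_one : series := fun w => (w == [::])%:R.

Definition series_mul f g : series :=
  fun w => \sum_(k < (size w).+1) f (take k w) * g (drop k w).

Lemma series_mulA : associative series_mul.
Proof.
move=> f g h; apply/funext => w; rewrite /series_mul.
pose N := (size w).+1.
pose F (i j : nat) := f (take i w) * g (take (j - i) (drop i w)) * h (drop j w).
transitivity (\sum_(i < N) \sum_(j < N | (i <= j)%N) F i j).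
  apply: eq_bigr => i _; rewrite mulr_sumr size_drop.
  have leiw : (i <= size w)%N by rewrite -ltnS.
  rewrite -[RHS](big_geq_mkord _ _ xpredT (F i)).
  have -> : \sum_(i <= j < N) F i j = \sum_(0 <= j < N - i) F i (j + i)%N.
    by rewrite -{1}[nat_of_ord i]add0n big_addn.
  rewrite subSn // big_mkord.
  by apply: eq_bigr => j _; rewrite /F addnK mulrA drop_drop.
rewrite (exchange_big_dep xpredT) //=.
apply: eq_bigr => j _; rewrite mulr_suml.
have lejw : (j <= size w)%N by rewrite -ltnS.
rewrite size_takel // (big_ord_widen N (fun i => f (take i (take j w)) *
  g (drop i (take j w)) * h (drop j w))) //.
apply: eq_bigr => i leij.
by rewrite /F take_takel // take_drop subnK.
Qed.

Lemma series_mul1 : left_id series_one series_mul.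
Proof.
move=> f; apply/funext => w; rewrite /series_mul big_ord_recl take0 drop0.
rewrite /series_one eqxx mul1r big1 ?addr0 // => k _.
by rewrite -size_eq0 size_take_min; case: w k => [[]|a w k] //=; rewrite ?mul0r // minnSS mul0r.
Qed.

Lemma series_mulr1 : right_id series_one series_mul.
Proof.
move=> f; apply/funext => w; rewrite /series_mul big_ord_recr /=.
rewrite take_size drop_size /series_one eqxx mulr1 big1 ?add0r // => k _.
by rewrite -size_eq0 size_drop subn_eq0 leqNgt ltn_ord mulr0.
Qed.

Lemma series_mulDl : left_distributive series_mul +%R.
Proof.
move=> f g h; apply/funext => w.
rewrite -[RHS]/(series_mul f h w + series_mul g h w) /series_mul -big_split /=.
by apply: eq_bigr => k _; rewrite -mulrDl.
Qed.

Lemma series_mulDr : right_distributive series_mul +%R.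
Proof.
move=> f g h; apply/funext => w.
rewrite -[RHS]/(series_mul f g w + series_mul f h w) /series_mul -big_split /=.
by apply: eq_bigr => k _; rewrite -mulrDr.
Qed.

Lemma series_one_neq0 : series_one != 0.
Proof.
by apply/eqP => /(congr1 (fun f : series => f [::])) /eqP; rewrite /series_one eqxx oner_eq0.
Qed.

HB.instance Definition _ := GRing.Zmodule_isNzRing.Build series
  series_mulA series_mul1 series_mulr1 series_mulDl series_mulDr series_one_neq0.

Lemma series_scaleAl (a : K) f g : a *: (f * g) = (a *: f) * g.
Proof.
apply/funext => w; rewrite /= [LHS]mulr_sumr.
by apply: eq_bigr => k _; rewrite mulrA.
Qed.

HB.instance Definition _ := GRing.Lmodule_isLalgebra.Build K series series_scaleAl.

Lemma series_scaleAr (a : K) f g : a *: (f * g) = f * (a *: g).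
Proof.
apply/funext => w; rewrite /= [LHS]mulr_sumr.
by apply: eq_bigr => k _; rewrite mulrCA.
Qed.

HB.instance Definition _ := GRing.Lalgebra_isAlgebra.Build K series series_scaleAr.

Definition var (i : 'I_d) : series := fun w => (w == [:: i])%:R.

Definition order_ge (t : nat) f : Prop := forall w, (size w < t)%N -> f w = 0.

(* The cyclic derivative of a monomial, as the list of its terms; the position
   [j] is counted from 0. *)
Definition cyclic_derivative_word (i : 'I_d) (m : seq 'I_d) : seq (seq 'I_d) :=
  [seq drop j.+1 m ++ take j m | j <- iota 0 (size m) & nth i m j == i].

(* The coefficient of [w] only receives contributions from the monomials of
   degree [(size w).+1], so that the termwise extension is a finite sum. *)
Definition cyclic_derivative (i : 'I_d) f : series := fun w =>
  \sum_(m : (size w).+1.-tuple 'I_d)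
    f m * (count_mem w (cyclic_derivative_word i m))%:R.

Definition series_maxideal : set series := [set f | f [::] = 0].

Definition adic_closure (S : set series) : set series :=
  \bigcap_(i in [set: nat])
    [set s + m | s in S & m in ideal_pow series_maxideal i].

Lemma adic_closure_ideal (S : set series) :
  two_sided_ideal S -> two_sided_ideal (adic_closure S).
Proof.
move=> [[S0 SD SM] SMr].
have PI i := ideal_pow_ideal series_maxideal i.
split; first split.
- move=> i _; have [[P0 _ _] _] := PI i.
  by exists 0 => //; exists 0 => //; rewrite addr0.
- move=> x y Cx Cy i _; have [[_ PD _] _] := PI i.
  have [s Ss [m Pm <-]] := Cx i I; have [t St [n Pn <-]] := Cy i I.
  by exists (s + t); [exact: SD|exists (m + n); [exact: PD|rewrite addrACA]].
- move=> a x Cx i _; have [[_ _ PM] _] := PI i.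
  have [s Ss [m Pm <-]] := Cx i I.
  by exists (a * s); [exact: SM|exists (a * m); [exact: PM|rewrite mulrDr]].
- move=> x a Cx i _; have [_ PM] := PI i.
  have [s Ss [m Pm <-]] := Cx i I.
  by exists (s * a); [exact: SMr|exists (m * a); [exact: PM|rewrite mulrDl]].
Qed.

Definition jacobi_ideal f : ideal series :=
  Ideal (adic_closure_ideal
    (ideal_gen_ideal [set cyclic_derivative i f | i in [set: 'I_d]])).

Definition Jac f := ideal_quotient (jacobi_ideal f).

Definition Jac_iso f g : Prop :=
  exists2 phi : {rmorphism Jac f -> Jac g}, scalable phi & bijective phi.

End NCSeries.

Section RelativeDimension.
Variables (R : realType) (K : fieldType) (V : lmodType K).
Implicit Types U W : set V.

Definition basis_mod U W (n : nat) (b : 'I_n -> V) : Prop :=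
  (forall i, U (b i)) /\
  forall u, U u -> exists! c : 'rV[K]_n, W (u - \sum_(i < n) c 0 i *: b i).

(* The dimension of U / W for subspaces W <= U: the size of a basis, or +oo if
   there is no finite basis (the infimum of the empty set). *)
Definition dim_mod U W : \bar R :=
  ereal_inf [set n%:R%:E | n in
    [set n : nat | exists b : 'I_n -> V, basis_mod U W b]].

End RelativeDimension.

Section Corank.
Variables (R : realType) (d : nat).
Implicit Types f : ncseries R[i] d.

Definition jac_radical_pow f (n : nat) : set (Jac f) :=
  ideal_pow (@jacobson_radical (Jac f)) n.

Definition corankm (m : nat) f : \bar R :=
  dim_mod R (@jac_radical_pow f m) (@jac_radical_pow f m.+1).

Definition corank f : \bar R := corankm 1 f.

Definition Jdim f : \bar R :=
  ereal_inf [set r%:E | r in [set r : R | 0 <= r /\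
    exists c : R, forall n : nat,
      (dim_mod R [set: Jac f] (@jac_radical_pow f n) <= (c * n%:R `^ r)%:E)%E]].

End Corank.

(* [DNInf n] and [DInfM m] stand for D_(n,oo) and D_(oo,m).  [DNM_even n m] and
   [DNM_odd n m] both stand for D_(n,m); they are told apart by the parity of the
   lowest power of [varx] in the normal form. *)
Inductive nf_label :=
  | DInfInf
  | DInfM of nat
  | DNInf of nat
  | DNM_even of nat & nat
  | DNM_odd of nat & nat.

Definition nf_valid (L : nf_label) : bool :=
  match L with
  | DInfInf => true
  | DInfM m => (1 <= m)%N
  | DNInf n => (2 <= n)%N
  | DNM_even n m => [&& (m <= 2 * n - 2)%N, (n <= m)%N & (2 <= n)%N]
  | DNM_odd n m => (m < n)%N && (1 <= m)%N
  end.

Section NormalForms.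
Variables (K : fieldType) (d : nat) (d_ge2 : (2 <= d)%N).

(* The d variables are z_1, ..., z_(d-2), x, y in this order. *)
Lemma ltn_subd k : (0 < k)%N -> (d - k < d)%N.
Proof. by move=> k0; rewrite ltn_subrL k0 (ltn_trans _ d_ge2). Qed.

Definition varz (i : 'I_(d - 2)) : ncseries K d :=
  var K (widen_ord (leq_subr 2 d) i).
Definition varx : ncseries K d := var K (Ordinal (ltn_subd (isT : (0 < 2)%N))).
Definition vary : ncseries K d := var K (Ordinal (ltn_subd (isT : (0 < 1)%N))).

Definition quadz : ncseries K d := \sum_(i < d - 2) varz i ^+ 2.

Definition normal_form (L : nf_label) : ncseries K d :=
  match L with
  | DInfInf => quadz + varx * vary ^+ 2
  | DInfM m => quadz + varx * vary ^+ 2 + varx ^+ (2 * m + 1)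
  | DNInf n => quadz + varx * vary ^+ 2 + varx ^+ (2 * n)
  | DNM_even n m =>
      quadz + varx * vary ^+ 2 + varx ^+ (2 * n) + varx ^+ (2 * m + 1)
  | DNM_odd n m =>
      quadz + varx * vary ^+ 2 + varx ^+ (2 * m + 1) + varx ^+ (2 * n)
  end.

End NormalForms.

(* Main.v *)
Require Import Defs.
From HB Require Import structures.
From mathcomp Require Import all_boot all_order all_algebra.
From mathcomp Require Import all_classical all_reals.
From mathcomp Require Import ereal exp complex.
From mathcomp Require Import ring lra zify.

(** Existence of a normal form.  The quotient [J / J^2] is the cokernel of the
    Hessian of [f], so corank 2 makes the Hessian of rank [d - 2]
    ([corank_rank]), and a linear change of variables turns the quadratic part
    into [q].  On the kernel of the Hessian the cubic part is a binary cubic form: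
    a cube, or [x y^2 + eps x^3] in suitable coordinates ([leading_coordinates]).
    For a cube, [J^2 / J^3] would have dimension at least 3 ([corank2_cube]).  With
    weight 3 for the [z]'s and 2 for [x] and [y], the leading part
    [q + x y^2 + eps x^3] is homogeneous, with cyclic derivatives [2 z_i],
    [x y + y x] and [y^2 + 3 eps x^2].  Up to cyclic rotation these relations
    rewrite any monomial into a power of [x] ([low_reducible]); to first order,
    such a rewriting is a change of variables ([subs_perturb]), and composing
    changes of increasing weight gives [f = q + x y^2 + p(x)] up to an isomorphism
    of Jacobi algebras ([xy_normalize]).

    Structure of the algebra of [q + x y^2 + p(x)].  With [s = - p'] the relations
    are [z_i = 0], [y a(x) = a(- x) y] and [y^2 = s(x)].  Hence every element is of
    the form [a(x) + b(x) y] ([jac_nf]), and since [y] commutes with [y^2], the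
    series [s(x) - s(- x)] annihilates [y]; there are no other relations
    ([jac_nf_eq]).  In this presentation [x] and [y] may be replaced by [gam(x)]
    and [bet(x) y] with [gam] odd and [bet] even ([reparam_subs_iso]), and by
    extracting roots of even series the odd and even parts of [p'] become
    monomials; an even part divisible by the product of [p'] and its odd part
    vanishes in the algebra.  This leaves the five families ([xy_pot_classify]).

    Dimensions.  For a normal form the relations between the [x^i] and the [x^i y]
    are [x^M = 0] and [x^N y = 0], where [N = 2 n - 1] and [M - N] is the order of
    [p'], and both are infinite for [n] infinite.  Thus [Jac / J^k] has dimension
    [min(k, M) + min(k - 1, N)] ([dim_mod_radical_nf]), which is bounded for [n]
    finite and linear in [k] otherwise ([normal_form_Jdim]).

    Distinctness.  These dimensions determine [n], and for [n] finite the order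
    [min(2 n - 1, 2 m)] of [p'].  If [n] is infinite, the order [2 m] of [p'] is
    recovered from the first components, which multiply modulo [s]
    ([odd_exponent_le]).  There remains the case of [n] finite and [m >= n], where
    [p'] has order [2 n - 1] whatever [m] is.  If the images [c + e y] of [x] and
    [a + b y] of [y] under an isomorphism satisfy the relations of a label with
    larger [m], the relation [x y + y x = 0] makes [c] odd and [a] zero up to high
    order, so that in [y^2 + p'(x) = 0] the only even term of order [2 m] is
    [b(x) b(- x) x^(2 m)]; it has to vanish, which the invertibility of [b] forbids
    ([mixed_exponent_le]). *)

Set Implicit Arguments.
Unset Strict Implicit.
Unset Printing Implicit Defensive.
Import Order.TTheory GRing.Theory Num.Theory.
Local Open Scope classical_set_scope.
Local Open Scope ring_scope.

(** * Series, weights and truncation *)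

Section Series.
Variables (K : fieldType) (d : nat).
Local Notation series := (ncseries K d).
Implicit Types (f g h u : series) (w : seq 'I_d).

(** Left division by a letter ([lquo_split]).  The operators on series used below
    (substitution, cyclic derivative, module actions) all satisfy a recursion
    through this division; it determines them, and proving an identity reduces
    to comparing two such recursions up to any given order. *)
Definition lquo (i : 'I_d) f : series := fun w => f (i :: w).

Lemma seriesP f g : (forall w, f w = g w) -> f = g.
Proof. by move=> fg; apply/funext. Qed.

Lemma addsE f g w : (f + g) w = f w + g w. Proof. by []. Qed.
Lemma oppsE f w : (- f) w = - f w. Proof. by []. Qed.
Lemma scalesE (a : K) f w : (a *: f) w = a * f w. Proof. by []. Qed.
Lemma zerosE w : (0 : series) w = 0. Proof. by []. Qed.
Lemma onesE w : (1 : series) w = (w == [::])%:R. Proof. by []. Qed.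
Lemma varE (i : 'I_d) w : var K i w = (w == [:: i])%:R. Proof. by []. Qed.
Lemma mulsE f g w :
  (f * g) w = \sum_(k < (size w).+1) f (take k w) * g (drop k w).
Proof. by []. Qed.

Lemma sumsE (T : Type) (r : seq T) (P : pred T) (F : T -> series) w :
  (\sum_(i <- r | P i) F i) w = \sum_(i <- r | P i) F i w.
Proof. by elim/big_rec2: _ => // i x y _ <-. Qed.

Lemma mulsE_nil f g : (f * g) [::] = f [::] * g [::].
Proof. by rewrite mulsE big_ord_recl big_ord0 addr0. Qed.

Lemma exprs_nil f n : (f ^+ n) [::] = f [::] ^+ n.
Proof. by elim: n => [|n IH]; rewrite ?exprS ?mulsE_nil ?IH // onesE. Qed.

Lemma lquoM i f g : lquo i (f * g) = lquo i f * g + f [::] *: lquo i g.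
Proof.
apply: seriesP => w; rewrite addsE scalesE {1}/lquo !mulsE /= big_ord_recl /=.
by rewrite addrC; congr (_ + _); apply: eq_bigr => k _.
Qed.

Lemma lquoD i f g : lquo i (f + g) = lquo i f + lquo i g. Proof. by []. Qed.
Lemma lquoZ i a f : lquo i (a *: f) = a *: lquo i f. Proof. by []. Qed.
Lemma lquo_sum i (T : Type) (r : seq T) (P : pred T) (F : T -> series) :
  lquo i (\sum_(j <- r | P j) F j) = \sum_(j <- r | P j) lquo i (F j).
Proof. by apply: seriesP => w; rewrite /lquo !sumsE. Qed.

Lemma lquo_var i j : lquo i (var K j) = (i == j)%:R.
Proof.
apply: seriesP => w; rewrite /lquo varE eqseq_cons.
by case: eqP => //= _; rewrite ?onesE.
Qed.

Lemma lquo1 i : lquo i 1 = 0 :> series.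
Proof. by apply: seriesP. Qed.

Lemma lquo_varM i j f : lquo i (var K j * f) = (i == j)%:R * f.
Proof. by rewrite lquoM lquo_var varE scale0r addr0. Qed.

Lemma var_mulE j f w :
  (var K j * f) w = if w is i :: v then (i == j)%:R * f v else 0.
Proof.
case: w => [|i v]; first by rewrite mulsE_nil varE mul0r.
rewrite -[LHS]/(lquo i (var K j * f) v) lquo_varM.
by case: eqP; rewrite ?mul1r ?mul0r.
Qed.

Lemma lquo_split f : f = f [::] *: 1 + \sum_i var K i * lquo i f.
Proof.
apply: seriesP => w; rewrite addsE scalesE onesE sumsE.
case: w => [|i w].
  by rewrite mulr1 big1 ?addr0 // => i _; rewrite var_mulE.
rewrite mulr0 add0r (bigD1 i) //= var_mulE eqxx mul1r big1 ?addr0 // => j ji.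
by rewrite var_mulE eq_sym (negPf ji) mul0r.
Qed.

Lemma mul_varE f j w i : (f * var K j) (rcons w i) = (i == j)%:R * f w.
Proof.
elim: w f => [|k w IH] f /=.
  rewrite -[LHS]/(lquo i (f * var K j) [::]) lquoM lquo_var addsE scalesE.
  by rewrite mulsE_nil varE mulr0 add0r mulrC; case: eqP; rewrite ?onesE.
rewrite -[LHS]/(lquo k (f * var K j) (rcons w i)) lquoM lquo_var addsE scalesE.
rewrite IH; case: (k == j); rewrite ?onesE ?zerosE ?mulr0 ?addr0 //.
by case: w {IH} => [|? ?] //=; rewrite mulr0 addr0.
Qed.

Lemma mul_var_nil f j : (f * var K j) [::] = 0.
Proof. by rewrite mulsE_nil varE mulr0. Qed.

End Series.

(** With the total weight of a word as its level, this is the ideal of series of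
    weighted order at least [k]; the module elements on which series act are
    filtered in the same way, whence the arbitrary index type. *)
Definition low (K : fieldType) (T : Type) (lv : T -> nat) (k : nat)
  (v : T -> K) : Prop := forall t, (lv t < k)%N -> v t = 0.

Definition wtw (d : nat) (wt : 'I_d -> nat) (w : seq 'I_d) : nat :=
  \sum_(i <- w) wt i.

Section Weights.
Variables (K : fieldType) (d : nat) (wt : 'I_d -> nat).
Local Notation series := (ncseries K d).
Implicit Types (f g h u : series) (w : seq 'I_d).
Local Notation wtw := (wtw wt).

Lemma wtw_nil : wtw [::] = 0%N. Proof. exact: big_nil. Qed.
Lemma wtw_cons i w : wtw (i :: w) = (wt i + wtw w)%N. Proof. exact: big_cons. Qed.
Lemma wtw_cat v w : wtw (v ++ w) = (wtw v + wtw w)%N. Proof. exact: big_cat. Qed.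

Lemma lowD k f g : low wtw k f -> low wtw k g -> low wtw k (f + g).
Proof. by move=> f0 g0 w wk; rewrite addsE f0 ?g0 ?addr0. Qed.
Lemma lowN k f : low wtw k f -> low wtw k (- f).
Proof. by move=> f0 w wk; rewrite oppsE f0 ?oppr0. Qed.
Lemma lowB k f g : low wtw k f -> low wtw k g -> low wtw k (f - g).
Proof. by move=> f0 g0; apply: lowD => //; apply: lowN. Qed.
Lemma lowZ k a f : low wtw k f -> low wtw k (a *: f).
Proof. by move=> f0 w wk; rewrite scalesE f0 ?mulr0. Qed.
Lemma low_sum k (T : Type) (r : seq T) (P : pred T) (F : T -> series) :
  (forall i, P i -> low wtw k (F i)) -> low wtw k (\sum_(i <- r | P i) F i).
Proof. by move=> F0; elim/big_ind: _ => //; exact: lowD. Qed.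
Lemma low_le k l f : (l <= k)%N -> low wtw k f -> low wtw l f.
Proof. by move=> lk f0 w wl; apply: f0; apply: leq_trans lk. Qed.
Lemma low0n f : low wtw 0 f. Proof. by []. Qed.

Lemma lowM k l f g : low wtw k f -> low wtw l g -> low wtw (k + l) (f * g).
Proof.
move=> f0 g0 w wkl; rewrite mulsE big1 // => j _.
have := wtw_cat (take j w) (drop j w); rewrite cat_take_drop => e.
case: (ltnP (wtw (take j w)) k) => c1; first by rewrite f0 ?mul0r.
by rewrite g0 ?mulr0 //; lia.
Qed.

Lemma lowMl k f g : low wtw k g -> low wtw k (f * g).
Proof. by move=> g0; rewrite -[k]add0n; apply: lowM. Qed.
Lemma lowMr k f g : low wtw k f -> low wtw k (f * g).
Proof. by move=> f0; rewrite -[k]addn0; apply: lowM. Qed.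

Lemma low_var i : low wtw (wt i) (var K i).
Proof.
move=> w wi; rewrite varE; case: eqP => // e; move: wi.
by rewrite e wtw_cons wtw_nil addn0 ltnn.
Qed.

Lemma low_lquo k i f : low wtw k f -> low wtw (k - wt i) (lquo i f).
Proof. by move=> f0 w wi; apply: f0; rewrite wtw_cons; lia. Qed.

Lemma low_nil k f : (0 < k)%N -> low wtw k f -> f [::] = 0.
Proof. by move=> k0; apply; rewrite wtw_nil. Qed.

Lemma low_eq0 f : (forall k, low wtw k f) -> f = 0.
Proof. by move=> f0; apply: seriesP => w; apply: (f0 (wtw w).+1). Qed.

End Weights.

Lemma wtw1 d (w : seq 'I_d) : wtw (fun=> 1%N) w = size w.
Proof. by rewrite /wtw sum1_size. Qed.

Lemma low_order_ge (K : fieldType) d k (f : ncseries K d) :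
  low (wtw (fun=> 1%N)) k f <-> order_ge k f.
Proof. by split=> f0 w wk; apply: f0; rewrite ?wtw1 // -wtw1. Qed.

Lemma order_ge_low (K : fieldType) d : @order_ge K d = low (@size 'I_d).
Proof. by []. Qed.

(** * Solving left recursions: actions and substitutions *)

(** Operators [X i] which raise the level extend to an action of all series: a
    word of length [n] raises the level by [n], so that only finitely many words
    contribute at a given point, and [actn] computes the value at [t] exactly
    after [lv t] steps.  Substitutions are the case of multiplication operators;
    the same construction yields the module that bounds Jacobi algebras from
    below. *)
Section Action.
Variables (K : fieldType) (d : nat) (T : Type) (lv : T -> nat).
Local Notation series := (ncseries K d).
Local Notation V := (T -> K).
Variable X : 'I_d -> V -> V.
Hypothesis X_lin : forall i a (v v' : V) t,
  X i (fun t => a * v t + v' t) t = a * X i v t + X i v' t.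
Hypothesis X_low : forall i k v, low lv k v -> low lv k.+1 (X i v).
Implicit Types (f g u : series) (v : V).

Fixpoint actn (n : nat) u v : V := fun t =>
  u [::] * v t + if n is n'.+1 then \sum_i X i (actn n' (lquo i u) v) t else 0.

Definition act u v : V := fun t => actn (lv t) u v t.

Let XB i v v' t : X i v t - X i v' t = X i (fun t => v t - v' t) t.
Proof.
transitivity (X i (fun t => -1 * v' t + v t) t); first by rewrite X_lin; ring.
by congr (X i _ t); apply/funext => s; ring.
Qed.

Lemma actn_stable n m u v : (n <= m)%N ->
  low lv n.+1 (fun t => actn m u v t - actn n u v t).
Proof.
elim: n m u => [|n IH] [|m] u //= nm t tn; rewrite ?addr0 ?subrr //.
  rewrite [X in X - _]addrC addrK; apply: big1 => i _.
  by apply: (@X_low _ 0).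
rewrite opprD addrACA subrr add0r -sumrB big1 // => i _.
by rewrite XB; apply: X_low tn; apply: IH.
Qed.

Lemma actE u v t : act u v t = u [::] * v t + \sum_i X i (act (lquo i u) v) t.
Proof.
transitivity (actn (lv t).+1 u v t).
  apply/eqP; rewrite eq_sym -subr_eq0; apply/eqP.
  exact: (actn_stable u v (leqnSn (lv t))).
rewrite /=; congr (_ + _); apply: eq_bigr => i _.
apply/eqP; rewrite -subr_eq0 XB; apply/eqP.
apply: (@X_low i (lv t).+1) => // s st; rewrite /act.
exact: (@actn_stable (lv s) (lv t) _ _ _ s).
Qed.

(** The difference of two solutions of the recursion has level at least [k] for
    every [k], by induction on [k]. *)
Lemma act_uniq (F : series -> V) v :
  (forall u t, F u t = u [::] * v t + \sum_i X i (F (lquo i u)) t) ->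
  forall u, F u = act u v.
Proof.
move=> FE u; apply/funext => t; apply/eqP; rewrite -subr_eq0; apply/eqP.
suff H k u' : low lv k (fun t => F u' t - act u' v t) by apply: (H (lv t).+1).
elim: k u' => [|k IH] u' s // sk.
rewrite FE actE opprD addrACA subrr add0r -sumrB big1 // => i _.
by rewrite XB; apply: X_low sk; apply: IH.
Qed.

Let X0 i t : X i (fun=> 0) t = 0.
Proof.
have := XB i (fun=> 0) (fun=> 0) t; rewrite subrr => e; rewrite [RHS]e.
by congr (X i _ t); apply/funext => s; rewrite subr0.
Qed.

Lemma act_linl a u u' v t : act (a *: u + u') v t = a * act u v t + act u' v t.
Proof.
apply/eqP; rewrite -subr_eq0; apply/eqP.
suff H k u1 u2 : low lv k (fun t =>
    act (a *: u1 + u2) v t - (a * act u1 v t + act u2 v t)).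
  exact: (H (lv t).+1).
elim: k u1 u2 => [|k IH] u1 u2 s // sk.
rewrite !actE addsE scalesE.
rewrite (_ : _ - _ = \sum_i (X i (act (lquo i (a *: u1 + u2)) v) s -
   (a * X i (act (lquo i u1) v) s + X i (act (lquo i u2) v) s))).
  rewrite big1 // => i _; rewrite -X_lin XB; apply: X_low sk; exact: IH.
rewrite sumrB big_split /= -mulr_sumr; ring.
Qed.

Lemma act_low k u v : low (@size _) k u -> low lv k (act u v).
Proof.
elim: k u => [|k IH] u u0 // t tk; rewrite actE u0 // mul0r add0r big1 // => i _.
by apply: X_low tk; apply: IH => w wk; apply: u0.
Qed.

Lemma act1 v : act 1 v = v.
Proof.
apply/funext => t; rewrite actE onesE mul1r big1 ?addr0 // => i _.
rewrite (_ : act _ v = fun=> 0) ?X0 // lquo1; apply/funext => s.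
by have := act_low (k := (lv s).+1) (u := 0) v; apply.
Qed.

Lemma act_var i v : act (var K i) v = X i v.
Proof.
apply/funext => t; rewrite actE varE mul0r add0r (bigD1 i) //= lquo_var eqxx.
rewrite act1 big1 ?addr0 // => j ji; rewrite lquo_var (negPf ji).
rewrite (_ : act _ v = fun=> 0) ?X0 //; apply/funext => s.
by have := act_low (k := (lv s).+1) (u := 0) v; apply.
Qed.

(** Both sides satisfy the same recursion in [u]. *)
Lemma actM u u' v : act (u * u') v = act u (act u' v).
Proof.
apply: (act_uniq (F := fun u => act (u * u') v)) => {}u t.
rewrite actE mulsE_nil actE.
rewrite (eq_bigr (fun i => u [::] * X i (act (lquo i u') v) t +
    X i (act (lquo i u * u') v) t)).
  by rewrite big_split -mulr_sumr /=; ring.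
move=> i _; rewrite -X_lin lquoM addrC; congr (X i _ t); apply/funext => s.
exact: act_linl.
Qed.

End Action.

(** Additive identities between series are checked coefficientwise, where the
    field decision procedure applies. *)
Ltac series_ring :=
  apply: seriesP => ?; rewrite ?(addsE, oppsE, scalesE, zerosE); ring.

Section Subst.
Variables (K : fieldType) (d d' : nat).
Local Notation series := (ncseries K d).
Local Notation series' := (ncseries K d').
Implicit Types (f g u : series) (phi psi : 'I_d -> series').

Definition nocst phi := forall i, phi i [::] = 0.

(** Substitution of [phi i] for the [i]-th variable.  Removing the constant terms
    of [phi] makes it a morphism unconditionally. *)
Definition subs phi f : series' :=
  act (@size 'I_d') (fun i v => (phi i - phi i [::] *: 1) * (v : series')) f (1 : series').

Let X phi := fun i (v : seq 'I_d' -> K) => (phi i - phi i [::] *: 1) * (v : series').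

Let X_lin phi i a (v v' : seq 'I_d' -> K) t :
  X phi i (fun t => a * v t + v' t) t = a * X phi i v t + X phi i v' t.
Proof.
rewrite /X (_ : (fun t => a * v t + v' t) = a *: (v : series') + (v' : series')) //.
by rewrite mulrDr -scalerAr.
Qed.

Lemma low1_nocst (f : series') : f [::] = 0 -> low (@size _) 1 f.
Proof. by move=> f0 w; rewrite ltnS leqn0 size_eq0 => /eqP ->. Qed.

Lemma low_sizeM k l (f g : series') :
  low (@size _) k f -> low (@size _) l g -> low (@size _) (k + l) (f * g).
Proof.
rewrite -!order_ge_low => /low_order_ge f0 /low_order_ge g0.
by apply/low_order_ge; apply: lowM.
Qed.

Let X_low phi i k (v : seq 'I_d' -> K) :
  low (@size _) k v -> low (@size _) k.+1 (X phi i v).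
Proof.
move=> v0; rewrite -[k.+1]add1n; apply: low_sizeM => //; apply: low1_nocst.
by rewrite addsE oppsE scalesE onesE mulr1 subrr.
Qed.

Fact subs_linear phi : linear (subs phi).
Proof.
move=> a u v; apply: seriesP => w.
exact: (act_linl (@X_lin phi) (@X_low phi)).
Qed.

Let act_mulr phi u (v : series') : act (@size _) (X phi) u v = subs phi u * v.
Proof.
symmetry; apply: (act_uniq (@X_lin phi) (@X_low phi)
   (F := fun u => (subs phi u * v : series'))) => {}u t.
have -> : subs phi u = u [::] *: 1 + \sum_i (phi i - phi i [::] *: 1) * subs phi (lquo i u).
  apply: seriesP => w; rewrite addsE scalesE sumsE.
  rewrite [LHS](actE (@X_lin phi) (@X_low phi)).
  by [].
rewrite mulrDl addsE -scalerAl mul1r scalesE mulr_suml sumsE; congr (_ + _).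
by apply: eq_bigr => i _; rewrite /X mulrA.
Qed.

Fact subs_monoid phi : monoid_morphism (subs phi).
Proof.
split; first exact: (act1 (@X_lin phi) (@X_low phi)).
move=> u v; rewrite -act_mulr.
exact: (actM (@X_lin phi) (@X_low phi)).
Qed.

HB.instance Definition _ phi :=
  GRing.isLinear.Build K series series' *:%R (subs phi) (subs_linear phi).
HB.instance Definition _ phi :=
  GRing.isMonoidMorphism.Build series series' (subs phi) (subs_monoid phi).

Lemma subsE phi f : nocst phi ->
  subs phi f = f [::] *: 1 + \sum_i phi i * subs phi (lquo i f).
Proof.
move=> phi0; apply: seriesP => w; rewrite addsE scalesE sumsE.
rewrite [LHS](actE (@X_lin phi) (@X_low phi)); congr (_ + _).
by apply: eq_bigr => i _; rewrite /X phi0 scale0r subr0.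
Qed.

Lemma subs_var phi i : nocst phi -> subs phi (var K i) = phi i.
Proof.
move=> phi0; rewrite /subs (act_var (@X_lin phi) (@X_low phi)).
by rewrite /X phi0 scale0r subr0 mulr1.
Qed.

Lemma subs_nil phi f : nocst phi -> subs phi f [::] = f [::].
Proof.
move=> phi0; rewrite subsE // addsE scalesE onesE mulr1 sumsE big1 ?addr0 // => i _.
by rewrite mulsE_nil phi0 mul0r.
Qed.

Section SubsLow.
Variables (wt : 'I_d -> nat) (wt' : 'I_d' -> nat).
Hypothesis wt_gt0 : forall i, (0 < wt i)%N.

Lemma subs_low phi k f : nocst phi -> (forall i, low (wtw wt') (wt i) (phi i)) ->
  low (wtw wt) k f -> low (wtw wt') k (subs phi f).
Proof.
move=> phi0 phil; elim/ltn_ind: k f => -[//|k] IH f f0.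
rewrite subsE // (low_nil _ f0) // scale0r add0r; apply: low_sum => i _.
case: (leqP (wt i) k.+1) => [le|lt].
  rewrite -(subnKC le); apply: lowM => //; apply: IH; last exact: low_lquo.
  by have := wt_gt0 i; lia.
by apply: lowMr; apply: low_le (phil i); exact: ltnW.
Qed.

(** Perturbing the substituted series by [psi], of weighted order [e] more than
    the variables, changes the result by terms of weighted order [e] more. *)
Lemma subs_perturb_low phi psi e k f : nocst phi -> nocst psi ->
  (forall i, low (wtw wt') (wt i) (phi i)) ->
  (forall i, low (wtw wt') (wt i + e) (psi i - phi i)) ->
  low (wtw wt) k f -> low (wtw wt') (k + e) (subs psi f - subs phi f).
Proof.
move=> phi0 psi0 phil psil; elim/ltn_ind: k f => -[|k] IH f f0.
  have {f0} IH1 n g : low (wtw wt') (minn n e) (subs psi g - subs phi g).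
    elim: n g => [|n IHn] g; first by rewrite min0n.
    rewrite !subsE // opprD addrACA subrr add0r -sumrB; apply: low_sum => i _.
    have -> : psi i * subs psi (lquo i g) - phi i * subs phi (lquo i g) =
       (psi i - phi i) * subs psi (lquo i g) + phi i * (subs psi (lquo i g) - subs phi (lquo i g)).
      by rewrite mulrBl mulrBr addrA subrK.
    apply: lowD; first by apply: lowMr; apply: low_le (psil i); lia.
    apply: (@low_le _ _ _ (wt i + minn n e)); first by have := wt_gt0 i; lia.
    exact: lowM.
  by have := IH1 e f; rewrite minnn.
rewrite !subsE // opprD addrACA subrr add0r -sumrB; apply: low_sum => i _.
have -> : psi i * subs psi (lquo i f) - phi i * subs phi (lquo i f) =
       (psi i - phi i) * subs psi (lquo i f) + phi i * (subs psi (lquo i f) - subs phi (lquo i f)).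
  by rewrite mulrBl mulrBr addrA subrK.
have w0 := wt_gt0 i.
have psil' j : low (wtw wt') (wt j) (psi j).
  have -> : psi j = (psi j - phi j) + phi j by rewrite subrK.
  by apply: lowD => //; apply: low_le (psil j); lia.
have f1 := low_lquo (i := i) f0.
apply: lowD.
  apply: (@low_le _ _ _ ((wt i + e) + (k.+1 - wt i))); first by lia.
  by apply: lowM => //; apply: subs_low.
apply: (@low_le _ _ _ (wt i + ((k.+1 - wt i) + e))); first by lia.
by apply: lowM => //; apply: IH => //; lia.
Qed.

End SubsLow.
End Subst.

Lemma size_low (K : fieldType) d k (f : ncseries K d) :
  low (wtw (fun=> 1%N)) k f -> low (@size _) k f.
Proof. by move/low_order_ge. Qed.

Lemma subs_id (K : fieldType) d (f : ncseries K d) : subs (@var K d) f = f.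
Proof.
apply/eqP; rewrite -subr_eq0; apply/eqP; apply: (@low_eq0 _ _ (fun=> 1%N)) => k.
elim: k f => [|k IH] f //; rewrite {2}(lquo_split f) subsE //.
rewrite opprD addrACA subrr add0r -sumrB; apply: low_sum => i _.
rewrite -mulrBr -[k.+1]add1n; apply: lowM; [exact: (@low_var _ _ (fun=> 1%N))|exact: IH].
Qed.

(** Both sides are morphisms with the same values on the variables, hence agree
    up to any order. *)
Lemma subs_comp (K : fieldType) d d' d'' (phi : 'I_d -> ncseries K d')
    (psi : 'I_d' -> ncseries K d'') f : nocst phi -> nocst psi ->
  subs psi (subs phi f) = subs (fun i => subs psi (phi i)) f.
Proof.
move=> phi0 psi0.
have pp0 : nocst (fun i => subs psi (phi i)) by move=> i; rewrite subs_nil.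
apply/eqP; rewrite -subr_eq0; apply/eqP; apply: (@low_eq0 _ _ (fun=> 1%N)) => k.
elim: k f => [|k IH] f //.
rewrite (subsE f phi0) (subsE f pp0) linearD linearZ rmorph1 linear_sum /=.
rewrite opprD addrACA subrr add0r -sumrB; apply: low_sum => i _.
rewrite rmorphM -mulrBr -[k.+1]add1n; apply: lowM; last exact: IH.
by apply/low_order_ge; apply: low1_nocst; apply: pp0.
Qed.

Lemma eq_subs (K : fieldType) d d' (phi psi : 'I_d -> ncseries K d') :
  phi =1 psi -> subs phi = subs psi.
Proof. by move=> e; congr subs; apply/funext. Qed.

(** * Limits of series and invertible substitutions *)

Section Limits.
Variables (K : fieldType) (d : nat) (wt : 'I_d -> nat).
Local Notation series := (ncseries K d).
Local Notation wtw := (wtw wt).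

Lemma series_limit (u : nat -> series) :
  (forall n, low wtw n (u n.+1 - u n)) ->
  exists l : series, forall n, low wtw n (l - u n).
Proof.
move=> u0; have ust n m w : (wtw w < n)%N -> (n <= m)%N -> u m w = u n w.
  move=> wn; elim: m => [|m IH]; first by rewrite leqn0 => /eqP ->.
  rewrite leq_eqVlt => /orP[/eqP <- //|nm]; rewrite -IH //.
  by apply/eqP; rewrite -subr_eq0; apply/eqP; apply: (u0 m); exact: leq_trans wn _.
exists (fun w => u (wtw w).+1 w) => n w wn.
by rewrite addsE oppsE (ust (wtw w).+1 n) ?subrr.
Qed.

End Limits.

Section InverseSubst.
Variables (K : fieldType) (d : nat) (wt : 'I_d -> nat).
Hypothesis wt_gt0 : forall i, (0 < wt i)%N.
Local Notation series := (ncseries K d).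
Local Notation wtw := (wtw wt).
Implicit Types (phi psi : 'I_d -> series) (f g : series).

Definition inverse_subs phi psi :=
  [/\ nocst phi, nocst psi, cancel (subs phi) (subs psi)
    & cancel (subs psi) (subs phi)].

Let unip phi := forall i, low wtw (wt i).+1 (phi i - var K i).

Let unip_low phi k f : nocst phi -> unip phi -> low wtw k f ->
  low wtw k.+1 (f - subs phi f).
Proof.
move=> phi0 phi1 f0; rewrite -opprB -{2}(subs_id f) -addn1; apply: lowN.
apply: subs_perturb_low f0 => // i; first exact: low_var.
by rewrite addn1; apply: phi1.
Qed.

Let unip_inj phi f : nocst phi -> unip phi -> subs phi f = 0 -> f = 0.
Proof.
move=> phi0 phi1 e; apply: (@low_eq0 _ _ wt); elim=> [|k IH] //.
by rewrite -[f]subr0 -e; apply: unip_low.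
Qed.

(** The solution of [f = g + (f - subs phi f)] is the limit of the iterates, the
    operator [f - subs phi f] raising the weight. *)
Let unip_surj phi g : nocst phi -> unip phi -> exists f, subs phi f = g.
Proof.
move=> phi0 phi1.
have [u u0 uS] : exists2 u : nat -> series,
    u 0%N = 0 & forall n, u n.+1 = g + (u n - subs phi (u n)).
  by exists (fun n => iter n (fun v => g + (v - subs phi v)) 0).
have [|f fu] := @series_limit K d wt u.
  elim=> [|n IH] //.
  have -> : u n.+2 - u n.+1 = (u n.+1 - u n) - subs phi (u n.+1 - u n).
    by rewrite raddfB /= (uS n.+1) [X in _ - X = _]uS; series_ring.
  exact: unip_low.
exists f; apply/eqP; rewrite -subr_eq0; apply/eqP.
apply: (@low_eq0 _ _ wt) => n.
have -> : subs phi f - g = (f - u n.+1) - ((f - u n) - subs phi (f - u n)).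
  by rewrite (raddfB (subs phi)) uS /=; series_ring.
apply: lowB; first by apply: low_le (fu n.+1).
by apply: (@low_le _ _ _ n.+1) => //; apply: unip_low.
Qed.

Let unip_inverse phi : nocst phi -> unip phi -> exists psi, inverse_subs phi psi.
Proof.
move=> phi0 phi1.
have /choice[psi psiP] i := unip_surj (var K i) phi0 phi1.
have psi0 : nocst psi by move=> i; rewrite -(subs_nil _ phi0) psiP varE.
have K1 : cancel (subs psi) (subs phi).
  by move=> f; rewrite subs_comp // (eq_subs psiP) subs_id.
exists psi; split=> // f; apply/eqP; rewrite -subr_eq0; apply/eqP.
by apply: (unip_inj phi0 phi1); rewrite raddfB /= K1 subrr.
Qed.

(** The inverse function theorem for substitutions whose leading part is
    diagonal: after rescaling the variables it is the identity up to an operator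
    raising the weight, hence invertible. *)
Lemma inverse_subs_exists (c : 'I_d -> K) phi : nocst phi ->
  (forall i, c i != 0) ->
  (forall i, low wtw (wt i).+1 (phi i - c i *: var K i)) ->
  exists psi, inverse_subs phi psi.
Proof.
move=> phi0 c0 phic.
pose s (a : 'I_d -> K) := fun i => a i *: var K i.
have s0 a : nocst (s a) by move=> i; rewrite /s scalesE varE mulr0.
pose phi' i := subs phi (s (fun i => (c i)^-1) i).
have phi'E i : phi' i = (c i)^-1 *: phi i by rewrite /phi' linearZ /= subs_var.
have [|i|psi' [phi'0 psi'0 K1 K2]] := @unip_inverse phi'.
- by move=> i; rewrite phi'E scalesE phi0 mulr0.
- have := lowZ (c i)^-1 (phic i).
  by rewrite scalerBr scalerA mulVf ?c0 // scale1r phi'E.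
have sK : cancel (subs (s c)) (subs (s (fun i => (c i)^-1))).
  move=> f; rewrite subs_comp // -[RHS]subs_id; congr subs; apply/funext => i.
  by rewrite linearZ /= subs_var // scalerA mulfV ?c0 // scale1r.
have phiE f : subs phi f = subs phi' (subs (s c) f).
  by rewrite -[in LHS](sK f) [LHS]subs_comp.
exists (fun i => subs (s (fun i => (c i)^-1)) (psi' i)); split=> //.
- by move=> i; rewrite subs_nil.
- by move=> f; rewrite -subs_comp // phiE K1 sK.
- by move=> f; rewrite -subs_comp // subs_comp // K2.
Qed.

End InverseSubst.

(** * Cyclic derivatives *)

Section CyclicDer.
Variables (K : fieldType) (d : nat).
Local Notation series := (ncseries K d).
Implicit Types (f g h u : series) (w : seq 'I_d).

Definition cut (i : 'I_d) g v : series := fun w => g (v ++ i :: w).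

(** The two-sided refinement of the cyclic derivative: it is linear in both
    series and sends [u x_i v] and [h] to the sum of [v h u] over the occurrences
    of [x_i].  Keeping track of [h] makes the Leibniz and chain rules provable
    from the left recursion [cder_rec] alone. *)
Definition cder (i : 'I_d) g h : series := fun w =>
  \sum_(b < (size w).+1) (cut i g (drop b w) * h) (take b w).

Lemma cder_linl i a g g' h : cder i (a *: g + g') h = a *: cder i g h + cder i g' h.
Proof.
apply: seriesP => w; rewrite addsE scalesE /cder mulr_sumr -big_split /=.
apply: eq_bigr => b _.
rewrite -[cut _ (a *: _ + _) _]/(a *: cut i g _ + cut i g' _).
by rewrite mulrDl -scalerAl.
Qed.

Lemma cder_linr i a g h h' : cder i g (a *: h + h') = a *: cder i g h + cder i g h'.
Proof.
apply: seriesP => w; rewrite addsE scalesE /cder mulr_sumr -big_split /=.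
by apply: eq_bigr => b _; rewrite mulrDr -scalerAr.
Qed.

Lemma cder0l i h : cder i 0 h = 0.
Proof. by have := cder_linl i (-1) 0 0 h; rewrite !scaleN1r !addNr. Qed.
Lemma cder0r i g : cder i g 0 = 0.
Proof. by have := cder_linr i (-1) g 0 0; rewrite !scaleN1r !addNr. Qed.
Lemma cderZl i a g h : cder i (a *: g) h = a *: cder i g h.
Proof. by rewrite -[a *: g]addr0 cder_linl cder0l addr0. Qed.
Lemma cderZr i a g h : cder i g (a *: h) = a *: cder i g h.
Proof. by rewrite -[a *: h]addr0 cder_linr cder0r addr0. Qed.
Lemma cderDl i g g' h : cder i (g + g') h = cder i g h + cder i g' h.
Proof. by have := cder_linl i 1 g g' h; rewrite !scale1r. Qed.
Lemma cderDr i g h h' : cder i g (h + h') = cder i g h + cder i g h'.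
Proof. by have := cder_linr i 1 g h h'; rewrite !scale1r. Qed.
Lemma cder_suml i (T : Type) (r : seq T) (P : pred T) (F : T -> series) h :
  cder i (\sum_(j <- r | P j) F j) h = \sum_(j <- r | P j) cder i (F j) h.
Proof. by elim/big_rec2: _ => [|j x y _ <-]; rewrite ?cder0l ?cderDl. Qed.
Lemma cder_sumr i (T : Type) (r : seq T) (P : pred T) g (F : T -> series) :
  cder i g (\sum_(j <- r | P j) F j) = \sum_(j <- r | P j) cder i g (F j).
Proof. by elim/big_rec2: _ => [|j x y _ <-]; rewrite ?cder0r ?cderDr. Qed.

Lemma cder_low i k g h : low (@size _) k h -> low (@size _) k (cder i g h).
Proof.
move=> h0 w wk; rewrite /cder big1 // => b _.
have := @low_order_ge K d k h; rewrite order_ge_low => /iffRL/(_ h0) h1.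
apply: (lowMl _ h1); rewrite wtw1; apply: leq_ltn_trans wk.
by rewrite size_take_min geq_minr.
Qed.

(** An occurrence of [x_i] is either the first letter, or to the right of the
    first letter [x_j], which is then moved behind [h]. *)
Lemma cder_rec i g h :
  cder i g h = lquo i g * h + \sum_j cder i (lquo j g) (h * var K j).
Proof.
apply: seriesP => w; rewrite addsE sumsE {1}/cder big_ord_recr /= addrC.
congr (_ + _); first by rewrite drop_size take_size.
rewrite /cder exchange_big /= big_ord_recl /= [X in X + _]big1 ?add0r; last first.
  by move=> j _; rewrite take0 mulrA mul_var_nil.
apply: eq_bigr => b _; rewrite /bump leq0n add1n.
case: w b => [[]//|x0 w'] b; set w := x0 :: w' in b *.
rewrite (take_nth x0) // (drop_nth x0) //; set c := nth x0 w b.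
rewrite (bigD1 c) //= mulrA mul_varE eqxx mul1r big1 ?addr0 // => j jc.
by rewrite mulrA mul_varE eq_sym (negPf jc) mul0r.
Qed.

Lemma cder1l i h : cder i 1 h = 0.
Proof.
rewrite cder_rec lquo1 mul0r add0r big1 // => j _.
by rewrite lquo1 cder0l.
Qed.

Lemma cder_var i j h : cder i (var K j) h = (i == j)%:R *: h.
Proof.
rewrite cder_rec lquo_var big1 ?addr0; last first.
  by move=> k _; rewrite lquo_var; case: eqP; rewrite ?cder1l ?cder0l.
by case: eqP; rewrite ?mul1r ?scale1r ?mul0r ?scale0r.
Qed.

(** Summing over the positions [j] of the letter removed from a monomial is the
    same as summing over the ways of cutting the resulting word at the place
    where the rotation starts, [size w - j]. *)
Lemma cyclic_derivative_cder i f : cyclic_derivative i f = cder i f 1.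
Proof.
apply: seriesP => w; rewrite /cyclic_derivative /cder.
set n := size w.
transitivity (\sum_(j < n.+1) f (drop (n - j) w ++ i :: take (n - j) w)); last first.
  rewrite (reindex_inj rev_ord_inj) /=; apply: eq_bigr => b _.
  by rewrite mulr1 subSS subKn // -ltnS.
pose P (j : nat) (m : seq 'I_d) := (nth i m j == i) && (drop j.+1 m ++ take j m == w).
transitivity (\sum_(m : n.+1.-tuple 'I_d) \sum_(j < n.+1) f m * (P j m)%:R).
  apply: eq_bigr => m _; rewrite -mulr_sumr; congr (_ * _).
  rewrite /cyclic_derivative_word count_map count_filter size_tuple -sum1_count.
  rewrite -[iota _ _]/(index_iota 0 n.+1) big_mkcond natr_sum big_mkord.
  by apply: eq_bigr => j _; rewrite /P /= andbC; case: ifP.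
rewrite exchange_big /=; apply: eq_bigr => j _.
have jn : (j <= n)%N by rewrite -ltnS.
have sz : size (drop (n - j) w ++ i :: take (n - j) w) == n.+1.
  by rewrite size_cat /= size_drop size_take_min -/n (minn_idPl _) ?leq_subr //; apply/eqP; lia.
rewrite (bigD1 (Tuple sz)) //= big1 ?addr0; last first.
  move=> m m_neq; rewrite /P; case: eqP => [mj|_]; last by rewrite /= mulr0.
  case: eqP => [mw|_]; last by rewrite /= mulr0.
  case/eqP: m_neq; apply: val_inj => /=.
  have szd : size (drop j.+1 m) = (n - j)%N by rewrite size_drop size_tuple subSS.
  rewrite -mw drop_size_cat // take_size_cat // -[i in _ ++ i :: _]mj -drop_nth ?cat_take_drop //.
  by rewrite size_tuple.
have szd : size (drop (n - j) w) = j by rewrite size_drop subKn.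
rewrite /P nth_cat szd ltnn subnn eqxx /=.
rewrite take_size_cat // -cat_rcons drop_size_cat ?size_rcons ?szd //.
by rewrite cat_take_drop eqxx mulr1.
Qed.

(** The Leibniz rule.  Comparing the recursions moves one letter of [f] behind
    [h], which gains one degree; hence the induction has to range over all [h],
    with their order [a] recorded. *)
Lemma cderM i f g h : cder i (f * g) h = cder i f (g * h) + cder i g (h * f).
Proof.
apply/eqP; rewrite -subr_eq0; apply/eqP.
suff H k f' h' a : low (@size _) a h' -> low (@size _) (a + k)
    (cder i (f' * g) h' - (cder i f' (g * h') + cder i g (h' * f'))).
  by apply: (@low_eq0 _ _ (fun=> 1%N)) => k; apply/low_order_ge; apply: (H k f h 0%N).
have M k1 k2 (u v : series) : low (@size _) k1 u -> low (@size _) k2 v ->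
    low (@size _) (k1 + k2) (u * v) by exact: low_sizeM.
elim: k f' h' a => [|k IH] f' h' a h0.
  have A (u v : series) : low (@size _) a u -> low (@size _) a v -> low (@size _) a (u + v).
    by move=> u0 v0 w wa; rewrite addsE u0 // v0 // addr0.
  rewrite addn0; apply: A; first exact: cder_low.
  have [h1 h2] : low (@size _) a (g * h') /\ low (@size _) a (h' * f').
    by split; [rewrite -[a]add0n|rewrite -[a]addn0]; apply: M.
  by move=> w wa; rewrite oppsE addsE (cder_low _ _ h1 wa) (cder_low _ _ h2 wa) addr0 oppr0.
rewrite {1}(cder_rec i (f' * g)) lquoM (cder_rec i f').
rewrite [X in cder i g (h' * X)](lquo_split f') mulrDr cderDr -scalerAr mulr1 cderZr.
rewrite (cder_rec i g h') mulr_sumr cder_sumr.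
rewrite (_ : _ - _ = \sum_j (cder i (lquo j f' * g) (h' * var K j) -
   (cder i (lquo j f') (g * (h' * var K j)) + cder i g (h' * var K j * lquo j f')))).
  move=> w wk; rewrite sumsE big1 // => j _; apply: (IH _ _ a.+1); last first.
    by rewrite addSnnS.
  rewrite -addn1; apply: M => //; exact: low1_nocst.
rewrite sumrB big_split /=.
rewrite (eq_bigr (fun j => cder i (lquo j f' * g) (h' * var K j) +
    f' [::] *: cder i (lquo j g) (h' * var K j))); last first.
  by move=> j _; rewrite lquoM cderDl cderZl.
rewrite big_split /= -scaler_sumr scalerDr mulrDl -scalerAl mulrA.
rewrite [X in _ - (_ + X + _)](eq_bigr (fun j => cder i (lquo j f') (g * (h' * var K j))));
  last by move=> j _; rewrite mulrA.
rewrite [X in _ - (_ + (_ + X))](eq_bigr (fun j => cder i g (h' * var K j * lquo j f')));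
  last by move=> j _; rewrite mulrA.
set A := _ * g * _; set B := _ *: (_ * _); set C := \sum_j _; set D := \sum_j _.
by set E := \sum_j _; set F := \sum_j _; series_ring.
Qed.

End CyclicDer.

(** The chain rule: in [subs phi f] the letter removed comes from the factor
    [phi j] substituted for some occurrence of [x_j]; the surrounding factors are
    [cder j f h] after substitution.  The order of [h] is tracked as for the
    Leibniz rule. *)
Lemma cder_subs (K : fieldType) d d' (phi : 'I_d -> ncseries K d') k f h :
  nocst phi ->
  cder k (subs phi f) (subs phi h) = \sum_j cder k (phi j) (subs phi (cder j f h)).
Proof.
move=> phi0; apply/eqP; rewrite -subr_eq0; apply/eqP.
pose sz := @size 'I_d'.
suff H n (f' h' : ncseries K d) a : low (@size _) a h' -> low sz (a + n)
    (cder k (subs phi f') (subs phi h') - \sum_j cder k (phi j) (subs phi (cder j f' h'))).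
  by apply: (@low_eq0 _ _ (fun=> 1%N)) => n; apply/low_order_ge; apply: (H n f h 0%N).
have S m0 u : low (@size _) m0 u -> low sz m0 (subs phi u).
  rewrite /sz -!order_ge_low => /low_order_ge u0; apply/low_order_ge.
  apply: (@subs_low _ _ _ (fun=> 1%N)) => // i; apply/low_order_ge; exact: low1_nocst.
elim: n f' h' a => [|n IH] f' h' a h0.
  rewrite addn0 => w wa; rewrite addsE oppsE sumsE (@cder_low _ _ _ a) ?sub0r //; last exact: S.
  rewrite big1 ?oppr0 // => j _; apply: (@cder_low _ _ _ a) => //; apply: S.
  exact: cder_low.
rewrite (subsE f' phi0) cderDl cderZl cder1l scaler0 add0r cder_suml.
under eq_bigr do rewrite cderM.
under [X in _ - X]eq_bigr => j _ do rewrite (cder_rec j) linearD rmorphM linear_sum cderDr cder_sumr /=.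
rewrite !big_split /= exchange_big /= opprD addrACA subrr add0r -sumrB.
move=> w wk; rewrite sumsE big1 // => i _.
have -> : subs phi h' * phi i = subs phi (h' * var K i) by rewrite rmorphM /= subs_var.
apply: (IH _ _ a.+1); last by rewrite addSnnS.
by rewrite -addn1; apply: low_sizeM => //; exact: low1_nocst.
Qed.

(** * Closed ideals and isomorphisms of Jacobi algebras *)

Lemma cyclic_derivativeE (K : fieldType) d i (f : ncseries K d) w :
  cyclic_derivative i f w = \sum_(b < (size w).+1) f (drop b w ++ i :: take b w).
Proof. by rewrite cyclic_derivative_cder /cder; apply: eq_bigr => b _; rewrite mulr1. Qed.

Lemma cyclic_derivativeD (K : fieldType) d i (f g : ncseries K d) :
  cyclic_derivative i (f + g) = cyclic_derivative i f + cyclic_derivative i g.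
Proof. by rewrite !cyclic_derivative_cder cderDl. Qed.

Lemma cyclic_derivativeZ (K : fieldType) d i a (f : ncseries K d) :
  cyclic_derivative i (a *: f) = a *: cyclic_derivative i f.
Proof. by rewrite !cyclic_derivative_cder cderZl. Qed.

Lemma cyclic_derivative_sum (K : fieldType) d i (T : Type) (r : seq T) (P : pred T)
    (F : T -> ncseries K d) :
  cyclic_derivative i (\sum_(j <- r | P j) F j) = \sum_(j <- r | P j) cyclic_derivative i (F j).
Proof.
by rewrite cyclic_derivative_cder cder_suml; under [RHS]eq_bigr do rewrite cyclic_derivative_cder.
Qed.

(** The cyclic derivatives are insensitive to cyclic rotation. *)
Lemma cyclic_derivativeC (K : fieldType) d i (f g : ncseries K d) :
  cyclic_derivative i (f * g) = cyclic_derivative i (g * f).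
Proof. by rewrite !cyclic_derivative_cder !cderM !mul1r !mulr1 addrC. Qed.

Lemma cyclic_derivative_low (K : fieldType) d (wt : 'I_d -> nat) k i (f : ncseries K d) :
  low (wtw wt) k f -> low (wtw wt) (k - wt i) (cyclic_derivative i f).
Proof.
move=> f0 w wk; rewrite cyclic_derivativeE big1 // => b _; apply: f0.
rewrite wtw_cat wtw_cons addnCA [X in (wt i + X)%N]addnC -wtw_cat cat_take_drop; lia.
Qed.

Section IdealOps.
Variables (A : pzRingType) (S : set A).
Hypothesis S_ideal : two_sided_ideal S.
Implicit Types u v w : A.

Lemma ideal0 : S 0. Proof. by case: S_ideal => [[]]. Qed.
Lemma idealD u v : S u -> S v -> S (u + v).
Proof. by case: S_ideal => [[_ + _] _]; apply. Qed.
Lemma idealMl u v : S v -> S (u * v).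
Proof. by case: S_ideal => [[_ _ +] _]; apply. Qed.
Lemma idealMr u v : S u -> S (u * v).
Proof. by case: S_ideal => [_ +]; apply. Qed.
Lemma idealN u : S u -> S (- u).
Proof. by rewrite -mulN1r; apply: idealMl. Qed.
Lemma idealB u v : S u -> S v -> S (u - v).
Proof. by move=> Su Sv; apply: idealD => //; apply: idealN. Qed.
Lemma ideal_sum (T : Type) (r : seq T) (P : pred T) (F : T -> A) :
  (forall i, P i -> S (F i)) -> S (\sum_(i <- r | P i) F i).
Proof. by move=> SF; elim/big_ind: _ => //; [exact: ideal0 | exact: idealD]. Qed.
Lemma idealB_iff u v : S (u - v) -> S u <-> S v.
Proof.
move=> Suv; split=> [Su|Sv]; last by rewrite -(subrK v u); apply: idealD.
by rewrite -(subKr u v); apply: idealB.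
Qed.
End IdealOps.

Section ClosedIdeals.
Variables (K : fieldType) (d : nat).
Local Notation series := (ncseries K d).
Implicit Types (f g h u v : series) (S : set series).

Definition closed_ideal S := two_sided_ideal S /\
  forall u, (forall k, exists2 s, S s & order_ge k (u - s)) -> S u.


Lemma idealZ (S : set series) a u : two_sided_ideal S -> S u -> S (a *: u).
Proof. by move=> SI Su; rewrite -mulr_algl; apply: idealMl. Qed.

Lemma ideal_pow_maxideal k u : ideal_pow (@series_maxideal K d) k u <-> order_ge k u.
Proof.
split.
  elim: k u => [//|k IH] u; apply; split; last first.
    move=> _ [a a0 [b /IH b0 <-]]; rewrite -[k.+1]add1n.
    by apply: low_sizeM b0; apply: low1_nocst.
  split; first split=> //.
  - by move=> x y x0 y0 w wk; rewrite addsE x0 // y0 // addr0.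
  - by move=> a x x0; rewrite -[k.+1]add0n; apply: low_sizeM x0.
  - by move=> x a x0; rewrite -[k.+1]addn0; apply: low_sizeM.
elim: k u => [//|k IH] u u0; rewrite (lquo_split u) u0 // scale0r add0r.
apply: ideal_sum => [|i _]; first exact: ideal_pow_ideal.
move=> M [_]; apply; exists (var K i); first by rewrite /series_maxideal /= varE.
by exists (lquo i u) => //; apply: IH => w wk; apply: u0.
Qed.

Lemma adic_closureP S u :
  adic_closure S u <-> forall k, exists2 s, S s & order_ge k (u - s).
Proof.
split=> [H k|H k _].
  have [s Ss [m /ideal_pow_maxideal m0 <-]] := H k I.
  by exists s => //; rewrite addrC addKr.
have [s Ss m0] := H k; exists s => //; exists (u - s); first exact/ideal_pow_maxideal.
by rewrite addrC subrK.
Qed.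

Local Notation Id f := (ideal_set (jacobi_ideal f)).

Lemma jacobi_two_sided f : two_sided_ideal (Id f).
Proof. exact: ideal_setP. Qed.

Lemma jacobi_closed f : closed_ideal (Id f).
Proof.
split=> [|u H]; first exact: jacobi_two_sided.
apply/adic_closureP => k; have [s /adic_closureP/(_ k)[s' Ss' m1] m2] := H k.
exists s' => // w wk; rewrite -(subrK s u) -addrA addsE m2 // m1 ?addr0 //.
Qed.

Lemma jacobi_der f i : Id f (cyclic_derivative i f).
Proof.
apply/adic_closureP => k; exists (cyclic_derivative i f).
  by move=> M [_]; apply; exists i.
by rewrite subrr.
Qed.

(** The universal property through which all inclusions of the Jacobi ideal are
    proved: it is the least closed ideal containing the cyclic derivatives. *)
Lemma jacobi_min f S : closed_ideal S ->
  (forall i, S (cyclic_derivative i f)) -> forall u, Id f u -> S u.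
Proof.
move=> [SI Sc] Sf u /adic_closureP fu; apply: Sc => k.
have [s Is s0] := fu k; exists s => //.
by apply: Is; split=> // _ [i _ <-].
Qed.

(** By [cder_rec], [cder i g h] is a convergent sum of products having [h] as a
    factor. *)
Lemma closed_cder S i g h : closed_ideal S -> S h -> S (cder i g h).
Proof.
move=> [SI Sc] Sh; apply: Sc => k.
suff H g' h' a : S h' -> order_ge a h' ->
    exists2 s, S s & order_ge (a + k) (cder i g' h' - s) by exact: (H g h 0%N).
elim: k g' h' a => [|k IH] g' h' a Sh' h0.
  exists 0; first exact: ideal0.
  by rewrite subr0 addn0; apply: cder_low.
have /choice[s sP] j : exists s, S s /\
    order_ge (a.+1 + k) (cder i (lquo j g') (h' * var K j) - s).
  have [||s Ss s0] := IH (lquo j g') (h' * var K j) a.+1; first exact: idealMr.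
    by rewrite -addn1; apply: low_sizeM => //; apply: low1_nocst.
  by exists s.
exists (lquo i g' * h' + \sum_j s j).
  apply: idealD => //; first exact: idealMl.
  by apply: ideal_sum => // j _; case: (sP j).
rewrite cder_rec opprD addrACA subrr add0r -sumrB -addSnnS => w wk.
by rewrite sumsE big1 // => j _; case: (sP j) => _ /(_ w wk).
Qed.

Lemma closed_preim (phi : 'I_d -> series) S : nocst phi -> closed_ideal S ->
  closed_ideal (fun u => S (subs phi u)).
Proof.
move=> phi0 [SI Sc]; split.
  split; first split.
  - by rewrite raddf0; apply: ideal0.
  - by move=> x y Sx Sy; rewrite raddfD; apply: idealD.
  - by move=> a x Sx; rewrite rmorphM; apply: idealMl.
  - by move=> x a Sx; rewrite rmorphM; apply: idealMr.
move=> u H; apply: Sc => k; have [s Ss s0] := H k.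
exists (subs phi s) => //; rewrite -raddfB; apply/low_order_ge.
apply: (@subs_low _ _ _ (fun=> 1%N)) => //; last exact/low_order_ge.
by move=> i; apply/low_order_ge; apply: low1_nocst.
Qed.

(** The isomorphisms of Jacobi algebras constructed below all come from
    substitutions; surjectivity is required of the substitution itself, while
    injectivity is contained in the equivalence of the two ideals. *)
Definition subs_iso f g := exists phi : 'I_d -> series,
  [/\ nocst phi, forall v, exists u, subs phi u = v
    & forall u, Id f u <-> Id g (subs phi u)].

Lemma subs_iso_trans g f h : subs_iso f g -> subs_iso g h -> subs_iso f h.
Proof.
move=> [phi [phi0 phis phiI]] [psi [psi0 psis psiI]].
exists (fun i => subs psi (phi i)); split.
- by move=> i; rewrite subs_nil.
- move=> v; have [u <-] := psis v; have [t <-] := phis u.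
  by exists t; rewrite subs_comp.
- by move=> u; rewrite -subs_comp // -psiI.
Qed.

Lemma subs_iso_Jac_iso f g : subs_iso f g -> Jac_iso f g.
Proof.
move=> [phi [phi0 phis phiI]].
pose F (q : Jac f) : Jac g := quotient_proj (jacobi_ideal g) (subs phi (repr q)).
have FE u : F (quotient_proj _ u) = quotient_proj _ (subs phi u).
  apply/quotient_projP; rewrite -raddfB -phiI.
  by apply/quotient_projP; rewrite quotient_projK.
have Fz : zmod_morphism F.
  move=> x y; rewrite -(quotient_projK x) -(quotient_projK y).
  have e (h : series) (a b : series) : quotient_proj (jacobi_ideal h) a -
     quotient_proj (jacobi_ideal h) b = quotient_proj (jacobi_ideal h) (a - b).
    by apply/eqP; rewrite subr_eq -quotient_projD subrK.
  by rewrite e !FE e raddfB.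
have Fm : monoid_morphism F.
  split; first by have := FE 1; rewrite rmorph1.
  move=> x y; rewrite -(quotient_projK x) -(quotient_projK y).
  rewrite -[_ * _]/(quotient_mul _ _) -quotient_projM !FE rmorphM.
  by rewrite quotient_projM.
pose pA := GRing.isZmodMorphism.Build _ _ F Fz.
pose pM := GRing.isMonoidMorphism.Build _ _ F Fm.
pose P : {rmorphism Jac f -> Jac g} := HB.pack F pA pM.
exists P.
  move=> a x; rewrite -(quotient_projK x) -[_ *: _]/(quotient_scale _ _).
  by rewrite -quotient_projZ [LHS]FE [P _]FE linearZ /= quotient_projZ.
have /choice[G GP] q : exists t, F t = q.
  have [u e] := phis (repr q); exists (quotient_proj _ u).
  by rewrite FE e quotient_projK.
exists G => [x|x]; last exact: GP.
rewrite -[LHS](quotient_projK) -[RHS]quotient_projK; apply/quotient_projP.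
by rewrite phiI raddfB; apply/quotient_projP; exact: GP.
Qed.

(** By the chain rule, the cyclic derivatives of [f] are sums of terms
    [cder i (psi j) h] with [h] the image of a cyclic derivative of [g]. *)
Let subs_iso_half phi psi f g : inverse_subs phi psi ->
  (forall i, cyclic_derivative i f = cyclic_derivative i (subs psi g)) ->
  forall u, Id f u -> Id g (subs phi u).
Proof.
move=> [phi0 psi0 K1 K2] fE; apply: jacobi_min.
  exact: closed_preim (jacobi_closed g).
have C := closed_preim phi0 (jacobi_closed g).
move=> i; rewrite fE cyclic_derivative_cder -(rmorph1 (subs psi)) cder_subs //.
apply: (ideal_sum C.1) => j _; apply: (closed_cder _ _ C).
by rewrite K2 -cyclic_derivative_cder; apply: jacobi_der.
Qed.

(** If [g] and [f] composed with an invertible substitution have the same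
    cyclic derivatives, the chain rule identifies the two Jacobi ideals. *)
Lemma subs_iso_cyc phi psi f g : inverse_subs phi psi ->
  (forall i, cyclic_derivative i g = cyclic_derivative i (subs phi f)) ->
  subs_iso f g.
Proof.
move=> ip gE; have [phi0 psi0 K1 K2] := ip.
have ip' : inverse_subs psi phi by split.
have fE i : cyclic_derivative i f = cyclic_derivative i (subs psi g).
  rewrite -[in LHS](K1 f) !cyclic_derivative_cder -(rmorph1 (subs psi)) !cder_subs //.
  by apply: eq_bigr => j _; rewrite -!cyclic_derivative_cder gE.
exists phi; split=> // [v|u]; first by exists (subs psi v).
split; first exact: (subs_iso_half ip fE).
by move=> /(subs_iso_half ip' gE); rewrite K1.
Qed.

Lemma eq_subs_iso f g : (forall i, cyclic_derivative i g = cyclic_derivative i f) ->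
  subs_iso f g.
Proof.
move=> e; apply: (@subs_iso_cyc (@var K d) (@var K d)); last by move=> i; rewrite subs_id.
by split=> // u; rewrite !subs_id.
Qed.

End ClosedIdeals.

Notation jId f := (ideal_set (jacobi_ideal f)).
Notation qpr f := (quotient_proj (jacobi_ideal f)).

(** * The Jacobson radical of a Jacobi algebra *)

Section Radical.
Variables (K : fieldType) (d : nat).
Local Notation series := (ncseries K d).
Implicit Types (f g h u v : series).

(** The geometric series, obtained by substitution into the one in one variable. *)
Lemma series_rinv u : u [::] != 0 -> exists v, u * v = 1.
Proof.
move=> u0; pose geom : ncseries K 1 := fun=> 1.
have gE : geom = 1 + var K ord0 * geom.
  by rewrite {1}(lquo_split geom) big_ord1 scale1r.
pose eta : series := 1 - (u [::])^-1 *: u.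
have eta0 : nocst (fun _ : 'I_1 => eta).
  by move=> _; rewrite /eta addsE oppsE scalesE onesE mulVf ?subrr.
exists ((u [::])^-1 *: subs (fun=> eta) geom).
rewrite -scalerAr scalerAl; have -> : (u [::])^-1 *: u = 1 - eta by rewrite subKr.
rewrite {1}gE (raddfD (subs _)) /= rmorph1 rmorphM /= subs_var //.
set S := subs _ _; have e : S = 1 + eta * S.
  by rewrite /S {1}gE (raddfD (subs _)) /= rmorph1 rmorphM /= subs_var.
by rewrite -e mulrBl mul1r {1}e addrK.
Qed.

Lemma series_inv u : u [::] != 0 -> exists v, u * v = 1 /\ v * u = 1.
Proof.
move=> u0; have [v uv] := series_rinv u0.
have v0 : v [::] != 0.
  by apply: contraNneq (oner_neq0 K) => e; rewrite -[1](congr1 (fun h : series => h [::]) uv) mulsE_nil e mulr0.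
have [w vw] := series_rinv v0; exists v; split=> //.
by have -> : u = w by rewrite -[u]mulr1 -vw mulrA uv mul1r.
Qed.

Lemma jacobi_nocst f u : order_ge 2 f -> jId f u -> u [::] = 0.
Proof.
move=> f2; apply: (@jacobi_min _ _ f (fun u => u [::] = 0)).
  split.
    split; first split=> //.
    - by move=> x y x0 y0; rewrite addsE x0 y0 addr0.
    - by move=> a x x0; rewrite mulsE_nil x0 mulr0.
    - by move=> a x x0; rewrite mulsE_nil x0 mul0r.
  by move=> v /(_ 1%N)[s s0 /(_ [::] isT)]; rewrite addsE oppsE s0 subr0.
by move=> i; rewrite cyclic_derivativeE big1 // => b _; apply: f2; rewrite size_cat.
Qed.

Lemma qprM f u v : qpr f (u * v) = qpr f u * qpr f v. Proof. exact: quotient_projM. Qed.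
Lemma qprD f u v : qpr f (u + v) = qpr f u + qpr f v. Proof. exact: quotient_projD. Qed.
Lemma qpr1 f : qpr f 1 = 1. Proof. by []. Qed.
Lemma qprZ f a u : qpr f (a *: u) = a *: qpr f u. Proof. exact: quotient_projZ. Qed.
Lemma qprB f u v : qpr f (u - v) = qpr f u - qpr f v.
Proof. by apply/eqP; rewrite eq_sym subr_eq -qprD subrK. Qed.
Lemma qpr0 f : qpr f 0 = 0. Proof. by rewrite -(subrr 0) qprB subrr. Qed.
Lemma qpr_eq0 f u : qpr f u = 0 <-> jId f u.
Proof. by rewrite -(qpr0 f) quotient_projP subr0. Qed.
Lemma qpr_sum f (T : Type) (r : seq T) (P : pred T) (F : T -> series) :
  qpr f (\sum_(j <- r | P j) F j) = \sum_(j <- r | P j) qpr f (F j).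
Proof. by elim/big_rec2: _ => [|j x y _ <-]; rewrite ?qpr0 ?qprD. Qed.

(** The series without constant term give a left ideal whose complement consists
    of units; it is therefore the only maximal left ideal. *)
Lemma jacobson_radicalP f : order_ge 2 f -> forall u : series,
  @jacobson_radical (Jac f) (qpr f u) <-> u [::] = 0.
Proof.
move=> f2.
pose M0 : set (Jac f) := fun q => exists2 u, q = qpr f u & u [::] = 0.
have M0E u : M0 (qpr f u) <-> u [::] = 0.
  split=> [[v /quotient_projP /(jacobi_nocst f2)]|u0]; last by exists u.
  by rewrite addsE oppsE => /eqP; rewrite subr_eq0 => /eqP ->.
have M0l : left_ideal M0.
  split.
  - by exists 0; rewrite ?qpr0.
  - move=> _ _ [u -> u0] [v -> v0]; exists (u + v); rewrite ?qprD //.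
    by rewrite addsE u0 v0 addr0.
  - move=> a _ [u -> u0]; rewrite -(quotient_projK a) -qprM; exists (repr a * u) => //.
    by rewrite mulsE_nil u0 mulr0.
have M01 : ~ M0 1 by rewrite -qpr1 M0E onesE; apply/eqP/oner_neq0.
have sub (N : set (Jac f)) : left_ideal N -> ~ N 1 -> N `<=` M0.
  move=> [_ _ Nm] N1 q Nq; rewrite -(quotient_projK q) M0E.
  apply/eqP; apply: contrapT => /negP /series_inv[v [_ vq]]; apply: N1.
  by rewrite -qpr1 -vq qprM quotient_projK; apply: Nm.
move=> u; rewrite -M0E; split.
  by apply; split=> // N Nl N1 M0N; apply/seteqP; split=> //; apply: sub.
move=> M0u N [Nl N1 Nmax]; rewrite -(Nmax M0) //; exact: sub.
Qed.

Lemma radical_powP f k : order_ge 2 f -> forall q : Jac f,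
  ideal_pow (@jacobson_radical (Jac f)) k q <-> exists2 u, q = qpr f u & order_ge k u.
Proof.
move=> f2; split.
  elim: k q => [|k IH] q; first by exists (repr q); rewrite ?quotient_projK.
  move/(_ (fun q => exists2 u, q = qpr f u & order_ge k.+1 u)); apply; split; last first.
    move=> _ [a +] [b /IH[v -> v0]] <-; rewrite -(quotient_projK a) => /(jacobson_radicalP f2) u0.
    exists (repr a * v); rewrite ?qprM // -[k.+1]add1n.
    by apply: low_sizeM => //; apply: low1_nocst.
  split; first split.
  - by exists 0; rewrite ?qpr0.
  - move=> _ _ [u -> u0] [v -> v0]; exists (u + v); rewrite ?qprD //.
    by move=> w wk; rewrite addsE u0 // v0 // addr0.
  - move=> a _ [u -> u0]; rewrite -(quotient_projK a) -qprM; exists (repr a * u) => //.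
    by rewrite -[k.+1]add0n; apply: low_sizeM.
  - move=> _ a [u -> u0]; rewrite -(quotient_projK a) -qprM; exists (u * repr a) => //.
    by rewrite -[k.+1]addn0; apply: low_sizeM.
move=> [u -> {q}]; elim: k u => [//|k IH] u u0.
rewrite (lquo_split u) u0 // scale0r add0r qpr_sum.
apply: ideal_sum => [|i _]; first exact: ideal_pow_ideal.
rewrite qprM => M [_]; apply; exists (qpr f (var K i)); first exact/jacobson_radicalP.
by exists (qpr f (lquo i u)) => //; apply: IH => w wk; apply: u0.
Qed.

Lemma radical_pow_qpr f k : order_ge 2 f -> forall u,
  ideal_pow (@jacobson_radical (Jac f)) k (qpr f u) <->
  exists2 v, order_ge k v & jId f (u - v).
Proof.
move=> f2 u; rewrite radical_powP //.
by split=> [[v /quotient_projP uv v0]|[v v0 uv]]; exists v => //; apply/quotient_projP.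
Qed.

(** A bijective ring morphism with its inverse as plain functions, so that the
    two directions can be exchanged. *)
Definition Jac_bij f g (F : Jac f -> Jac g) (G : Jac g -> Jac f) :=
  [/\ cancel F G, cancel G F, additive F & F 1 = 1 /\ {morph F : x y / x * y}].

Lemma Jac_iso_bij f g : Jac_iso f g -> exists F G,
  [/\ @Jac_bij f g F G, @Jac_bij g f G F & scalable F].
Proof.
move=> [phi phiZ [psi K1 K2]]; exists phi, psi; split=> //.
  by split=> //; [exact: raddfB|split; [exact: rmorph1|exact: rmorphM]].
split=> //; first by move=> x y; apply: (can_inj K1); rewrite raddfB /= !K2.
split; first by rewrite -(rmorph1 phi) K1.
by move=> x y; apply: (can_inj K1); rewrite rmorphM /= !K2.
Qed.

(** The radical is the set of non-units, which every isomorphism preserves; its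
    powers follow by minimality of the generated ideals. *)
Lemma Jac_bij_pow f g F G k : order_ge 2 f -> order_ge 2 g ->
  @Jac_bij f g F G -> Jac_bij G F -> forall q : Jac f,
  ideal_pow (@jacobson_radical (Jac f)) k q <-> ideal_pow (@jacobson_radical (Jac g)) k (F q).
Proof.
have half f' g' (F' : Jac f' -> Jac g') (G' : Jac g' -> Jac f') :
    order_ge 2 f' -> order_ge 2 g' -> Jac_bij F' G' -> Jac_bij G' F' -> forall q,
    ideal_pow (@jacobson_radical (Jac f')) k q -> ideal_pow (@jacobson_radical (Jac g')) k (F' q).
  move=> f2 g2 [K1 K2 FB [F1 FM]] [_ _ _ [G1 GM]].
  have F0 : F' 0 = 0 by rewrite -(subrr 0) FB subrr.
  have FD : {morph F' : x y / x + y}.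
    by move=> x y; rewrite -[y in LHS]opprK -[- y]sub0r !FB F0 sub0r opprK.
  elim: k => [//|k IH] q.
  move/(_ (fun q => ideal_pow (@jacobson_radical (Jac g')) k.+1 (F' q))); apply.
  have IP := @ideal_pow_ideal _ (@jacobson_radical (Jac g')) k.+1.
  split; last first.
    move=> _ [a Ja] [b Jb <-]; rewrite FM => M [_]; apply.
    exists (F' a); last by exists (F' b) => //; apply: IH.
    move: Ja; rewrite -(quotient_projK a) -(quotient_projK (F' (qpr f' (repr a)))).
    rewrite !jacobson_radicalP // => a0.
    apply/eqP; apply: contrapT => /negP /series_inv[v [_ vq]].
    suff : @jacobson_radical (Jac f') (qpr f' 1).
      by rewrite jacobson_radicalP // onesE; apply/eqP/oner_neq0.
    rewrite qpr1 -G1 -qpr1 -vq qprM quotient_projK GM K1.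
    rewrite -(quotient_projK (G' _)) -qprM jacobson_radicalP //.
    by rewrite mulsE_nil a0 mulr0.
  split; first split.
  - by rewrite F0; apply: (ideal0 IP).
  - by move=> x y Hx Hy; rewrite FD; apply: (idealD IP).
  - by move=> x y Hy; rewrite FM; apply: (idealMl IP).
  - by move=> x y Hy; rewrite FM; apply: (idealMr IP).
move=> f2 g2 FG GF q; split; first exact: (half f g F G).
by move=> /(half g f G F g2 f2 GF FG); case: FG => ->.
Qed.

End Radical.

(** * Removing the non-leading part of a potential *)

Section Perturbation.
Variables (K : fieldType) (d : nat) (wt : 'I_d -> nat).
Hypothesis wt_gt0 : forall i, (0 < wt i)%N.
Local Notation series := (ncseries K d).
Local Notation wtw := (wtw wt).
Local Notation D := cyclic_derivative.
Implicit Types (f g h u v r : series) (phi psi : 'I_d -> series).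

(** First-order expansion of a substitution, up to cyclic rotation.  Expanding a
    word letter by letter, the letters already treated are rotated to the right
    end, which is legitimate under [D i]; they accumulate in the factor [h].
    The error of weight [2 e] comes from the terms where two letters are
    perturbed. *)
Lemma subs_perturb_mul phi psi e k l i f h :
  nocst phi -> nocst psi ->
  (forall j, low wtw (wt j) (phi j)) -> (forall j, low wtw (wt j + e) (psi j)) ->
  low wtw k f -> low wtw l h ->
  let phi' j := phi j + psi j in
  low wtw (k + l + 2 * e - wt i)
    (D i ((subs phi' f - subs phi f) * subs phi h)
     - D i (\sum_j psi j * subs phi (cder j f h))).
Proof.
move=> phi0 psi0 phil psil f0 h0 phi'.
have phi'0 : nocst phi' by move=> j; rewrite /phi' addsE phi0 psi0 addr0.
have phi'l j : low wtw (wt j) (phi' j).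
  by apply: lowD => //; apply: low_le (psil j); apply: leq_addr.
pose R f h := D i ((subs phi' f - subs phi f) * subs phi h)
     - D i (\sum_j psi j * subs phi (cder j f h)).
rewrite -/(R f h).
have DB u v : D i (u - v) = D i u - D i v.
  by rewrite cyclic_derivativeD -scaleN1r cyclic_derivativeZ scaleN1r.
have S0 m0 u : low (@size _) m0 u -> low (@size _) m0 (subs phi u).
  move=> u0; apply: size_low; apply: (@subs_low _ _ _ (fun=> 1%N)) => //.
    by move=> j; apply/low_order_ge; apply: low1_nocst.
  exact/low_order_ge.
have DD m0 u : low (@size _) m0 u -> low (@size _) m0.-1 (D i u).
  move=> u0; apply: size_low; rewrite -subn1.
  by apply: (@cyclic_derivative_low _ _ (fun=> 1%N)); apply/low_order_ge.
suff H n a f' h' k' l' w : order_ge a h' -> low wtw k' f' -> low wtw l' h' ->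
    (k + l <= k' + l')%N -> ((size w).+1 < a + n)%N ->
    (wtw w < k + l + 2 * e - wt i)%N -> R f' h' w = 0.
  by move=> w ww; apply: (H (size w).+2 0%N f h k l) ww.
elim: n a f' h' k' l' => [|n IH] a f' h' k' l' a0 f'0 h'0 kl wa ww.
  have wa' : (size w < a.-1)%N by lia.
  rewrite /R addsE oppsE (DD a _ _ w wa'); last first.
    by rewrite -[a]add0n; apply: low_sizeM => //; apply: S0.
  rewrite (DD a _ _ w wa') ?subrr // => v va; rewrite sumsE big1 // => j _.
  move: v va; rewrite -/(low (@size _) a _) -[a]add0n; apply: low_sizeM => //.
  by apply: S0; apply: cder_low.
have dE : subs phi' f' - subs phi f' = \sum_j (psi j * subs phi' (lquo j f')
    + phi j * (subs phi' (lquo j f') - subs phi (lquo j f'))).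
  rewrite (subsE f' phi0) (subsE f' phi'0) opprD addrACA subrr add0r -sumrB.
  by apply: eq_bigr => j _; rewrite mulrDl mulrBr -addrA addrCA addrC.
have RE : R f' h' = \sum_j (R (lquo j f') (h' * var K j) +
    D i (psi j * (subs phi' (lquo j f') - subs phi (lquo j f')) * subs phi h')).
  rewrite /R dE mulr_suml !cyclic_derivative_sum.
  under [X in _ - X]eq_bigr => j _.
    rewrite cder_rec (raddfD (subs phi)) /= (rmorphM (subs phi)) (raddf_sum (subs phi)) mulrDr /= mulr_sumr.
    rewrite cyclic_derivativeD cyclic_derivative_sum; over.
  rewrite big_split /= [X in _ - (_ + X)]exchange_big /= opprD addrA -!sumrB.
  apply: eq_bigr => j _; rewrite cyclic_derivative_sum.
  rewrite mulrDl cyclic_derivativeD rmorphM /= subs_var //.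
  rewrite (mulrBr (psi j)) [(psi j * _ - _) * _]mulrBl [D i (psi j * _ * _ - _)]DB.
  rewrite -[phi j * _ * _]mulrA [D i (phi j * _)]cyclic_derivativeC !mulrA.
  by series_ring.
rewrite RE sumsE big1 // => j _; rewrite addsE.
have w0 := wt_gt0 j.
rewrite (IH a.+1 _ _ (k' - wt j)%N (l' + wt j)%N) ?add0r; first last.
- by [].
- by rewrite addSnnS.
- by lia.
- by apply: lowM => //; apply: low_var.
- exact: low_lquo.
- by rewrite -addn1; apply: low_sizeM => //; apply: low1_nocst.
have df : low wtw ((k' - wt j) + e) (subs phi' (lquo j f') - subs phi (lquo j f')).
  apply: (subs_perturb_low wt_gt0) => //; last exact: low_lquo.
  by move=> s; rewrite /phi' addrC addKr.
apply: (cyclic_derivative_low (k := (wt j + e) + ((k' - wt j) + e) + l')) _.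
  by apply: lowM; [apply: lowM|apply: (subs_low wt_gt0)].
by apply: leq_trans ww _; lia.
Qed.

(** Changing the variables by [psi] changes a potential, up to cyclic rotation and
    second order, by the combination of its cyclic derivatives with coefficients
    [psi]. *)
Lemma subs_perturb phi psi e k i f : nocst phi -> nocst psi ->
  (forall j, low wtw (wt j) (phi j)) -> (forall j, low wtw (wt j + e) (psi j)) ->
  low wtw k f ->
  low wtw (k + 2 * e - wt i)
    (D i (subs (fun j => phi j + psi j) f) - D i (subs phi f)
     - D i (\sum_j psi j * subs phi (D j f))).
Proof.
move=> phi0 psi0 phil psil f0.
have := @subs_perturb_mul phi psi e k 0 i f 1 phi0 psi0 phil psil f0 (@low0n _ _ _ _).
rewrite addn0 /= (rmorph1 (subs phi)) mulr1 cyclic_derivativeD -scaleN1r cyclic_derivativeZ scaleN1r.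
by under [X in D i (subs _ f) - _ - D i X]eq_bigr do rewrite cyclic_derivative_cder.
Qed.

(** The cyclic derivative is homogeneous, so the terms of [f] of weight below [k]
    contribute only to terms of the derivatives which vanish by assumption. *)
Lemma cyclic_truncate k f : (forall i, low wtw (k - wt i) (D i f)) ->
  exists2 g, low wtw k g & forall i, D i g = D i f.
Proof.
move=> f0; exists (fun w => if (wtw w < k)%N then 0 else f w).
  by move=> w ->.
move=> i; apply: seriesP => w; rewrite !cyclic_derivativeE.
have e (b : nat) : wtw (drop b w ++ i :: take b w) = (wt i + wtw w)%N.
  by rewrite wtw_cat wtw_cons addnCA [X in (wt i + X)%N]addnC -wtw_cat cat_take_drop.
case: (ltnP (wt i + wtw w) k) => c; last first.
  by apply: eq_bigr => b _; rewrite e ltnNge c.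
rewrite big1 => [|b _]; last by rewrite e c.
by rewrite -cyclic_derivativeE f0 //; lia.
Qed.

End Perturbation.

(** * Power series in one variable *)

(** The series in one letter form a commutative algebra; the alias carries this
    additional structure. *)
Definition pser (K : fieldType) : Type := ncseries K 1.

Lemma word1 (w : seq 'I_1) : w = nseq (size w) ord0.
Proof. by elim: w => //= i w <-; rewrite ord1. Qed.

Section PSer.
Variable K : fieldType.

HB.instance Definition _ := GRing.Algebra.copy (pser K) (ncseries K 1).

Lemma pser_mulC : commutative (@GRing.mul (pser K)).
Proof.
move=> f g; apply: seriesP => w; rewrite !mulsE (reindex_inj rev_ord_inj) /=.
apply: eq_bigr => b _; rewrite mulrC subSS.
have bw : (b <= size w)%N by rewrite -ltnS.
congr (_ * _); congr (_ _); rewrite [LHS]word1 [RHS]word1; congr nseq.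
  by rewrite size_drop size_takel // subKn.
by rewrite size_drop size_takel ?leq_subr.
Qed.

HB.instance Definition _ := GRing.PzRing_hasCommutativeMul.Build (pser K) pser_mulC.

Definition tvar : pser K := var K ord0.

(** In one variable, the cyclic derivative is the usual derivative ([pder_tvarX]). *)
Definition pder (p : pser K) : pser K := cyclic_derivative ord0 p.

Lemma pderZ a (p : pser K) : pder (a *: p) = a *: pder p.
Proof. exact: cyclic_derivativeZ. Qed.
Lemma pderD (p r : pser K) : pder (p + r) = pder p + pder r.
Proof. exact: cyclic_derivativeD. Qed.

Lemma pder_tvarX n : pder (tvar ^+ n.+1) = n.+1%:R *: tvar ^+ n.
Proof.
suff H m : cder ord0 (tvar ^+ n.+1) (tvar ^+ m) = n.+1%:R *: tvar ^+ (n + m).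
  by rewrite /pder cyclic_derivative_cder -(expr0 tvar) H addn0.
elim: n m => [|n IH] m; first by rewrite expr1 cder_var eqxx add0n.
rewrite exprS cderM -exprSr IH cder_var eqxx scale1r -exprD addnS addSn.
by rewrite -[X in X + _]scale1r -scalerDl -[n.+2%:R]natr1 [1 + _]addrC.
Qed.

End PSer.

(** * The potentials [q + x y^2 + p(x)] *)

Section XY.
Variables (K : fieldType) (d : nat) (d_ge2 : (2 <= d)%N).
Local Notation series := (ncseries K d).
Local Notation D := cyclic_derivative.
Implicit Types (f g h u v r : series) (phi psi : 'I_d -> series) (p : pser K).

Definition ix : 'I_d := Ordinal (ltn_subd d_ge2 (isT : (0 < 2)%N)).
Definition iy : 'I_d := Ordinal (ltn_subd d_ge2 (isT : (0 < 1)%N)).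
Definition isz (i : 'I_d) := (i < d - 2)%N.
Local Notation t := (tvar K).
Local Notation x := (varx K d_ge2).
Local Notation y := (vary K d_ge2).

Lemma isz_ix : isz ix = false. Proof. by rewrite /isz ltnn. Qed.
Lemma isz_iy : isz iy = false. Proof. by rewrite /isz /=; apply/negbTE; lia. Qed.
Lemma ix_iy : (ix == iy) = false. Proof. by apply/negbTE; rewrite -val_eqE /=; lia. Qed.
Lemma iy_ix : (iy == ix) = false. Proof. by rewrite eq_sym ix_iy. Qed.

Variant xyz_spec (i : 'I_d) : Type :=
  | XyzZ of isz i | XyzX of i = ix | XyzY of i = iy.

Lemma xyzP i : xyz_spec i.
Proof.
case zi: (isz i); first exact: XyzZ.
case: (eqVneq i ix) => [->|ni]; first exact: XyzX.
apply: XyzY; apply: val_inj => /=; move: zi ni; rewrite /isz -val_eqE /=.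
by have := ltn_ord i; lia.
Qed.

Definition at_x p : series := subs (fun=> x) p.

Lemma at_x_nocst : nocst (fun _ : 'I_1 => x).
Proof. by move=> _; rewrite /varx varE. Qed.

HB.instance Definition _ := GRing.isLinear.Build K (pser K) series *:%R at_x
  (subs_linear (fun=> x)).
HB.instance Definition _ := GRing.isMonoidMorphism.Build (pser K) series at_x
  (subs_monoid (fun=> x)).

Lemma at_x_var : at_x t = x.
Proof. exact: (subs_var _ at_x_nocst). Qed.

Definition xy_pot p : series := @quadz K d + x * y ^+ 2 + at_x p.

Lemma der_quadz i : D i (@quadz K d) = if isz i then 2 *: var K i else 0.
Proof.
rewrite /quadz cyclic_derivative_sum.
under eq_bigr => j _ do rewrite cyclic_derivative_cder expr2 cderM mul1r mulr1 cder_var -scalerDr.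
case: ifP => [zi|/negbT zi].
  rewrite (bigD1 (Ordinal zi)) //= big1 ?addr0.
    rewrite -val_eqE eqxx scale1r /varz scaler_nat mulr2n.
    by congr (var K _ + var K _); apply: val_inj.
  move=> j; rewrite -val_eqE /= => ji; case: eqP => [e|]; rewrite ?scale0r //.
  by move: ji; rewrite e /= eqxx.
rewrite big1 // => j _; case: eqP => [e|]; rewrite ?scale0r //.
by move: zi; rewrite e /isz /= ltn_ord.
Qed.

Lemma der_xyy i : D i (x * y ^+ 2) = (i == ix)%:R *: y ^+ 2 + (i == iy)%:R *: (x * y + y * x).
Proof.
rewrite cyclic_derivative_cder cderM mulr1 mul1r expr2 cderM !cder_var -scalerDr.
by rewrite [y * x + _]addrC.
Qed.

Lemma der_at_x i p : D i (at_x p) = (i == ix)%:R *: at_x (pder p).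
Proof.
rewrite cyclic_derivative_cder -(rmorph1 at_x) /at_x cder_subs; last exact: at_x_nocst.
by rewrite big_ord1 cder_var -cyclic_derivative_cder.
Qed.

Lemma der_xy_pot i p : D i (xy_pot p) =
  if isz i then 2 *: var K i
  else if i == ix then y ^+ 2 + at_x (pder p) else x * y + y * x.
Proof.
rewrite /xy_pot !cyclic_derivativeD der_quadz der_xyy der_at_x.
case: (xyzP i) => [zi|->|->].
- rewrite zi; have -> : (i == ix) = false by apply: contraTF zi => /eqP ->; rewrite isz_ix.
  have -> : (i == iy) = false by apply: contraTF zi => /eqP ->; rewrite isz_iy.
  by rewrite !scale0r !addr0.
- by rewrite isz_ix eqxx ix_iy !scale1r scale0r add0r addr0.
- by rewrite isz_iy iy_ix eqxx scale1r !scale0r !add0r addr0.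
Qed.

(** For these weights the leading part [q + x y^2 + eps x^3] is homogeneous of
    weight 6, although [q] and the other terms have different degrees. *)
Definition wxy (i : 'I_d) : nat := if isz i then 3 else 2.
Local Notation W := (wtw wxy).
Local Notation W2 := (wtw (fun _ : 'I_1 => 2%N)).

Lemma wxy_gt0 i : (0 < wxy i)%N. Proof. by rewrite /wxy; case: ifP. Qed.
Lemma wxy_ix : wxy ix = 2%N. Proof. by rewrite /wxy isz_ix. Qed.
Lemma wxy_iy : wxy iy = 2%N. Proof. by rewrite /wxy isz_iy. Qed.

Lemma low_x : low W 2 x.
Proof. by move: (@low_var K d wxy ix); rewrite wxy_ix. Qed.
Lemma low_y : low W 2 y.
Proof. by move: (@low_var K d wxy iy); rewrite wxy_iy. Qed.

Lemma low_at_x k p : low W2 k p -> low W k (at_x p).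
Proof. by apply: subs_low => //; try exact: at_x_nocst; move=> _; exact: low_x. Qed.

Variable eps : K.
Hypothesis K2 : (2 : K) != 0.
Local Notation pot0 := (xy_pot (eps *: t ^+ 3)).

Lemma der_cube : pder (eps *: t ^+ 3) = (3 * eps) *: t ^+ 2.
Proof. by rewrite pderZ pder_tvarX scalerA mulrC. Qed.

(** The derivatives [2 z_i], [x y + y x] and [y^2 + 3 eps x^2] are homogeneous for
    these weights; this is why the [z]'s get weight 3. *)
Lemma der_pot0_low i : low W (6 - wxy i) (D i pot0).
Proof.
rewrite der_xy_pot; case: (xyzP i) => [zi|->|->].
- by rewrite zi; apply: lowZ; rewrite -[X in low _ X](_ : wxy i = _)%N; [exact: low_var|rewrite /wxy zi].
- rewrite isz_ix eqxx wxy_ix der_cube linearZ /= rmorphXn /= at_x_var.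
  apply: lowD; last apply: lowZ; rewrite expr2 -[(6 - 2)%N]/(2 + 2)%N; apply: lowM;
    [exact: low_y|exact: low_y|exact: low_x|exact: low_x].
- rewrite isz_iy iy_ix wxy_iy -[(6 - 2)%N]/(2 + 2)%N.
  by apply: lowD; apply: lowM; [exact: low_x|exact: low_y|exact: low_y|exact: low_x].
Qed.

Section Reduction.
Variable k : nat.
Hypothesis k_ge7 : (7 <= k)%N.

(** [r] is, up to cyclic rotation and higher weight, a series in [x] plus a
    combination of the derivatives of the leading part.  By [subs_perturb] such a
    combination is removed by adding [- psi] to the variables, at the cost of
    terms of weight above [k] only. *)
Definition reducible r := exists (psi : 'I_d -> series) p,
  [/\ forall j, low W (wxy j + (k - 6)) (psi j), low W2 k p
    & forall i, low W (k.+1 - wxy i) (D i (r - \sum_j psi j * D j pot0 - at_x p))].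

Lemma reducible_lin a r r' : reducible r -> reducible r' -> reducible (a *: r + r').
Proof.
move=> [psi [p [psi0 p0 H]]] [psi' [p' [psi'0 p'0 H']]].
exists (fun j => a *: psi j + psi' j), (a *: p + p'); split.
- by move=> j; apply: lowD => //; apply: lowZ.
- by apply: lowD => //; apply: lowZ.
move=> i; under eq_bigr do rewrite mulrDl -scalerAl.
rewrite big_split /= -scaler_sumr (linearP at_x) /=.
set s := \sum_j _; set s' := \sum_j _.
have -> : a *: r + r' - (a *: s + s') - (a *: at_x p + at_x p') =
   a *: (r - s - at_x p) + (r' - s' - at_x p') by series_ring.
by rewrite cyclic_derivativeD cyclic_derivativeZ; apply: lowD => //; apply: lowZ.
Qed.

Lemma reducible_der r r' : (forall i, D i r = D i r') -> reducible r -> reducible r'.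
Proof.
move=> e [psi [p [psi0 p0 H]]]; exists psi, p; split=> // i.
have DB u v : D i (u - v) = D i u - D i v.
  by rewrite cyclic_derivativeD -scaleN1r cyclic_derivativeZ scaleN1r.
by have := H i; rewrite !DB e.
Qed.

Lemma reducible_low r : low W k.+1 r -> reducible r.
Proof.
move=> r0; exists (fun=> 0), 0; split=> // i; rewrite raddf0 subr0.
rewrite big1 ?subr0 => [|j _]; last by rewrite mul0r.
exact: cyclic_derivative_low.
Qed.

Lemma reducible0 : reducible 0. Proof. exact: reducible_low. Qed.
Lemma reducibleD r r' : reducible r -> reducible r' -> reducible (r + r').
Proof. by rewrite -{2}[r]scale1r; exact: reducible_lin. Qed.
Lemma reducibleZ a r : reducible r -> reducible (a *: r).
Proof. by move=> Rr; rewrite -[_ *: _]addr0; apply: reducible_lin => //; exact: reducible0. Qed.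
Lemma reducible_sum (T : Type) (s : seq T) (P : pred T) (F : T -> series) :
  (forall i, P i -> reducible (F i)) -> reducible (\sum_(i <- s | P i) F i).
Proof. by move=> H; elim/big_ind: _ => //; [exact: reducible0|exact: reducibleD]. Qed.

(** Inside a cyclic word, a derivative of the leading part can be rotated to the
    right end, where [psi i := v u] absorbs it. *)
Lemma reducible_der_mul i u v : low W (wxy i + (k - 6)) (v * u) ->
  reducible (u * D i pot0 * v).
Proof.
move=> uv0; apply: (@reducible_der (v * u * D i pot0)).
  by move=> j; rewrite -mulrA cyclic_derivativeC.
exists (fun j => (j == i)%:R *: (v * u)), 0; split=> //.
  by move=> j; case: eqP => [->|_]; rewrite ?scale1r ?scale0r.
move=> j; rewrite raddf0 subr0 (bigD1 i) //= eqxx scale1r big1 ?addr0.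
  by rewrite subrr -(scale0r 0) cyclic_derivativeZ scale0r.
by move=> s /negPf ->; rewrite scale0r mul0r.
Qed.

(** As [D_i] of the leading part is [2 z_i], every monomial involving [z_i] is
    absorbed. *)
Lemma reducible_z i u v : isz i -> low W (k - 3) (v * u) -> reducible (u * var K i * v).
Proof.
move=> zi uv0; have := @reducible_der_mul i u v.
rewrite der_xy_pot zi -scalerAr -scalerAl /wxy zi => /(_ _)/(reducibleZ 2^-1).
rewrite scalerA mulVf // scale1r; apply.
by rewrite (_ : (3 + (k - 6) = k - 3)%N) //; lia.
Qed.

Lemma reducible_xy u v : low W (k - 4) (v * u) -> reducible (u * (x * y + y * x) * v).
Proof.
move=> uv0; have := @reducible_der_mul iy u v.
rewrite der_xy_pot isz_iy iy_ix wxy_iy; apply.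
by rewrite (_ : (2 + (k - 6) = k - 4)%N) //; lia.
Qed.

Lemma reducible_yy u v : low W (k - 4) (v * u) ->
  reducible (u * (y ^+ 2 + (3 * eps) *: x ^+ 2) * v).
Proof.
move=> uv0; have := @reducible_der_mul ix u v.
rewrite der_xy_pot isz_ix eqxx wxy_ix der_cube linearZ /= rmorphXn /= at_x_var; apply.
by rewrite (_ : (2 + (k - 6) = k - 4)%N) //; lia.
Qed.

Lemma low_xn n : low W (2 * n) (x ^+ n).
Proof.
elim: n => [|n IH] //; rewrite exprS mulnS; apply: lowM => //; exact: low_x.
Qed.

(** Moving [y] past [n] letters [x], one relation [x y + y x] at a time; [u] is
    general because the letters already passed are added to it. *)
Lemma reducible_comm l n u v : low W l u -> low W (k - l - 2 * n.+1) v ->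
  reducible (u * (y * x ^+ n - (-1) ^+ n *: (x ^+ n * y)) * v).
Proof.
elim: n l u v => [|n IH] l u v u0 v0.
  by rewrite !expr0 scale1r mul1r mulr1 subrr mulr0 mul0r; exact: reducible0.
have -> : y * x ^+ n.+1 - (-1) ^+ n.+1 *: (x ^+ n.+1 * y) =
    (x * y + y * x) * x ^+ n - x * (y * x ^+ n - (-1) ^+ n *: (x ^+ n * y)).
  rewrite !exprS mulN1r scaleNr opprK mulrBr mulrDl -scalerAr !mulrA.
  by series_ring.
rewrite mulrBr mulrBl; apply: reducibleD.
  rewrite !mulrA -[u * _ * _ * v]mulrA; apply: reducible_xy.
  apply: (@low_le _ _ _ (((2 * n) + (k - l - 2 * n.+2)) + l)); first by lia.
  by apply: lowM => //; apply: lowM => //; exact: low_xn.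
rewrite -[- _]scaleN1r; apply: reducibleZ; rewrite mulrA.
apply: (IH (l + 2)%N); first by apply: lowM => //; exact: low_x.
by rewrite (_ : (_ - (l + 2) - _ = k - l - 2 * n.+2)%N) //; lia.
Qed.

(** The words in [x] and [y] straighten, inside any larger word of weight [k], to
    multiples of [x^n] or [x^n y]: the relations move [y] to the right and replace
    [y^2] by [- 3 eps x^2].  The relations being homogeneous, the total weight of
    the two sides is the same. *)
Let straight l m := exists (c : K) n b, [/\ (2 * (n + b) = l)%N, (b <= 1)%N &
  forall u, low W (k - l) u -> reducible (u * (m - c *: (x ^+ n * y ^+ b)))].

Let straight_x l m : (l + 2 <= k)%N -> straight l m -> straight (l + 2) (x * m).
Proof.
move=> lk [c [n [b [nb b1 H]]]]; exists c, n.+1, b; split=> //; first by lia.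
move=> u u0; have -> : u * (x * m - c *: (x ^+ n.+1 * y ^+ b)) =
    u * x * (m - c *: (x ^+ n * y ^+ b)).
  by rewrite exprS -[u * x * _]mulrA [x * (_ - _)]mulrBr -scalerAr !mulrA.
apply: H; rewrite (_ : (k - l = k - (l + 2) + 2)%N); last by lia.
by apply: lowM => //; exact: low_x.
Qed.

Let straight_y l m : (l + 2 <= k)%N -> straight l m -> straight (l + 2) (y * m).
Proof.
move=> lk [c [n [b [nb b1 H]]]].
have step u : low W (k - (l + 2)) u ->
    reducible (u * (y * m - (c * (-1) ^+ n) *: (x ^+ n * y ^+ b.+1))).
  move=> u0; have -> : u * (y * m - (c * (-1) ^+ n) *: (x ^+ n * y ^+ b.+1)) =
      u * y * (m - c *: (x ^+ n * y ^+ b)) +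
      c *: (u * (y * x ^+ n - (-1) ^+ n *: (x ^+ n * y)) * y ^+ b).
    rewrite exprS -scalerA !mulrBr !mulrBl -!scalerAr -!scalerAl !mulrA.
    by series_ring.
  apply: reducibleD.
    apply: H; rewrite (_ : (k - l = k - (l + 2) + 2)%N); last by lia.
    by apply: lowM => //; exact: low_y.
  apply: reducibleZ; apply: (@reducible_comm (k - (l + 2))) => //.
  apply: (@low_le _ _ _ (2 * b)); first by lia.
  by case: (b) b1 => [|[]] // _; exact: low_y.
case: b b1 nb H step => [|[|//]] _ nb H step.
  by exists (c * (-1) ^+ n), n, 1%N; split=> //; lia.
move: (c * (-1) ^+ n) step => c' step.
exists (- (3 * eps) * c'), n.+2, 0%N; split=> //; first by lia.
move=> u u0.
have -> : u * (y * m - (- (3 * eps) * c') *: (x ^+ n.+2 * y ^+ 0)) =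
   u * (y * m - c' *: (x ^+ n * y ^+ 2)) +
   c' *: (u * x ^+ n * (y ^+ 2 + (3 * eps) *: x ^+ 2) * 1).
  rewrite expr0 !mulr1 -[n.+2]addn2 exprD !mulrBr mulrDr -!scalerAr !mulrA.
  by series_ring.
apply: reducibleD; first exact: step.
apply: reducibleZ; apply: reducible_yy; rewrite mul1r.
apply: (@low_le _ _ _ (k - (l + 2) + 2 * n)); first by lia.
by apply: lowM => //; exact: low_xn.
Qed.

Definition monom (w : seq 'I_d) : series := \prod_(i <- w) var K i.

Lemma monom_low w : low W (W w) (monom w).
Proof.
elim: w => [|i w IH]; first by rewrite wtw_nil.
rewrite /monom big_cons wtw_cons; apply: lowM => //; exact: low_var.
Qed.

Let straight_monom w : (W w <= k)%N -> ~~ has isz w -> straight (W w) (monom w).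
Proof.
elim: w => [|i w IH] /=.
  move=> _ _; exists 1, 0%N, 0%N; split=> //; first by rewrite wtw_nil.
  move=> u _; rewrite !expr0 mulr1 scale1r /monom big_nil subrr mulr0; exact: reducible0.
rewrite wtw_cons negb_or => wk /andP[zi zw].
rewrite /monom big_cons -/(monom w).
case: (xyzP i) wk zi => [->//|->|->]; rewrite ?wxy_ix ?wxy_iy addnC => wk _.
- by apply: straight_x => //; apply: IH => //; lia.
- by apply: straight_y => //; apply: IH => //; lia.
Qed.

(** Rotation makes [x^n y] equal to half of [x^(n-1) (x y + y x)]. *)
Let reducible_xny n : (2 * n.+1 = k)%N -> reducible (x ^+ n * y).
Proof.
case: n => [|n] nk; first by lia.
apply: (@reducible_der (2^-1 *: (x ^+ n * (x * y + y * x) * 1))).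
  move=> i; rewrite mulr1 mulrDr cyclic_derivativeZ cyclic_derivativeD !mulrA.
  rewrite -[x ^+ n * y * x]mulrA -[_ * (y * x)]/(_ * _) mulrA.
  rewrite [D i (x ^+ n * y * x)]cyclic_derivativeC !mulrA -exprS -exprSr -mulr2n.
  by rewrite -scaler_nat scalerA mulVf // scale1r.
apply: reducibleZ; apply: reducible_xy; rewrite mul1r.
by apply: low_le (@low_xn n); lia.
Qed.

Let reducible_xn n : (2 * n = k)%N -> reducible (x ^+ n).
Proof.
move=> nk; exists (fun=> 0), (t ^+ n); split=> //.
  rewrite -nk; elim: (n) => [|m IH] //; rewrite exprS mulnS; apply: lowM => //.
  exact: (@low_var _ _ (fun=> 2%N)).
move=> i; rewrite rmorphXn /= at_x_var big1 ?subr0 => [|j _]; last by rewrite mul0r.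
by rewrite subrr -(scale0r 0) cyclic_derivativeZ scale0r.
Qed.

Let reducible_monom w : W w = k -> reducible (monom w).
Proof.
move=> wk; case: (boolP (has isz w)) => [/hasP[i iw zi]|nz].
  case/splitPr: iw wk => a b wk.
  rewrite /monom big_cat big_cons /= mulrA; apply: reducible_z => //.
  apply: (@low_le _ _ _ (W b + W a)); last by apply: lowM; exact: monom_low.
  by move: wk; rewrite wtw_cat wtw_cons /wxy zi; lia.
have [||c [n [b [nb b1 H]]]] := @straight_monom w; rewrite ?wk //.
have := H 1; rewrite mul1r wk subnn => /(_ _)/reducibleD Hw.
rewrite -[monom w](subrK (c *: (x ^+ n * y ^+ b))); apply: Hw => //.
apply: reducibleZ; move: nb; rewrite wk; case: b b1 {H} => [|[|//]] _ nb.
  by rewrite expr0 mulr1; apply: reducible_xn; lia.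
by apply: reducible_xny; lia.
Qed.

(** The terms of weight [k] of [r] are finitely many monomials; they are reached
    by splitting off the letters one after the other, [u] being the prefix read
    so far. *)
Lemma low_reducible r : low W k r -> reducible r.
Proof.
suff H (n : nat) (u : seq 'I_d) r' : (k - W u <= n)%N -> low W (k - W u) r' -> reducible (monom u * r').
  move=> r0; have := H k [::] r; rewrite wtw_nil subn0 => /(_ (leqnn _) r0).
  by rewrite /monom big_nil mul1r.
elim: n u r' => [|n IH] u r' un r0.
  rewrite leqn0 subn_eq0 leq_eqVlt in un; case/orP: un => [/eqP wu|wu]; last first.
    by apply: reducible_low; apply: low_le wu _; apply: lowMr; exact: monom_low.
  rewrite (lquo_split r') mulrDr -scalerAr mulr1; apply: reducibleD.
    exact/reducibleZ/reducible_monom.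
  apply: reducible_low; rewrite mulr_sumr; apply: low_sum => i _; rewrite mulrA.
  apply: lowMr; apply: (@low_le _ _ _ (W u + wxy i)).
    by have := wxy_gt0 i; lia.
  by apply: lowM; [exact: monom_low|exact: low_var].
case: (leqP k (W u)) => wu; first by apply: IH => //; rewrite (eqP wu).
rewrite (lquo_split r') (low_nil _ r0); last by rewrite subn_gt0.
rewrite scale0r add0r mulr_sumr; apply: reducible_sum => i _; rewrite mulrA.
have -> : monom u * var K i = monom (rcons u i).
  by rewrite /monom -cats1 big_cat big_seq1.
have e : W (rcons u i) = (W u + wxy i)%N by rewrite -cats1 wtw_cat wtw_cons wtw_nil addn0.
apply: IH; rewrite e; first by have := wxy_gt0 i; lia.
by rewrite subnDA; apply: low_lquo.
Qed.

End Reduction.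
End XY.

(** * Eliminating the terms of higher weight *)

Section XYNormalize.
Variables (K : fieldType) (d : nat) (d_ge2 : (2 <= d)%N) (eps : K).
Hypothesis K2 : (2 : K) != 0.
Local Notation series := (ncseries K d).
Local Notation D := cyclic_derivative.
Local Notation wz := (@wxy d).
Local Notation W := (wtw wz).
Local Notation W2 := (wtw (fun _ : 'I_1 => 2%N)).
Local Notation cub := (eps *: tvar K ^+ 3).
Local Notation pot := (@xy_pot K d d_ge2).
Local Notation pot0 := (pot cub).
Implicit Types (f g h u v r : series) (phi psi : 'I_d -> series) (p : pser K).

Let DB i u v : D i (u - v) = D i u - D i v.
Proof. by rewrite cyclic_derivativeD -scaleN1r cyclic_derivativeZ scaleN1r. Qed.

Variable f : series.
Hypothesis f_low : low W 6 f.
Hypothesis f_lead : forall i, low W (7 - wz i) (D i f - D i pot0).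

(** A change of variables [s.1], tangent to the identity, which brings [f] to the
    form [q + x y^2 + s.2(x)] up to cyclic rotation and terms of weight [k]. *)
Definition xy_approx k (s : ('I_d -> series) * pser K) :=
  [/\ forall j, low W (wz j).+1 (s.1 j - var K j), low W2 7 (s.2 - cub)
    & forall i, low W (k - wz i) (D i (subs s.1 f) - D i (pot s.2))].

Let unip_nocst phi : (forall j, low W (wz j).+1 (phi j - var K j)) -> nocst phi.
Proof.
move=> phi1 j; have := phi1 j [::]; rewrite wtw_nil addsE oppsE varE subr0.
exact.
Qed.

Let unip_low phi : (forall j, low W (wz j).+1 (phi j - var K j)) ->
  forall j, low W (wz j) (phi j).
Proof.
move=> phi1 j; rewrite -(subrK (var K j) (phi j)); apply: lowD; last exact: low_var.
exact: low_le (phi1 j).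
Qed.

(** Let [r] be the error of weight [k].  Write it as [sum_j psi_j D_j pot0 + P(x)]
    by [low_reducible]; adding [psi] to the variables and subtracting [P] cancels
    it, since [D_j f] and [D_j pot0] agree to lowest weight. *)
Lemma xy_step k s : (7 <= k)%N -> xy_approx k s -> exists s', xy_approx k.+1 s' /\
  (forall j, low W (wz j + (k - 6)) (s'.1 j - s.1 j)) /\ low W2 k (s'.2 - s.2).
Proof.
case: s => phi p k7 [/= phi1 p0 H].
have phi0 := unip_nocst phi1; have phil := unip_low phi1.
have [|r r_low rE] := @cyclic_truncate K d wz k (pot p - subs phi f).
  by move=> i; rewrite DB -opprB; apply: lowN.
have [psi [P [psil P0 HP]]] := low_reducible d_ge2 eps K2 k7 r_low.
have psi0 : nocst psi.
  by move=> j; apply: low_nil (psil j); have := wxy_gt0 j; lia.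
exists (fun j => phi j + psi j, p - P); split; last first.
  split=> [j|] /=; first by rewrite addrC addKr.
  by rewrite addrC addKr; apply: lowN.
split=> /= [j||i].
- rewrite -addrA addrCA; apply: lowD => //; apply: low_le (psil j); lia.
- by rewrite addrAC; apply: lowB => //; apply: low_le P0.
have Spot : pot (p - P) = pot p - at_x d_ge2 P.
  by rewrite /xy_pot (linearB (at_x d_ge2)) addrA.
set S := subs _ f.
pose A := \sum_j psi j * subs phi (D j f); pose B := \sum_j psi j * D j pot0.
have -> : D i S - D i (pot (p - P)) = (D i S - D i (subs phi f) - D i A)
    - D i (r - B - at_x d_ge2 P) + D i (A - B).
  by rewrite Spot !DB rE DB; series_ring.
apply: lowD; first apply: lowB.
- apply: (low_le _ (@subs_perturb _ _ wz (@wxy_gt0 d) phi psi (k - 6) 6 i f phi0 psi0 phil psil f_low)).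
  lia.
- exact: HP.
apply: cyclic_derivative_low; rewrite /A /B -sumrB; apply: low_sum => j _.
rewrite -mulrBr; apply: (@low_le _ _ _ ((wz j + (k - 6)) + (7 - wz j))); first by lia.
apply: lowM => //.
have -> : subs phi (D j f) - D j pot0 = subs phi (D j f - D j pot0) +
    (subs phi (D j pot0) - subs (@var K d) (D j pot0)).
  by rewrite (linearB (subs phi)) /= subs_id; series_ring.
apply: lowD; first exact: (subs_low (@wxy_gt0 d)).
apply: (@low_le _ _ _ ((6 - wz j) + 1)).
  by rewrite /wxy; case: ifP.
apply: (subs_perturb_low (@wxy_gt0 d)) => //.
- by move=> s; exact: low_var.
- by move=> s; rewrite addn1.
- exact: der_pot0_low.
Qed.

(** The corrections of step [k] have relative weight [k - 6], so that the changes
    of variables and the series in [x] converge; the limit is again tangent to the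
    identity, hence invertible. *)
Lemma xy_normalize : exists2 p, low W2 7 (p - cub) & subs_iso f (pot p).
Proof.
have init : xy_approx 7 (@var K d, cub).
  split=> /= [j||i]; rewrite ?subrr //.
  by rewrite subs_id; exact: f_lead.
have stepT (ks : nat * _) : exists s', (7 <= ks.1)%N -> xy_approx ks.1 ks.2 ->
    xy_approx ks.1.+1 s' /\ (forall j, low W (wz j + (ks.1 - 6)) (s'.1 j - ks.2.1 j))
      /\ low W2 ks.1 (s'.2 - ks.2.2).
  case: ks => k s /=; case: (pselect ((7 <= k)%N /\ xy_approx k s)) => [[k7 /(xy_step k7)[s' Hs]]|N].
    by exists s'.
  by exists s => k7 sk; case: N.
have [F FP] := choice stepT.
pose s := fix s n := if n is n'.+1 then F (n' + 7, s n')%N else (@var K d, cub).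
have sA n : xy_approx (n + 7) (s n).
  elim: n => [|n IH] //; by case: (FP (n + 7, s n)%N (leq_addl _ _) IH).
have sS n : (forall j, low W (wz j + (n + 1)) ((s n.+1).1 j - (s n).1 j))
     /\ low W2 (n + 7) ((s n.+1).2 - (s n).2).
  case: (FP (n + 7, s n)%N (leq_addl _ _) (sA n)) => _ [H1 H2]; split=> // j.
  by rewrite (_ : (n + 1 = n + 7 - 6)%N) //; lia.
have phiL j : exists l : series, forall n, low W (wz j + (n + 1)) (l - (s n).1 j).
  have [|l lP] := @series_limit K d wz (fun n => (s (n - (wz j).+1)%N).1 j).
    move=> n; case: (leqP (wz j).+1 n) => c.
      rewrite subSn //; apply: low_le (proj1 (sS _) j); lia.
    by rewrite (eqP (ltnW c : _ - _ == _)%N) (eqP (c : _ - _ == _)%N) subrr.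
  exists l => n; have := lP (wz j + (n + 1))%N.
  by rewrite (_ : (_ - _ = n)%N) //; lia.
have /choice[phi phiP] := phiL.
have [|p pP] := @series_limit K 1 (fun=> 2%N) (fun n => (s n).2).
  by move=> n; apply: low_le (proj2 (sS n)); exact: leq_addr.
have p7 : low W2 7 (p - cub).
  have -> : p - cub = (p - (s 7).2) + ((s 7).2 - cub) by series_ring.
  by apply: lowD => //; have [] := sA 7%N.
have phi1 j : low W (wz j).+1 (phi j - var K j).
  by have := phiP j 0%N; rewrite add0n addn1.
have phi0 := unip_nocst phi1; have phil := unip_low phi1.
have [|j|psi ips] := @inverse_subs_exists K d wz (@wxy_gt0 d) (fun=> 1) phi phi0.
- by move=> _; exact: oner_neq0.
- by rewrite scale1r.
exists p => //; apply: (subs_iso_cyc ips) => i.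
apply/eqP; rewrite eq_sym -subr_eq0; apply/eqP; apply: (@low_eq0 _ _ wz) => n.
have [sn1 _ sn3] := sA n.
have -> : D i (subs phi f) - D i (pot p) = D i (subs phi f - subs (s n).1 f)
   + (D i (subs (s n).1 f) - D i (pot (s n).2)) - D i (pot p - pot (s n).2).
  by rewrite !DB; series_ring.
have w3 : (wz i <= 3)%N by rewrite /wxy; case: ifP.
apply: lowB; first apply: lowD.
- apply: (@low_le _ _ _ ((6 + (n + 1)) - wz i)); first by lia.
  apply: cyclic_derivative_low; apply: (subs_perturb_low (@wxy_gt0 d)) => //.
  + exact: unip_nocst.
  + exact: unip_low.
- by apply: low_le (sn3 i); lia.
have -> : pot p - pot (s n).2 = at_x d_ge2 (p - (s n).2).
  by rewrite (linearB (at_x d_ge2)) /= /xy_pot; series_ring.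
apply: (@low_le _ _ _ (n.+3 - wz i)); first by lia.
apply: cyclic_derivative_low; apply: low_at_x.
have -> : p - (s n).2 = (p - (s n.+3).2) + ((s n.+3).2 - (s n.+2).2) + ((s n.+2).2 - (s n.+1).2)
    + ((s n.+1).2 - (s n).2) by series_ring.
have H m : (n <= m)%N -> low W2 n.+3 ((s m.+1).2 - (s m).2).
  by move=> nm; apply: low_le (proj2 (sS m)); lia.
by do 3!(apply: lowD; last by apply: H; lia); exact: pP.
Qed.

End XYNormalize.

(** * Arithmetic of power series in one variable *)

Section PSerTheory.
Variable K : fieldType.
Local Notation pser := (pser K).
Local Notation t := (tvar K).
Implicit Types a b c p : pser.

Lemma pser_split p : p = p [::] *: 1 + t * (lquo ord0 p : pser).
Proof. by rewrite {1}[p]lquo_split big_ord1. Qed.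

Lemma ordM k l a b : order_ge k a -> order_ge l b -> order_ge (k + l) (a * b).
Proof. exact: low_sizeM. Qed.
Lemma ordMl k a b : order_ge k b -> order_ge k (a * b).
Proof. by move=> b0; rewrite -[k]add0n; apply: ordM. Qed.
Lemma ordMr k a b : order_ge k a -> order_ge k (a * b).
Proof. by move=> b0; rewrite -[k]addn0; apply: ordM. Qed.
Lemma ordD k a b : order_ge k a -> order_ge k b -> order_ge k (a + b).
Proof. by move=> a0 b0 w wk; rewrite addsE a0 ?b0 ?addr0. Qed.
Lemma ordN k a : order_ge k a -> order_ge k (- a).
Proof. by move=> a0 w wk; rewrite oppsE a0 ?oppr0. Qed.
Lemma ordB k a b : order_ge k a -> order_ge k b -> order_ge k (a - b).
Proof. by move=> a0 b0; apply: ordD => //; apply: ordN. Qed.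
Lemma ordZ k x a : order_ge k a -> order_ge k (x *: a).
Proof. by move=> a0 w wk; rewrite scalesE a0 ?mulr0. Qed.
Lemma ord_le k l a : (l <= k)%N -> order_ge k a -> order_ge l a.
Proof. by move=> lk a0 w wl; apply: a0; apply: leq_trans lk. Qed.
Lemma ord0n a : order_ge 0 a. Proof. by []. Qed.
Lemma ord_t : order_ge 1 t.
Proof. by apply: low1_nocst; rewrite /tvar varE. Qed.
Lemma ordX k n a : order_ge k a -> order_ge (n * k) (a ^+ n).
Proof. by move=> a0; elim: n => [|n IH] //; rewrite exprS mulSn; apply: ordM. Qed.
Lemma ord_tX n : order_ge n (t ^+ n).
Proof. by rewrite -{1}[n]muln1; apply: ordX; exact: ord_t. Qed.
Lemma ord1P a : order_ge 1 a <-> a [::] = 0.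
Proof. by split=> [/(_ [::]) -> //|]; exact: low1_nocst. Qed.
Lemma ord_eq0 a : (forall k, order_ge k a) -> a = 0.
Proof. by move=> a0; apply: (@low_eq0 _ _ (fun=> 1%N)) => k; apply/low_order_ge. Qed.

Definition pcoef n a : K := a (nseq n ord0).

Lemma pcoefD n a b : pcoef n (a + b) = pcoef n a + pcoef n b. Proof. by []. Qed.
Lemma pcoefN n a : pcoef n (- a) = - pcoef n a. Proof. by []. Qed.
Lemma pcoefZ n x a : pcoef n (x *: a) = x * pcoef n a. Proof. by []. Qed.
Lemma pcoef0M a b : pcoef 0 (a * b) = pcoef 0 a * pcoef 0 b.
Proof. exact: mulsE_nil. Qed.
Lemma pcoef01 : pcoef 0 (1 : pser) = 1. Proof. by rewrite /pcoef onesE eqxx. Qed.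
Lemma pcoef0X n a : pcoef 0 (a ^+ n) = pcoef 0 a ^+ n.
Proof. exact: exprs_nil. Qed.
Lemma pcoef_tM n a : pcoef n.+1 (t * a) = pcoef n a.
Proof. by rewrite /pcoef /= [LHS]var_mulE eqxx mul1r. Qed.
Lemma pcoef_tXM n k a : pcoef (n + k) (t ^+ n * a) = pcoef k a.
Proof. by elim: n => [|n IH]; rewrite ?mul1r // exprS -mulrA addSn pcoef_tM. Qed.

Lemma pserP a b : (forall n, pcoef n a = pcoef n b) -> a = b.
Proof. by move=> ab; apply: seriesP => w; rewrite [w]word1; exact: ab. Qed.

Lemma order_geP k a : order_ge k a <-> forall n, (n < k)%N -> pcoef n a = 0.
Proof.
split=> [a0 n nk|a0 w wk]; first by apply: a0; rewrite size_nseq.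
by rewrite [w]word1; exact: a0.
Qed.

Lemma ordS k a : order_ge k a -> pcoef k a = 0 -> order_ge k.+1 a.
Proof.
move=> /order_geP a0 ak; apply/order_geP => n; rewrite ltnS leq_eqVlt.
by case/orP=> [/eqP -> //|]; exact: a0.
Qed.

Lemma pcoef_ord k n a : order_ge k a -> (n < k)%N -> pcoef n a = 0.
Proof. by move=> /order_geP; apply. Qed.

Lemma ord_factor n a : order_ge n a -> exists b, a = t ^+ n * b.
Proof.
elim: n a => [|n IH] a a0; first by exists a; rewrite mul1r.
have [b e] : exists b, (lquo ord0 a : pser) = t ^+ n * b.
  by apply: IH => w wn; apply: a0.
by exists b; rewrite exprS -mulrA -e {1}[a]pser_split a0 // scale0r add0r.
Qed.

Lemma ord_tXM n k b : order_ge (n + k) (t ^+ n * b) <-> order_ge k b.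
Proof.
split; last by apply: ordM; exact: ord_tX.
move=> H; apply/order_geP => m mk; rewrite -(pcoef_tXM n).
by apply: pcoef_ord H _; rewrite ltn_add2l.
Qed.

Definition punit a := exists b, a * b = 1.

Lemma punitP a : punit a <-> pcoef 0 a != 0.
Proof.
split=> [[b /(congr1 (pcoef 0))]|/series_rinv //].
by rewrite pcoef0M pcoef01; apply: contra_eq_neq => ->; rewrite mul0r eq_sym oner_neq0.
Qed.

Lemma punitM a b : punit a -> punit b -> punit (a * b).
Proof. by rewrite !punitP pcoef0M => ? ?; rewrite mulf_neq0. Qed.
Lemma punitX a n : punit a -> punit (a ^+ n).
Proof. by rewrite !punitP pcoef0X; exact: expf_neq0. Qed.
Lemma punitZ x a : x != 0 -> punit a -> punit (x *: a).
Proof. by move=> x0; rewrite !punitP pcoefZ => ?; rewrite mulf_neq0. Qed.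

Lemma ord_unit k a u : punit u -> order_ge k (a * u) <-> order_ge k a.
Proof.
move=> [v uv]; split; last exact: ordMr.
by move=> /(@ordMr k _ v); rewrite -mulrA uv mulr1.
Qed.

Lemma pser_factor a : a != 0 -> exists n u, punit u /\ a = t ^+ n * u.
Proof.
move=> a0; have [n an] : exists n, pcoef n a != 0.
  apply: contrapT => /forallNP H; case/eqP: a0; apply: pserP => n.
  by have /negP := H n; rewrite negbK => /eqP ->; rewrite /pcoef.
have [m am mmin] := ex_minnP (ex_intro (fun n => pcoef n a != 0) n an).
have [|u e] := @ord_factor m a.
  apply/order_geP => k km; apply/eqP; apply: contraTT km => ak.
  by rewrite -leqNgt; exact: mmin.
exists m, u; split=> //; apply/punitP; rewrite -(pcoef_tXM m) addn0 -e //.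
Qed.

(** Up to a unit [c] is a power of [t], and divisibility by [t ^+ n] depends on
    the first [n] coefficients only. *)
Lemma pser_ideal_closed c a :
  (forall k, exists b, order_ge k (a - c * b)) -> exists b, a = c * b.
Proof.
move=> H; case: (eqVneq c 0) => [c0|/pser_factor[n [u [[v uv] cE]]]].
  exists 0; rewrite mulr0; apply: ord_eq0 => k; have [b] := H k.
  by rewrite c0 mul0r subr0.
have [b Hb] := H n; have [|a' ->] := @ord_factor n a.
  rewrite -(subrK (c * b) a); apply: ordD => //; rewrite cE -mulrA.
  by apply: ordMr; exact: ord_tX.
exists (v * a'); rewrite cE -mulrA; congr (_ * _).
by rewrite mulrA uv mul1r.
Qed.

Definition pconj : pser -> pser := subs (fun=> - t).

HB.instance Definition _ := GRing.isLinear.Build K pser pser *:%R pconj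
  (subs_linear (fun=> - t : ncseries K 1)).
HB.instance Definition _ := GRing.isMonoidMorphism.Build pser pser pconj
  (subs_monoid (fun=> - t : ncseries K 1)).

Lemma nocst_Nt : nocst (fun _ : 'I_1 => - t : ncseries K 1).
Proof. by move=> _; rewrite oppsE /tvar varE oppr0. Qed.

Lemma pconj_t : pconj t = - t.
Proof. exact: (subs_var _ nocst_Nt). Qed.

Lemma pconj_rec p : pconj p = p [::] *: 1 - t * pconj (lquo ord0 p : pser).
Proof.
rewrite {1}[p]pser_split (linearD pconj) linearZ /= rmorph1 rmorphM /= pconj_t.
by rewrite mulNr.
Qed.

Lemma pconjK : involutive pconj.
Proof.
move=> p; apply/eqP; rewrite -subr_eq0; apply/eqP; apply: ord_eq0 => k.
elim: k p => [|k IH] p //; rewrite (pconj_rec p) (linearB pconj) linearZ /= rmorph1 rmorphM /=.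
rewrite pconj_t [X in _ - X]pser_split.
have -> (x y z : pser) : x - - t * y - (x + t * z) = t * (y - z) by ring.
by rewrite -[k.+1]add1n; apply: ordM; [exact: ord_t|exact: IH].
Qed.

Lemma ord_pconj k a : order_ge k a -> order_ge k (pconj a).
Proof.
move=> /ord_factor[b ->]; rewrite rmorphM rmorphXn /= pconj_t; apply: ordMr.
by rewrite -{1}[k]muln1; apply: ordX; apply: ordN; exact: ord_t.
Qed.

Lemma pcoef_pconj n a : pcoef n (pconj a) = (-1) ^+ n * pcoef n a.
Proof.
elim: n a => [|n IH] a.
  by rewrite mul1r; exact: (subs_nil _ nocst_Nt).
rewrite pconj_rec pcoefD pcoefN pcoef_tM IH pcoefZ [in RHS](pser_split a) !pcoefD pcoefZ pcoef_tM.
by rewrite /pcoef !onesE /= exprS; ring.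
Qed.

Lemma order_pder k p : order_ge k.+1 p -> order_ge k (pder p).
Proof.
move=> /low_order_ge p0; apply/low_order_ge.
have := @cyclic_derivative_low K 1 (fun=> 1%N) k.+1 ord0 p p0.
by rewrite subSS subn0.
Qed.


End PSerTheory.

(** * The Jacobi algebra of [q + x y^2 + p(x)] *)

Section Structure.
Variables (K : fieldType) (d : nat) (d_ge2 : (2 <= d)%N).
Local Notation series := (ncseries K d).
Local Notation pser := (pser K).
Local Notation t := (tvar K).
Local Notation x := (varx K d_ge2).
Local Notation y := (vary K d_ge2).
Local Notation ix := (ix d_ge2).
Local Notation iy := (iy d_ge2).
Local Notation atx := (at_x d_ge2).
Hypothesis K2 : (2 : K) != 0.
Variable p : pser.
Hypothesis p_ord : order_ge 3 p.
Implicit Types (u : series) (a b : pser).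

Local Notation pot := (xy_pot d_ge2 p).
Local Notation I := (jId pot).

(** In the Jacobi algebra [y^2 = s(x)] with [s = ysq].  As [y] also commutes with
    [y^2], while [y s(x) = s(-x) y], twice the odd part of [s], here [yodd],
    annihilates [y]. *)
Definition ysq : pser := - pder p.
Definition yodd : pser := ysq - pconj ysq.
Local Notation s := ysq.
Local Notation sigma := yodd.

Let I2 : two_sided_ideal I. Proof. exact: jacobi_two_sided. Qed.

Lemma ysq_ord : order_ge 2 s.
Proof. by apply: ordN; exact: order_pder. Qed.

Lemma jac_z i : isz i -> I (var K i).
Proof.
move=> zi; have := jacobi_der pot i; rewrite der_xy_pot zi => /(idealZ 2^-1 I2).
by rewrite scalerA mulVf // scale1r.
Qed.

Lemma jac_xy : I (x * y + y * x).
Proof. by have := jacobi_der pot iy; rewrite der_xy_pot isz_iy iy_ix. Qed.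

Lemma jac_yy : I (y ^+ 2 - atx s).
Proof.
have := jacobi_der pot ix; rewrite der_xy_pot isz_ix eqxx.
by rewrite /ysq (linearN atx) /= opprK.
Qed.

(** Moving [y] past the letters of [a] one at a time is possible up to any order,
    and the ideal is closed. *)
Lemma jac_y_atx a : I (y * atx a - atx (pconj a) * y).
Proof.
apply: (jacobi_closed pot).2 => k.
suff [e E ek] : exists2 e, I e & order_ge k (y * atx a - atx (pconj a) * y - e) by exists e.
elim: k a => [|k IH] a; first by exists 0; [exact: (ideal0 I2)|].
have [e E ek] := IH (lquo ord0 a).
exists ((x * y + y * x) * atx (lquo ord0 a : pser) - x * e).
  by apply: (idealB I2); [apply: (idealMr I2); exact: jac_xy|exact: (idealMl I2)].
set a' : pser := lquo ord0 a in e E ek *.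
have -> : y * atx a - atx (pconj a) * y = y * x * atx a' + x * atx (pconj a') * y.
  rewrite (pconj_rec a) {1}[a]pser_split (linearD atx) (linearB atx) /= !linearZ /= !rmorph1 !rmorphM /=.
  rewrite at_x_var mulrDr mulrDl mulNr -scalerAr -scalerAl mulr1 mul1r !mulrA.
  by series_ring.
have -> : y * x * atx a' + x * atx (pconj a') * y - ((x * y + y * x) * atx a' - x * e) =
    - (x * (y * atx a' - atx (pconj a') * y - e)).
  by rewrite !mulrBr mulrDl !mulrA; series_ring.
move=> w wk; rewrite oppsE -[k.+1]add1n in wk *.
rewrite (low_sizeM _ ek wk) ?oppr0 //; apply: low1_nocst; exact: at_x_nocst ord0.
Qed.

(** [s(-x) y = y s(x) = y^3 = s(x) y]. *)
Lemma jac_odd_y a : I (atx (sigma * a) * y).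
Proof.
suff H : I (atx sigma * y) by rewrite mulrC rmorphM -mulrA; apply: (idealMl I2).
have e1 : I (y * atx s - y ^+ 3).
  rewrite exprS -mulrBr -opprB mulrN; apply: (idealN I2); apply: (idealMl I2).
  exact: jac_yy.
have e2 : I (y ^+ 3 - atx s * y).
  by rewrite exprSr -mulrBl; apply: (idealMr I2); exact: jac_yy.
have e3 := jac_y_atx s.
have -> : atx sigma * y = (y * atx s - atx (pconj s) * y) -
    ((y * atx s - y ^+ 3) + (y ^+ 3 - atx s * y)).
  by rewrite /yodd (linearB atx) /= mulrBl; series_ring.
by apply: (idealB I2) => //; exact: (idealD I2).
Qed.

Lemma jac_odd a : I (atx (sigma * s * a)).
Proof.
have -> : sigma * s * a = sigma * a * s by ring.
have H : I (atx (sigma * a) * y ^+ 2 - atx (sigma * a * s)).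
  by rewrite [atx (_ * s)]rmorphM /= -mulrBr; apply: (idealMl I2); exact: jac_yy.
apply: (iffLR (idealB_iff I2 H)).
by rewrite expr2 mulrA; apply: (idealMr I2); exact: jac_odd_y.
Qed.

(** To see that there are no further relations, the free algebra is made to act on
    pairs [(a, b)] standing for [a(x) + b(x) y] as it would by left
    multiplication.  The elements of the Jacobi ideal map every pair into the
    subspace [W] of the relations found above.  The Boolean index selects the
    component; the basis vector [x^n y] has level [n + 1]. *)
Let V : Type := (bool * seq 'I_1)%type -> K.
Implicit Types v : V.
Let lv (bw : bool * seq 'I_1) : nat := (bw.1 + size bw.2)%N.
Let mk a b : V := fun bw => if bw.1 then b bw.2 else a bw.2.
Let fst_ (v : V) : pser := fun w => v (false, w).
Let snd_ (v : V) : pser := fun w => v (true, w).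
Let fst_mk a b : fst_ (mk a b) = a. Proof. by []. Qed.
Let snd_mk a b : snd_ (mk a b) = b. Proof. by []. Qed.

Let fstD v v' : fst_ (fun bw => v bw + v' bw) = fst_ v + fst_ v'. Proof. by []. Qed.
Let sndD v v' : snd_ (fun bw => v bw + v' bw) = snd_ v + snd_ v'. Proof. by []. Qed.

Let X (i : 'I_d) (v : V) : V :=
  if isz i then mk 0 0
  else if i == ix then mk (t * fst_ v) (t * snd_ v)
  else mk (s * pconj (snd_ v)) (pconj (fst_ v)).

Let lowP k v : low lv k v <-> order_ge k (fst_ v) /\ order_ge k.-1 (snd_ v).
Proof.
split=> [v0|[v1 v2]]; first by split=> w wk; apply: v0; rewrite /lv /=; lia.
case=> -[] w; rewrite /lv /= => wk; last exact: v1.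
by apply: v2; lia.
Qed.

Let lin_fst c (v v' : V) : fst_ (fun bw => c * v bw + v' bw) = c *: fst_ v + fst_ v'.
Proof. by []. Qed.
Let lin_snd c (v v' : V) : snd_ (fun bw => c * v bw + v' bw) = c *: snd_ v + snd_ v'.
Proof. by []. Qed.

Let X_lin i c (v v' : V) bw :
  X i (fun bw => c * v bw + v' bw) bw = c * X i v bw + X i v' bw.
Proof.
rewrite /X; case: ifP => _; first by case: bw => -[] w; rewrite /mk /= zerosE mulr0 addr0.
case: ifP => _; rewrite lin_fst lin_snd ?linearP /= ?mulrDr -?scalerAr;
  by case: bw => -[] w.
Qed.

Let X_low i k (v : V) : low lv k v -> low lv k.+1 (X i v).
Proof.
move=> /lowP[v1 v2]; apply/lowP; rewrite /X; case: ifP => _; first by split.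
case: ifP => _; split.
- by rewrite -[k.+1]add1n; apply: ordM; [exact: ord_t|exact: v1].
- case: k v1 v2 => [|k] v1 v2 //=; rewrite -[k.+1]add1n.
  by apply: ordM; [exact: ord_t|exact: v2].
- apply: (@ord_le _ (2 + k.-1)); first by lia.
  by apply: ordM; [exact: ysq_ord|exact: ord_pconj].
- exact: ord_pconj.
Qed.

Let A u (v : V) : V := act lv X u v.

Let AE u v bw : A u v bw = u [::] * v bw + \sum_i X i (A (lquo i u) v) bw.
Proof. exact: (actE X_lin X_low). Qed.

Let e0 : V := mk 1 0.
Let nf u : series := atx (fst_ (A u e0)) + atx (snd_ (A u e0)) * y.

Let A_sum u : fst_ (A u e0) = u [::] *: 1 + \sum_i fst_ (X i (A (lquo i u) e0)) /\
  snd_ (A u e0) = \sum_i snd_ (X i (A (lquo i u) e0)).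
Proof.
split; apply: seriesP => w.
  by rewrite [LHS]AE addsE scalesE; congr (_ + _); rewrite [RHS]sumsE.
by rewrite [LHS]AE /e0 /mk /= zerosE mulr0 add0r [RHS]sumsE.
Qed.

(** The normal form of [u] is [u] applied to the pair [(1, 0)] standing for [1]:
    left multiplication by a variable agrees, modulo the ideal, with the operator
    [X i] on pairs. *)
Lemma jac_nf u : exists a b, I (u - (atx a + atx b * y)) /\
  forall k, order_ge k u -> order_ge k a /\ order_ge k.-1 b.
Proof.
exists (fst_ (A u e0)), (snd_ (A u e0)); split; last first.
  by move=> k u0; apply/lowP; exact: (act_low X_lin X_low).
apply: (jacobi_closed pot).2 => k.
suff [e E ek] : exists2 e, I e & order_ge k (u - nf u - e) by exists e.
elim: k u => [|k IH] u; first by exists 0; [exact: (ideal0 I2)|].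
have /choice[e eP] i : exists e, I e /\ order_ge k (lquo i u - nf (lquo i u) - e).
  by have [e] := IH (lquo i u); exists e.
pose Y (v : V) := atx (fst_ v) + atx (snd_ v) * y.
have YX i v : I (var K i * Y v - Y (X i v)).
  rewrite /X; case: (xyzP d_ge2 i) => [zi|->|->].
  - rewrite zi /Y fst_mk snd_mk (linear0 atx) mul0r addr0 subr0.
    by apply: (idealMr I2); exact: jac_z.
  - rewrite isz_ix eqxx /Y fst_mk snd_mk.
    rewrite !rmorphM /= at_x_var -[var K ix]/x mulrDr !mulrA subrr; exact: (ideal0 I2).
  rewrite isz_iy iy_ix /Y fst_mk snd_mk.
  rewrite -[var K iy]/y; set a := fst_ v; set b := snd_ v.
  have -> : y * (atx a + atx b * y) - (atx (s * pconj b) + atx (pconj a) * y) =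
     (y * atx a - atx (pconj a) * y) + ((y * atx b - atx (pconj b) * y) * y +
       atx (pconj b) * (y ^+ 2 - atx s)).
    rewrite [s * _]mulrC rmorphM /= mulrDr mulrBl mulrBr expr2 !mulrA; series_ring.
  apply: (idealD I2); first exact: jac_y_atx.
  apply: (idealD I2); first by apply: (idealMr I2); exact: jac_y_atx.
  by apply: (idealMl I2); exact: jac_yy.
exists (\sum_i (var K i * e i + (var K i * nf (lquo i u) - Y (X i (A (lquo i u) e0))))).
  apply: (ideal_sum I2) => i _; apply: (idealD I2); last exact: YX.
  by apply: (idealMl I2); case: (eP i).
have nfE : nf u = u [::] *: 1 + \sum_i Y (X i (A (lquo i u) e0)).
  rewrite /nf (proj1 (A_sum u)) (proj2 (A_sum u)) (linearD atx) linearZ /= rmorph1 !(linear_sum atx) /=.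
  by rewrite mulr_suml big_split addrA.
rewrite {1}[u]lquo_split nfE opprD addrACA subrr add0r -!sumrB => w wk.
rewrite sumsE big1 // => i _.
have -> : var K i * lquo i u - Y (X i (A (lquo i u) e0)) -
   (var K i * e i + (var K i * nf (lquo i u) - Y (X i (A (lquo i u) e0)))) =
   var K i * (lquo i u - nf (lquo i u) - e i).
  by rewrite !mulrBr; series_ring.
rewrite -[k.+1]add1n in wk; case: (eP i) => _ ei.
by apply: (low_sizeM _ ei wk); apply: low1_nocst; rewrite varE.
Qed.

Let W (v : V) := (exists a, fst_ v = sigma * s * a) /\ (exists b, snd_ v = sigma * b).

Let W_lin c v v' : W v -> W v' -> W (fun bw => c * v bw + v' bw).
Proof.
move=> [[a e1] [b e2]] [[a' e1'] [b' e2']].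
split; [exists (c *: a + a')|exists (c *: b + b')].
  by rewrite lin_fst e1 e1' mulrDr -scalerAr.
by rewrite lin_snd e2 e2' mulrDr -scalerAr.
Qed.

Let W0 : W (fun=> 0).
Proof. by split; exists 0; rewrite mulr0. Qed.

Let W_closed v : (forall k, exists2 v', W v' & low lv k (fun bw => v bw - v' bw)) -> W v.
Proof.
move=> H; split; apply: pser_ideal_closed => k.
  by have [v' [[a e] _] /lowP[L _]] := H k; exists a; rewrite -e; exact: L.
by have [v' [_ [b e]] /lowP[_ L]] := H k.+1; exists b; rewrite -e; exact: L.
Qed.

Let conj_sigma : pconj sigma = - sigma.
Proof. by rewrite /yodd (linearB (@pconj K)) /= pconjK; ring. Qed.

Let conj_s : pconj s = s - sigma.
Proof. by rewrite /yodd; ring. Qed.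

Let W_X i v : W v -> W (X i v).
Proof.
move=> [[a e1] [b e2]]; rewrite /X; case: ifP => _.
  by split; exists 0; rewrite ?fst_mk ?snd_mk mulr0.
case: ifP => _; split.
- exists (t * a); rewrite ?fst_mk ?snd_mk e1; ring.
- by exists (t * b); rewrite ?fst_mk ?snd_mk e2; ring.
- exists (- pconj b); rewrite ?fst_mk ?snd_mk e2 rmorphM /= conj_sigma; ring.
- exists (- (pconj s * pconj a)); rewrite ?fst_mk ?snd_mk e1 !rmorphM /= conj_sigma; ring.
Qed.

Let W_sum (v : 'I_d -> V) : (forall i, W (v i)) -> W (fun bw => \sum_i v i bw).
Proof.
move=> H; elim: (index_enum _) => [|i r IH].
  by rewrite (_ : (fun _ => _) = fun=> 0) //; apply/funext => bw; rewrite big_nil.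
rewrite (_ : (fun _ => _) = fun bw => 1 * v i bw + \sum_(j <- r) v j bw).
  exact: W_lin.
by apply/funext => bw; rewrite big_cons mul1r.
Qed.

Let W_A u v : W v -> W (A u v).
Proof.
move=> Wv; apply: W_closed => k.
elim: k u => [|k IH] u; first by exists (fun=> 0).
have /choice[w wP] i : exists w, W w /\ low lv k (fun bw => A (lquo i u) v bw - w bw).
  by have [w] := IH (lquo i u); exists w.
exists (fun bw => u [::] * v bw + \sum_i X i (w i) bw).
  by apply: W_lin => //; apply: W_sum => i; apply: W_X; case: (wP i).
move=> bw bwk; rewrite AE opprD addrACA subrr add0r -sumrB big1 // => i _.
rewrite -[- _]mulN1r addrC -X_lin.
case: (wP i) => _ /X_low; move/(_ i bw bwk) => <-; congr (X i _ bw).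
by apply/funext => z; rewrite mulN1r addrC.
Qed.

Let A_atx a v : A (atx a) v = mk (a * fst_ v) (a * snd_ v).
Proof.
have D0 b v' k : low lv k (fun bw => A (atx b) v' bw - mk (b * fst_ v') (b * snd_ v') bw).
  elim: k b v' => [|k IH] b v' // bw bwk.
  have AD u u' v1 : A (u + u') v1 bw = A u v1 bw + A u' v1 bw.
    by have := act_linl X_lin X_low 1 u u' v1 bw; rewrite scale1r mul1r.
  have AZ c v1 : A (c *: 1) v1 bw = c * v1 bw.
    have := act_linl X_lin X_low c 1 0 v1 bw; rewrite addr0 /A => ->.
    rewrite (act1 X_lin X_low) -[X in _ + X](_ : 0 = _) ?addr0 //.
    by symmetry; apply: (act_low X_lin X_low (k := (lv bw).+1)).
  have -> : atx b = b [::] *: 1 + x * atx (lquo ord0 b : pser).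
    by rewrite {1}[b]pser_split (linearD atx) linearZ /= rmorph1 rmorphM /= at_x_var.
  rewrite AD AZ {1}/A (actM X_lin X_low) (act_var X_lin X_low) -/(A _ _).
  set b' : pser := lquo ord0 b.
  have -> : mk (b * fst_ v') (b * snd_ v') bw =
      b [::] * v' bw + X ix (mk (b' * fst_ v') (b' * snd_ v')) bw.
    rewrite /X isz_ix eqxx {1 2}[b]pser_split -/b' !mulrDl -!scalerAl !mul1r -!mulrA.
    by case: (bw) => -[] w.
  rewrite opprD addrACA subrr add0r -[- _]mulN1r addrC -X_lin.
  move: (@X_low ix _ _ (IH b' v') bw bwk) => <-; congr (X ix _ bw).
  by apply/funext => z; rewrite mulN1r addrC.
apply/funext => bw; apply/eqP; rewrite -subr_eq0; apply/eqP.
exact: (D0 a v (lv bw).+1).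
Qed.

(** [W] is a closed submodule, so it suffices to apply the three kinds of cyclic
    derivatives to a pair: the components of the result vanish or are multiples of
    [yodd]. *)
Lemma jac_W u v : I u -> W (A u v).
Proof.
move=> Iu; move: u Iu v; apply: (jacobi_min (S := fun u => forall v, W (A u v))).
  have Alin c u u' v : A (c *: u + u') v = fun bw => c * A u v bw + A u' v bw.
    by apply/funext => bw; exact: (act_linl X_lin X_low).
  have A0 v : A 0 v = fun=> 0.
    by apply/funext => bw; apply: (act_low X_lin X_low (k := (lv bw).+1)).
  split; first split; first split.
  - by move=> v; rewrite A0.
  - by move=> u u' Hu Hu' v; rewrite -[u]scale1r Alin; apply: W_lin.
  - by move=> a u Hu v; rewrite /A (actM X_lin X_low); apply: W_A; exact: Hu.
  - by move=> u a Hu v; rewrite /A (actM X_lin X_low); exact: Hu.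
  move=> u H v; apply: W_closed => k; have [e He ek] := H k.
  exists (A e v) => //.
  have -> : (fun bw => A u v bw - A e v bw) = A (u - e) v.
    rewrite -[u - e]addrC -scaleN1r Alin; apply/funext => bw.
    by rewrite mulN1r addrC.
  exact: (act_low X_lin X_low).
have AD u u' v : A (u + u') v = fun bw => A u v bw + A u' v bw.
  apply/funext => bw.
  by have := act_linl X_lin X_low 1 u u' v bw; rewrite scale1r mul1r.
have AM u u' v : A (u * u') v = A u (A u' v) by exact: (actM X_lin X_low).
have Av i v : A (var K i) v = X i v by exact: (act_var X_lin X_low).
move=> i v; rewrite der_xy_pot; case: (xyzP d_ge2 i) => [zi|->|->].
- rewrite zi (_ : 2 *: _ = var K i + var K i); last by rewrite scaler_nat mulr2n.
  rewrite AD Av /X zi; split; exists 0; rewrite mulr0 ?fstD ?sndD ?fst_mk ?snd_mk; exact: addr0.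
- rewrite isz_ix eqxx AD expr2 AM A_atx -[y]/(var K iy) !Av /X isz_iy iy_ix.
  split; rewrite ?fstD ?sndD ?fst_mk ?snd_mk.
    by exists 0; rewrite pconjK -mulrDl /ysq addNr mul0r mulr0.
  exists (- snd_ v); rewrite rmorphM /= pconjK.
  have -> : pder p = - s by rewrite /ysq opprK.
  by rewrite /yodd; ring.
- rewrite isz_iy iy_ix AD !AM -[x]/(var K ix) -[y]/(var K iy) !Av /X isz_ix isz_iy iy_ix eqxx.
  split; exists 0; rewrite mulr0 ?fstD ?sndD ?fst_mk ?snd_mk rmorphM /= pconj_t; ring.
Qed.

(** The relation [sigma y = 0] and its multiple [sigma y^2 = sigma s = 0] are the
    only ones: applying an element of the ideal to [(1, 0)] gives its components,
    which lie in [W]. *)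
Lemma jac_nf_eq a b : I (atx a + atx b * y) <->
  (exists a', a = sigma * s * a') /\ (exists b', b = sigma * b').
Proof.
split=> [H|[[a' ->] [b' ->]]]; last first.
  by apply: (idealD I2); [exact: jac_odd|exact: jac_odd_y].
have := jac_W e0 H.
have -> : A (atx a + atx b * y) e0 = mk a b.
  apply/funext => bw.
  have := act_linl X_lin X_low 1 (atx a) (atx b * y) e0 bw.
  rewrite scale1r mul1r (actM X_lin X_low) -[y]/(var K iy) (act_var X_lin X_low).
  rewrite -!/(A _ _) => ->; rewrite !A_atx /X isz_iy iy_ix.
  rewrite /e0 !fst_mk !snd_mk (linear0 (@pconj K)) rmorph1 !mulr0 !mulr1.
  by case: bw => -[] w; rewrite /mk /= ?zerosE ?add0r ?addr0.
by [].
Qed.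

Lemma jac_nf_mul a b a' b' :
  I ((atx a + atx b * y) * (atx a' + atx b' * y) -
     (atx (a * a' + b * pconj b' * s) + atx (a * b' + b * pconj a') * y)).
Proof.
have -> : (atx a + atx b * y) * (atx a' + atx b' * y) -
     (atx (a * a' + b * pconj b' * s) + atx (a * b' + b * pconj a') * y) =
   atx b * (y * atx a' - atx (pconj a') * y) + atx b * (y * atx b' - atx (pconj b') * y) * y
   + atx (b * pconj b') * (y ^+ 2 - atx s).
  rewrite !(linearD atx) /= !rmorphM /= expr2 !(mulrDl, mulrDr, mulrN, mulNr) !mulrA.
  by series_ring.
apply: (idealD I2); first apply: (idealD I2).
- by apply: (idealMl I2); exact: jac_y_atx.
- by apply: (idealMr I2); apply: (idealMl I2); exact: jac_y_atx.
- by apply: (idealMl I2); exact: jac_yy.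
Qed.

End Structure.

(** * Reparametrization *)

Section Reparam.
Variables (K : fieldType) (d : nat) (d_ge2 : (2 <= d)%N).
Local Notation series := (ncseries K d).
Local Notation pser := (pser K).
Local Notation t := (tvar K).
Local Notation x := (varx K d_ge2).
Local Notation y := (vary K d_ge2).
Local Notation ix := (ix d_ge2).
Local Notation iy := (iy d_ge2).
Local Notation atx := (at_x d_ge2).
Local Notation pconj := (@pconj K).
Hypothesis K2 : (2 : K) != 0.
Variables p P gam bet c : pser.
Hypothesis p_ord : order_ge 3 p.
Hypothesis P_ord : order_ge 3 P.

Local Notation s := (ysq p).
Local Notation sigma := (yodd p).
Local Notation S := (ysq P).
Local Notation Sigma := (yodd P).

(** The variables [x] and [y] are replaced by [gam(x)] and [bet(x) y], where [gam]
    is odd and [bet] is even, so that they still anticommute.  The relation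
    [y^2 = S(x)] is then mapped to [bet(x)^2 y^2 = S(gam(x))], which has to hold in
    the algebra of [p]; as [sigma s] vanishes there, [S_gam] may be relaxed by a
    multiple of it. *)
Hypothesis gam_unit : exists2 g, gam = t * g & punit g.
Hypothesis gam_odd : pconj gam = - gam.
Hypothesis bet_unit : punit bet.
Hypothesis bet_even : pconj bet = bet.

Definition atg : pser -> pser := subs (fun=> gam).
HB.instance Definition _ := GRing.isLinear.Build K pser pser *:%R atg
  (subs_linear (fun=> gam : ncseries K 1)).
HB.instance Definition _ := GRing.isMonoidMorphism.Build pser pser atg
  (subs_monoid (fun=> gam : ncseries K 1)).

Hypothesis S_gam : atg S = bet ^+ 2 * s + sigma * s * c.

Let gam0 : nocst (fun _ : 'I_1 => gam : ncseries K 1).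
Proof.
by move=> _; case: gam_unit => g -> _; rewrite -[LHS]/(pcoef 0 (t * g)) pcoef0M /pcoef /tvar varE mul0r.
Qed.

Let atg_inv : exists2 psi : 'I_1 -> ncseries K 1, nocst psi & inverse_subs (fun=> gam) psi.
Proof.
case: gam_unit => g gE /punitP g0.
have [||psi ips] := @inverse_subs_exists K 1 (fun=> 1%N) (fun=> erefl) (fun=> pcoef 0 g) _ gam0.
- by move=> _; exact: g0.
- move=> i; apply/low_order_ge; rewrite ord1 gE.
  have -> : t * g - pcoef 0 g *: (t : ncseries K 1) = t * (g - pcoef 0 g *: 1) :> pser.
    by rewrite mulrBr -scalerAr mulr1.
  rewrite -[2%N]/(1 + 1)%N; apply: ordM; first exact: ord_t.
  by apply/ord1P; rewrite addsE oppsE scalesE onesE mulr1 subrr.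
by exists psi => //; case: ips.
Qed.

Let atg_inj a : atg a = 0 -> a = 0.
Proof.
by have [psi _ [_ _ K1 _]] := atg_inv => e; rewrite -[a]K1 -/(atg a) e raddf0.
Qed.

Let atg_surj a : exists b, atg b = a.
Proof. by have [psi _ [_ _ _ K1]] := atg_inv; exists (subs psi a); exact: K1. Qed.

Let conj_s : pconj s = s - sigma. Proof. by rewrite /yodd; ring. Qed.
Let conj_sigma : pconj sigma = - sigma.
Proof. by rewrite /yodd (linearB pconj) /= pconjK; ring. Qed.

Let atg_conj a : atg (pconj a) = pconj (atg a).
Proof.
rewrite /atg /pconj !subs_comp //; [|exact: nocst_Nt..].
apply: (congr1 (fun f => subs f a)); apply/funext => _.
rewrite (linearN (subs (fun=> gam))) /= [X in - X](subs_var _ gam0).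
by rewrite -gam_odd.
Qed.

(** [S] and [Sigma] correspond to [s] and [sigma] up to units, so that the two
    algebras have the same relations between normal forms. *)
Let S_unit : exists2 v, punit v & atg S = s * v.
Proof.
exists (bet ^+ 2 + sigma * c); last by rewrite S_gam; ring.
apply/punitP; rewrite pcoefD [X in _ + X](_ : _ = 0) ?addr0.
  by apply/punitP; apply: punitX.
rewrite pcoef0M /yodd pcoefD pcoefN (_ : pcoef 0 s = 0).
  by rewrite pcoef_pconj (_ : pcoef 0 s = 0) ?mulr0 ?oppr0 ?add0r ?mul0r //; apply: pcoef_ord (ysq_ord p_ord) _.
by apply: pcoef_ord (ysq_ord p_ord) _.
Qed.

Let Sigma_unit : exists2 v, punit v & atg Sigma = sigma * v.
Proof.
exists (bet ^+ 2 + (s * c + pconj s * pconj c)); last first.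
  rewrite {1}/yodd (linearB atg) /= atg_conj S_gam.
  rewrite (linearD pconj) /= !rmorphM /= ?rmorphXn /= bet_even conj_sigma conj_s; ring.
apply/punitP; rewrite pcoefD [X in _ + X](_ : _ = 0) ?addr0.
  by apply/punitP; apply: punitX.
have s0 : pcoef 0 s = 0 by apply: pcoef_ord (ysq_ord p_ord) _.
by rewrite pcoefD !pcoef0M pcoef_pconj s0 mulr0 !mul0r addr0.
Qed.

Let phi (i : 'I_d) : series :=
  if i == ix then atx gam else if i == iy then atx bet * y else var K i.

Let phi_x : phi ix = atx gam. Proof. by rewrite /phi eqxx. Qed.
Let phi_y : phi iy = atx bet * y. Proof. by rewrite /phi iy_ix eqxx. Qed.
Let phi_z i : isz i -> phi i = var K i.
Proof.
move=> zi; rewrite /phi; case: eqP zi => [->|_]; first by rewrite isz_ix.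
by case: eqP => // ->; rewrite isz_iy.
Qed.

Let y0 : y [::] = 0. Proof. by rewrite /vary varE. Qed.

Let phi0 : nocst phi.
Proof.
move=> i; rewrite /phi; case: ifP => _.
  by rewrite [LHS](subs_nil _ (at_x_nocst K d_ge2)); exact: (gam0 ord0).
by case: ifP => _; rewrite ?mulsE_nil ?y0 ?mulr0 ?varE.
Qed.

Let atx_low1 (a : pser) : order_ge 1 a -> order_ge 1 (atx a : series).
Proof.
move=> a0; apply: low1_nocst.
by rewrite [LHS](subs_nil _ (at_x_nocst K d_ge2)) a0.
Qed.

Let phi_inv : exists psi, inverse_subs phi psi.
Proof.
case: gam_unit => g gE /punitP g0; move/punitP: bet_unit => b0.
apply: (@inverse_subs_exists K d (fun=> 1%N) (fun=> erefl)
  (fun i => if i == ix then pcoef 0 g else if i == iy then pcoef 0 bet else 1)) => //.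
  by move=> i; case: ifP => _ //; case: ifP => _ //; exact: oner_neq0.
have H (a : pser) : order_ge 1 (atx (a - pcoef 0 a *: 1)).
  by apply: atx_low1; apply/ord1P; rewrite addsE oppsE scalesE onesE mulr1 subrr.
move=> i; apply/low_order_ge; rewrite /phi; case: eqP => [->|_].
  have -> : atx gam - pcoef 0 g *: var K ix = x * atx (g - pcoef 0 g *: 1).
    by rewrite gE rmorphM /= at_x_var (linearB atx) /= [atx (_ *: _)]linearZ /= rmorph1 mulrBr -scalerAr mulr1.
  rewrite -[2%N]/(1 + 1)%N; apply: low_sizeM; last exact: H.
  by apply: low1_nocst; rewrite /varx varE.
case: eqP => [->|_]; last by rewrite scale1r subrr.
have -> : atx bet * y - pcoef 0 bet *: var K iy = atx (bet - pcoef 0 bet *: 1) * y.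
  by rewrite (linearB atx) /= [atx (_ *: _)]linearZ /= rmorph1 mulrBl -scalerAl mul1r.
rewrite -[2%N]/(1 + 1)%N; apply: low_sizeM; first exact: H.
by apply: low1_nocst; rewrite /vary varE.
Qed.

Let phi_atx a : subs phi (atx a) = atx (atg a).
Proof.
rewrite /at_x /atg !subs_comp //; try exact: at_x_nocst.
apply: (congr1 (fun f => subs f a)); apply/funext => _.
by rewrite [LHS](subs_var _ phi0) phi_x.
Qed.

Let I_half u : jId (xy_pot d_ge2 P) u -> jId (xy_pot d_ge2 p) (subs phi u).
Proof.
have I2 := jacobi_two_sided (xy_pot d_ge2 p).
move: u; apply: (jacobi_min (S := fun u => jId (xy_pot d_ge2 p) (subs phi u))).
  exact: closed_preim (jacobi_closed _).
have px : subs phi x = atx gam by rewrite /varx subs_var // phi_x.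
have py : subs phi y = atx bet * y by rewrite /vary subs_var // phi_y.
have C1 (a : pser) : jId (xy_pot d_ge2 p) (y * atx a - atx (pconj a) * y) by exact: jac_y_atx.
move=> i; rewrite der_xy_pot; case: (xyzP d_ge2 i) => [zi|->|->].
- rewrite zi linearZ /= subs_var // phi_z //.
  by apply: (idealZ _ I2); exact: (jac_z d_ge2 K2).
- rewrite isz_ix eqxx (linearD (subs phi)) /= rmorphXn /= py phi_atx.
  have -> : (atx bet * y) ^+ 2 + atx (atg (pder P)) =
     atx bet * ((y * atx bet - atx (pconj bet) * y) * y) + atx (bet ^+ 2) * (y ^+ 2 - atx s)
      - atx (sigma * s * c).
    have -> : atx (atg (pder P)) = - atx (bet ^+ 2) * atx s - atx (sigma * s * c).
      rewrite mulNr -rmorphM /= -opprD -(linearD atx) /= -S_gam /ysq.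
      by rewrite (linearN atg) (linearN atx) /= opprK.
    rewrite bet_even !expr2 !rmorphM /= !(mulrDl, mulrDr, mulrN, mulNr) !mulrA.
    by series_ring.
  apply: (idealB I2); last exact: jac_odd.
  apply: (idealD I2); last by apply: (idealMl I2); exact: jac_yy.
  by apply: (idealMl I2); apply: (idealMr I2); exact: C1.
- rewrite isz_iy iy_ix (linearD (subs phi)) /= !rmorphM /= px py.
  have -> : atx gam * (atx bet * y) + atx bet * y * atx gam =
      atx bet * (y * atx gam - atx (pconj gam) * y).
    rewrite gam_odd (linearN atx) /= mulNr opprK mulrDr !mulrA addrC; congr (_ + _).
    by rewrite -!(rmorphM atx) /= mulrC.
  by apply: (idealMl I2); exact: C1.
Qed.

(** The substitution maps the first ideal into the second by construction.
    Conversely, an element whose image vanishes is compared with its normal form,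
    whose components are divisible by the right series by [jac_nf_eq]. *)
Lemma reparam_subs_iso : subs_iso (xy_pot d_ge2 p) (xy_pot d_ge2 P).
Proof.
have [psi [_ psi0 K1 K2']] := phi_inv.
have key u : jId (xy_pot d_ge2 P) u <-> jId (xy_pot d_ge2 p) (subs phi u).
  split; first exact: I_half.
  have [a [b [ab _]]] := jac_nf d_ge2 K2 P_ord u.
  have I2 := jacobi_two_sided (xy_pot d_ge2 p).
  move=> Hu; have := I_half ab; rewrite (linearB (subs phi)) /=.
  have -> : subs phi (atx a + atx b * y) = atx (atg a) + atx (atg b * bet) * y.
    rewrite (linearD (subs phi)) rmorphM /= !phi_atx [subs phi y]subs_var // phi_y.
    by rewrite mulrA -rmorphM.
  move=> Hab; have Hn := iffLR (idealB_iff I2 Hab) Hu.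
  have [[a' ea] [b' eb]] := iffLR (jac_nf_eq d_ge2 K2 p_ord _ _) Hn.
  apply: (iffRL (idealB_iff (jacobi_two_sided _) ab)); apply: (iffRL (jac_nf_eq d_ge2 K2 P_ord _ _)).
  have [v [v' vv] Sv] := S_unit; have [w [w' ww] Sw] := Sigma_unit.
  have [a1 a1E] := atg_surj (v' * w' * a').
  have [bet' bb] := bet_unit; have [b1 b1E] := atg_surj (w' * b' * bet').
  split; [exists a1|exists b1]; apply/eqP; rewrite -subr_eq0; apply/eqP; apply: atg_inj.
    rewrite (linearB atg) /= !rmorphM /= a1E Sv Sw ea.
    have -> : sigma * w * (s * v) * (v' * w' * a') = sigma * s * a' * (v * v') * (w * w') by ring.
    by rewrite vv ww !mulr1 subrr.
  rewrite (linearB atg) /= !rmorphM /= b1E Sw.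
  have -> : sigma * w * (w' * b' * bet') = sigma * b' * (w * w') * bet' by ring.
  by rewrite ww mulr1 -eb -mulrA bb mulr1 subrr.
exists psi; split=> // [v|u]; first by exists (subs phi v).
by rewrite key K2'.
Qed.

End Reparam.

(** * Roots of power series *)

Section Roots.
Variable K : numClosedFieldType.
Local Notation pser := (pser K).
Local Notation t := (tvar K).
Local Notation pconj := (@pconj K).
Implicit Types (a b g u : pser).

Let K2 : (2 : K) != 0. Proof. by rewrite pnatr_eq0. Qed.

(** If [psi] is the inverse of the substitution [t := (1 + t)^k - 1], then
    [1 + psi(t)] is a [k]-th root of [1 + t]; any unit is [1 + w] up to a
    constant. *)
Lemma pser_root k u : (0 < k)%N -> punit u -> exists2 g, g ^+ k = u & punit g.
Proof.
move=> k0 /punitP u0.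
pose phi := fun _ : 'I_1 => ((1 + t) ^+ k - 1 : ncseries K 1).
have phi_lead : order_ge 2 (phi ord0 - k%:R *: (t : ncseries K 1)).
  suff: order_ge 2 ((1 + t) ^+ k - 1 - k%:R *: t) by [].
  elim: (k) => [|j IH]; first by rewrite expr0 scale0r subr0 subrr.
  have -> : (1 + t) ^+ j.+1 - 1 - j.+1%:R *: t =
     ((1 + t) ^+ j - 1 - j%:R *: t) * (1 + t) + j%:R *: t ^+ 2 :> pser.
    by rewrite exprS !scaler_nat -(mulr_natl _ j) -(mulr_natl t j.+1) -(mulr_natl _ j) -natr1; ring.
  apply: ordD; first exact: ordMr.
  by apply: ordZ; exact: ord_tX.
have phi0 : nocst phi.
  move=> i; have /(_ [::] isT) := phi_lead.
  by rewrite addsE oppsE scalesE /tvar varE mulr0 subr0.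
have [||psi [_ psi0 K1 _]] := @inverse_subs_exists K 1 (fun=> 1%N) (fun=> erefl) (fun=> k%:R) phi phi0.
- by move=> _; rewrite pnatr_eq0 -lt0n.
- by move=> i; apply/low_order_ge; rewrite (ord1 i).
have r1 : (1 + psi ord0 : pser) ^+ k = 1 + t.
  have := K1 (var K ord0); rewrite subs_var // /phi => e.
  have e1 : subs psi ((1 + t) ^+ k - 1) = (1 + psi ord0) ^+ k - 1.
    by rewrite (linearB (subs psi)) /= rmorph1 rmorphXn rmorphD /= rmorph1 [subs psi t]subs_var.
  have e2 : (1 + psi ord0 : pser) ^+ k - 1 = t by rewrite -[RHS]e -e1.
  by rewrite -e2 [RHS]addrC subrK.
pose w : ncseries K 1 := (pcoef 0 u)^-1 *: u - 1.
have w0 : nocst (fun _ : 'I_1 => w).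
  by move=> _; rewrite /w addsE oppsE scalesE onesE -[u [::]]/(pcoef 0 u) mulVf ?subrr.
have r2 : (1 + subs (fun=> w) (psi ord0) : pser) ^+ k = (pcoef 0 u)^-1 *: u.
  have e3 : subs (fun=> w) ((1 + psi ord0) ^+ k : ncseries K 1) = (1 + subs (fun=> w) (psi ord0)) ^+ k.
    by rewrite rmorphXn rmorphD /= rmorph1.
  have e4 : subs (fun=> w) (1 + var K ord0 : ncseries K 1) = (1 + w : ncseries K 1).
    by rewrite (linearD (subs _)) /= rmorph1 subs_var.
  rewrite -[LHS]e3 [X in subs _ X]r1 [LHS]e4 /w addrC subrK //.
exists ((k.-root (pcoef 0 u)) *: (1 + subs (fun=> w) (psi ord0) : pser)).
  by rewrite exprZn r2 rootCK // scalerA mulfV // scale1r.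
apply/punitP; rewrite pcoefZ mulf_neq0 //.
  by rewrite rootC_eq0.
rewrite pcoefD pcoef01 [pcoef 0 _](subs_nil _ w0) psi0 addr0; exact: oner_neq0.
Qed.

Let t2 := fun _ : 'I_1 => (t ^+ 2 : ncseries K 1).
Let t20 : nocst t2.
Proof. by move=> i; rewrite /t2 exprs_nil /tvar varE expr0n. Qed.

Lemma even_series a : pconj a = a -> exists b : pser, a = subs t2 b.
Proof.
move=> ae; exists (fun w => pcoef (2 * size w) a); apply: pserP => n.
have odd0 m : odd m -> pcoef m a = 0.
  move=> om; have := congr1 (pcoef m) ae; rewrite pcoef_pconj -signr_odd om mulN1r.
  by move=> /eqP; rewrite eq_sym -subr_eq0 opprK -mulr2n -mulr_natl mulf_eq0 (negPf K2) => /eqP.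
have H (b : pser) m : pcoef m (subs t2 b) = if odd m then 0 else pcoef m./2 b.
  elim/ltn_ind: m b => m IH b.
  have e : subs t2 b = b [::] *: 1 + t * (t * subs t2 (lquo ord0 b)) :> pser.
    by rewrite (subsE b t20) big_ord1 /t2 expr2 mulrA.
  rewrite e pcoefD; case: m IH => [|[|m]] IH.
  - by rewrite pcoefZ pcoef01 mulr1 pcoef0M /pcoef /tvar varE mul0r addr0.
  - rewrite pcoef_tM pcoef0M pcoefZ [pcoef 1 1]onesE mulr0 add0r.
    by rewrite /pcoef /tvar varE mul0r.
  - rewrite !pcoef_tM IH // pcoefZ [pcoef _ 1]onesE mulr0 add0r /= negbK.
    by case: ifP.
rewrite H; case: ifP => [/odd0 //|/negbT /even_halfK e].
by rewrite [RHS]/pcoef size_nseq mul2n e.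
Qed.

Lemma subs_t2_even b : pconj (subs t2 b) = subs t2 b.
Proof.
rewrite /pconj subs_comp //; last exact: nocst_Nt.
apply: (congr1 (fun f => subs f b)); apply/funext => i; rewrite /t2 rmorphXn /=.
by rewrite [subs _ t](subs_var _ (@nocst_Nt K)) sqrrN.
Qed.

(** The root is taken as a series in [t^2], so that it is even again. *)
Lemma even_root k u : (0 < k)%N -> punit u -> pconj u = u ->
  exists g, [/\ g ^+ k = u, punit g & pconj g = g].
Proof.
move=> k0 uu /even_series[b e].
have [|h hk hu] := @pser_root k b k0.
  by move: uu; rewrite !punitP e [pcoef 0 _](subs_nil _ t20).
exists (subs t2 h : pser); split.
- by rewrite e -hk [RHS]rmorphXn.
- by move: hu; rewrite !punitP [X in _ -> X != 0](subs_nil _ t20).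
- exact: subs_t2_even.
Qed.

Lemma even_inv u : punit u -> pconj u = u -> exists v, [/\ u * v = 1, punit v & pconj v = v].
Proof.
move=> [v uv] ue; exists v; split=> //; first by exists u; rewrite mulrC.
have uv' : u * pconj v = 1 by rewrite -{1}ue -rmorphM /= uv rmorph1.
by rewrite -[pconj v]mul1r -uv mulrAC uv' mul1r.
Qed.

Lemma parity_factor (e : bool) a : pconj a = (-1) ^+ e *: a -> a != 0 ->
  exists n u, [/\ a = t ^+ n * u, odd n = e, punit u & pconj u = u].
Proof.
move=> ae /pser_factor[n [u [uu aE]]]; exists n, u.
have H : (-1) ^+ n *: pconj u = (-1) ^+ e *: u.
  have := ae; rewrite aE rmorphM rmorphXn /= pconj_t -[- t]scaleN1r exprZn.
  rewrite -scalerAl scalerAr [RHS]scalerAr => E.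
  apply/eqP; rewrite -subr_eq0; apply/eqP; apply: ord_eq0 => k.
  by apply/(ord_tXM n); rewrite mulrBr E subrr.
have oe : odd n = e.
  have := congr1 (pcoef 0) H; rewrite !pcoefZ pcoef_pconj mul1r => /(mulIf _).
  move/punitP: (uu) => /[swap] /[apply]; rewrite -signr_odd.
  have N1 : (-1 == 1 :> K) = false.
    by apply/negbTE; rewrite -subr_eq0 -opprD oppr_eq0 -mulr2n.
  by case: (odd n) e {ae H} => -[] //; rewrite expr0 expr1 => /eqP; rewrite ?N1 // eq_sym N1.
split=> //; move: H; rewrite -signr_odd oe; case: e {ae oe}; rewrite ?expr0 ?expr1 ?scale1r //.
by rewrite !scaleN1r => /oppr_inj.
Qed.

End Roots.

(** * Normal forms of [q + x y^2 + p(x)] *)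

(** The exponents of [D_(n,m)], [None] standing for infinity. *)
Definition nf_n (L : nf_label) : option nat :=
  match L with DInfInf | DInfM _ => None | DNInf n | DNM_even n _ | DNM_odd n _ => Some n end.
Definition nf_m (L : nf_label) : option nat :=
  match L with DInfInf | DNInf _ => None | DInfM m | DNM_even _ m | DNM_odd _ m => Some m end.

Lemma nf_label_inj L L' : nf_valid L -> nf_valid L' ->
  nf_n L = nf_n L' -> nf_m L = nf_m L' -> L = L'.
Proof.
by case: L => [|m|n|n m|n m]; case: L' => [|m'|n'|n' m'|n' m'] /= v v' e1 e2;
  try congruence; case: e1 e2 => -> [->] in v v' *; exfalso; lia.
Qed.

Section NormalFormPot.
Variable K : fieldType.
Local Notation pser := (pser K).
Local Notation t := (tvar K).

Definition nf_even (L : nf_label) : pser := if nf_n L is Some n then t ^+ (2 * n) else 0.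
Definition nf_odd (L : nf_label) : pser := if nf_m L is Some m then t ^+ (2 * m + 1) else 0.
Definition nf_pot L : pser := nf_even L + nf_odd L.

Lemma normal_formE d (d_ge2 : (2 <= d)%N) L :
  normal_form K d_ge2 L = xy_pot d_ge2 (nf_pot L).
Proof.
have X k : at_x d_ge2 (t ^+ k) = varx K d_ge2 ^+ k by rewrite rmorphXn /= at_x_var.
rewrite /xy_pot /nf_pot (linearD (at_x d_ge2)) /=.
case: L => [|m|n|n m|n m]; rewrite /nf_even /nf_odd /= ?X ?(linear0 (at_x d_ge2)) ?addr0 ?add0r ?addrA //.
by rewrite addrAC.
Qed.

Lemma nf_pot_order L : nf_valid L -> order_ge 3 (nf_pot L).
Proof.
move=> v; apply: ordD.
  rewrite /nf_even; case: L v => [|m|n|n m|n m] //= v; apply: ord_le (@ord_tX K _).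
  - by lia.
  - by case/and3P: v => *; lia.
  - by case/andP: v => *; lia.
rewrite /nf_odd; case: L v => [|m|n|n m|n m] //= v; apply: ord_le (@ord_tX K _).
- by lia.
- by case/and3P: v => *; lia.
- by case/andP: v => *; lia.
Qed.

Lemma pder_even n : (0 < n)%N -> pder (t ^+ (2 * n)) = (2 * n)%:R *: t ^+ (2 * n - 1).
Proof.
move=> n0; have e : (2 * n = (2 * n - 1).+1)%N by lia.
by rewrite {1 2}e pder_tvarX.
Qed.

Lemma pder_odd m : pder (t ^+ (2 * m + 1)) = (2 * m + 1)%:R *: t ^+ (2 * m).
Proof. by rewrite addn1 pder_tvarX. Qed.

Lemma pder0 : pder (0 : pser) = 0.
Proof. by have := pderZ 0 (0 : pser); rewrite !scale0r. Qed.

End NormalFormPot.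

Section Classification.
Variables (K : numClosedFieldType) (d : nat) (d_ge2 : (2 <= d)%N).
Local Notation pser := (pser K).
Local Notation t := (tvar K).
Local Notation pconj := (@pconj K).

Let K2 : (2 : K) != 0. Proof. by rewrite pnatr_eq0. Qed.
Let natK n : (0 < n)%N -> n%:R != 0 :> K. Proof. by rewrite pnatr_eq0 -lt0n. Qed.

Let gam_props g : pconj g = g -> punit g ->
  (exists2 g', t * g = t * g' & punit g') /\ pconj (t * g) = - (t * g).
Proof.
by move=> ge gu; split; [exists g|rewrite rmorphM /= pconj_t ge mulNr].
Qed.

Let atg_t g k : atg (t * g) (t ^+ k) = t ^+ k * g ^+ k.
Proof.
rewrite rmorphXn /= [atg _ t]subs_var ?exprMn // => _.
by rewrite -[LHS]/(pcoef 0 (t * g)) pcoef0M /pcoef /tvar varE mul0r.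
Qed.

(** Write [p' = co + ce] with [co = t^k A] odd and [ce = t^l B] even, [A] and [B]
    being even units.  A reparametrization by [x := x g(x)] and [y := bet(x) y]
    requires the derivative of the new potential, evaluated at [x g(x)], to be
    [bet^2 p'].  As [g] and [bet] are even, the odd and even parts can be compared
    separately; the two equations between units are solved by extracting roots.
    If [co = 0] only [ce] is left, and [n] is infinite.  If [ce] has order at
    least [2 k], it is a multiple of [co p'], which vanishes in the algebra, and
    [m] is infinite. *)
Lemma xy_pot_classify (p : pser) : order_ge 3 p ->
  exists2 L, nf_valid L & subs_iso (xy_pot d_ge2 p) (normal_form K d_ge2 L).
Proof.
move=> p_ord; pose c := pder p.
have c_ord : order_ge 2 c by exact: order_pder.
pose co := 2^-1 *: (c - pconj c); pose ce := 2^-1 *: (c + pconj c).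
have cE : c = co + ce.
  rewrite -scalerDr addrACA [- _ + _]addrC subrr addr0 -mulr2n -scaler_nat.
  by rewrite scalerA mulVf // scale1r.
have co_odd : pconj co = (-1) ^+ true *: co.
  by rewrite linearZ /= (linearB pconj) /= pconjK expr1 scaleN1r -scalerN opprB.
have ce_even : pconj ce = (-1) ^+ false *: ce.
  by rewrite linearZ /= (linearD pconj) /= pconjK expr0 scale1r addrC.
have co_ord : order_ge 2 co by apply: ordZ; apply: ordB => //; exact: ord_pconj.
have ce_ord : order_ge 2 ce by apply: ordZ; apply: ordD => //; exact: ord_pconj.
have sE : ysq p = - c by [].
have sigmaE : yodd p = - (2 *: co).
  by rewrite /yodd sE (linearN pconj) /= scalerA mulfV // scale1r; ring.
have cdef : pder p = c by [].
clearbody co ce; clearbody c.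
have ordu n u : punit u -> order_ge 2 (t ^+ n * u) -> (2 <= n)%N.
  move=> /punitP u0 H; rewrite leqNgt; apply/negP => n2.
  by case/eqP: u0; rewrite -(pcoef_tXM n) addn0; apply: pcoef_ord H n2.
pose goal P g bet c0 := @reparam_subs_iso K d d_ge2 K2 p P (t * g) bet c0 p_ord.
case: (eqVneq co 0) => [co0|co_neq0].
  case: (eqVneq ce 0) => [ce0|ce_neq0].
    exists DInfInf => //; rewrite normal_formE; apply: eq_subs_iso => i.
    rewrite !der_xy_pot cdef cE co0 ce0 addr0.
    by rewrite /nf_pot /nf_even /nf_odd /= addr0 pder0.
  have [k [B [ceE k_even Bu Be]]] := parity_factor ce_even ce_neq0.
  have k2 := ordu _ _ Bu (eq_ind _ (order_ge 2) ce_ord _ ceE).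
  have [m km] : exists m, k = (2 * m)%N by exists k./2; rewrite mul2n even_halfK ?k_even.
  have v : nf_valid (DInfM m) by rewrite /=; lia.
  have m21 : (2 * m + 1)%:R != 0 :> K by apply: natK; lia.
  have [|||g [gk gu ge]] := @even_root K (2 * m) ((2 * m + 1)%:R^-1 *: B).
  - by lia.
  - by apply: punitZ => //; rewrite invr_eq0.
  - by rewrite linearZ /= Be.
  exists (DInfM m) => //; rewrite normal_formE.
  have [gp1 gp2] := gam_props ge gu.
  apply: (goal _ g 1 0 (nf_pot_order K v)) => //; first by exists 1; rewrite mulr1.
    by rewrite rmorph1.
  rewrite /ysq /nf_pot /nf_even /nf_odd /= add0r pder_odd (linearN (atg _)) /= linearZ /=.
  rewrite atg_t gk -scalerAr scalerA mulfV // scale1r expr1n mul1r mulr0 addr0.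
  by rewrite cdef cE co0 add0r ceE km.
have [k [A [coE k_odd Au Ae]]] := parity_factor co_odd co_neq0.
have k2 := ordu _ _ Au (eq_ind _ (order_ge 2) co_ord _ coE).
have [n [kn n2]] : exists n, k = (2 * n - 1)%N /\ (2 <= n)%N.
  exists k./2.+1; have := odd_double_half k; rewrite k_odd -mul2n; lia.
have n20 : (2 * n)%:R != 0 :> K by apply: natK; lia.
have [A' [AA' A'u A'e]] := even_inv Au Ae.
case: (pselect (order_ge (2 * k) ce)) => [ce_high|ce_low].
  have [g [gk gu ge]] : exists g, [/\ g ^+ k = (2 * n)%:R^-1 *: A, punit g & pconj g = g].
    apply: even_root; first by lia.
      by apply: punitZ => //; rewrite invr_eq0.
    by rewrite linearZ /= Ae.
  have [ce' ce'E] := ord_factor ce_high.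
  have [W HW] : punit (A * (A + t ^+ k * ce')).
    apply: punitM => //; apply/punitP; rewrite pcoefD pcoef0M pcoef0X.
    rewrite [pcoef 0 t]/pcoef /tvar varE expr0n (_ : (k == 0)%N = false); last by lia.
    by rewrite mul0r addr0; apply/punitP.
  have v : nf_valid (DNInf n) by [].
  exists (DNInf n) => //; rewrite normal_formE.
  have [gp1 gp2] := gam_props ge gu.
  apply: (goal _ g 1 (2^-1 *: (W * ce')) (nf_pot_order K v)) => //; first by exists 1; rewrite mulr1.
    by rewrite rmorph1.
  rewrite {1}/ysq /nf_pot /nf_even /nf_odd /= addr0 pder_even; last by lia.
  rewrite (linearN (atg _)) /= linearZ /= atg_t -kn gk -scalerAr scalerA mulfV // scale1r -coE.
  rewrite expr1n mul1r sigmaE sE.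
  have -> : - (2 *: co) * - c * (2^-1 *: (W * ce')) = ce.
    rewrite mulrNN -!scalerAl -scalerAr scalerA mulfV // scale1r cE coE ce'E.
    have -> : t ^+ k * A * (t ^+ k * A + t ^+ (2 * k) * ce') * (W * ce') =
      t ^+ (2 * k) * ce' * ((A * (A + t ^+ k * ce')) * W) by rewrite mul2n -addnn exprD; ring.
    by rewrite HW mulr1.
  by rewrite cE opprD addrNK.
have ce_neq0 : ce != 0 by apply/eqP => ce0; apply: ce_low; rewrite ce0.
have [l [B [ceE l_even Bu Be]]] := parity_factor ce_even ce_neq0.
have l2 := ordu _ _ Bu (eq_ind _ (order_ge 2) ce_ord _ ceE).
have lk : (l < 2 * k)%N.
  rewrite ltnNge; apply/negP => kl; apply: ce_low; rewrite ceE.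
  by apply: ordMr; apply: ord_le kl _; exact: ord_tX.
have [m lm] : exists m, l = (2 * m)%N by exists l./2; rewrite mul2n even_halfK ?l_even.
have [B' [BB' B'u B'e]] := even_inv Bu Be.
have m21 : (2 * m + 1)%:R != 0 :> K by apply: natK; lia.
have [g [gE gu ge]] : exists g, [/\ (2 * m + 1)%:R *: (g ^+ l * A) = (2 * n)%:R *: (g ^+ k * B),
    punit g & pconj g = g].
  case: (ltngtP l k) => [lk'|kl|e]; last by move: k_odd; rewrite -e l_even.
    have [|||g [gk gu ge]] := @even_root K (k - l) (((2 * m + 1)%:R / (2 * n)%:R) *: (A * B')).
    - by lia.
    - by apply: punitZ; [rewrite mulf_neq0 ?invr_eq0|exact: punitM].
    - by rewrite linearZ /= rmorphM /= Ae B'e.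
    exists g; split=> //; rewrite -[in RHS](subnK (ltnW lk')) exprD gk.
    rewrite -!scalerAl scalerA mulrCA mulfV // mulr1; congr (_ *: _).
    have -> : A * B' * g ^+ l * B = g ^+ l * A * (B * B') by ring.
    by rewrite BB' mulr1.
  have [|||g [gk gu ge]] := @even_root K (l - k) (((2 * n)%:R / (2 * m + 1)%:R) *: (A' * B)).
  - by lia.
  - by apply: punitZ; [rewrite mulf_neq0 ?invr_eq0|exact: punitM].
  - by rewrite linearZ /= rmorphM /= A'e Be.
  exists g; split=> //; rewrite -[in LHS](subnK (ltnW kl)) exprD gk.
  rewrite -!scalerAl scalerA mulrCA mulfV // mulr1; congr (_ *: _).
  have -> : A' * B * g ^+ k * A = g ^+ k * B * (A * A') by ring.
  by rewrite AA' mulr1.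
have [|||bet [bk bu be]] := @even_root K 2 ((2 * n)%:R *: (g ^+ k * A')).
- by [].
- by apply: punitZ => //; apply: punitM => //; exact: punitX.
- by rewrite linearZ /= rmorphM rmorphXn /= ge A'e.
have fin L : nf_valid L -> nf_n L = Some n -> nf_m L = Some m ->
    subs_iso (xy_pot d_ge2 p) (normal_form K d_ge2 L).
  move=> v Ln Lm; rewrite normal_formE; have [gp1 gp2] := gam_props ge gu.
  apply: (goal _ g bet 0 (nf_pot_order K v)) => //.
  rewrite {1}/ysq /nf_pot /nf_even /nf_odd Ln Lm pderD pder_even ?pder_odd; last by lia.
  rewrite (linearN (atg _)) (linearD (atg _)) /= !linearZ /= !atg_t -kn -lm mulr0 addr0.
  rewrite sE cE coE ceE mulrN; congr (- _); rewrite mulrDr bk; congr (_ + _).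
    rewrite -!scalerAl; congr (_ *: _).
    have -> : g ^+ k * A' * (t ^+ k * A) = t ^+ k * g ^+ k * (A * A') by ring.
    by rewrite AA' mulr1.
  have -> : (2 * n)%:R *: (g ^+ k * A') * (t ^+ l * B) = (2 * n)%:R *: (g ^+ k * B) * (t ^+ l * A').
    by rewrite -!scalerAl; congr (_ *: _); ring.
  have gE' := gE; rewrite -lm in gE'.
  rewrite -gE' -!scalerAl; congr (_ *: _).
  have -> : g ^+ l * A * (t ^+ l * A') = t ^+ l * g ^+ l * (A * A') by ring.
  by rewrite AA' mulr1.
case: (leqP n m) => nm.
  by exists (DNM_even n m); [rewrite /=; apply/and3P; split; lia|apply: fin => //=; apply/and3P; split; lia].
by exists (DNM_odd n m); [rewrite /=; apply/andP; split; lia|apply: fin => //=; apply/andP; split; lia].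
Qed.

End Classification.

(** * Dimensions of quotients *)

Section Dimension.
Variables (R : realType) (K : fieldType).

Definition subspace (V : lmodType K) (W : set V) :=
  W 0 /\ forall a u v, W u -> W v -> W (a *: u + v).

Section Basis.
Variable V : lmodType K.
Implicit Types U W : set V.

Lemma subspace_sum W (I : Type) (r : seq I) (P : pred I) (F : I -> V) :
  subspace W -> (forall i, P i -> W (F i)) -> W (\sum_(i <- r | P i) F i).
Proof.
move=> [W0 WD] WF; elim/big_ind: _ => // u v Wu Wv.
by rewrite -[u]scale1r; apply: WD.
Qed.

Lemma subspaceZ W a u : subspace W -> W u -> W (a *: u).
Proof. by move=> [W0 WD] Wu; rewrite -[_ *: _]addr0; apply: WD. Qed.

(** The matrices expressing one basis in the other have product [1], which bounds
    the sizes. *)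
Lemma basis_mod_size U W n n' (b : 'I_n -> V) (b' : 'I_n' -> V) :
  subspace W -> basis_mod U W b -> basis_mod U W b' -> (n <= n')%N.
Proof.
move=> WS [Ub Hb] [Ub' Hb'].
have /choice[c cP] i : exists c : 'rV[K]_n', W (b i - \sum_j c 0 j *: b' j).
  by have [c [Hc _]] := Hb' _ (Ub i); exists c.
have /choice[c' c'P] j : exists c : 'rV[K]_n, W (b' j - \sum_i c 0 i *: b i).
  by have [c' [Hc _]] := Hb _ (Ub' j); exists c'.
pose C := \matrix_(i, j) c i 0 j; pose C' := \matrix_(j, i) c' j 0 i.
suff /mulmx1_min : C *m C' = 1%:M by [].
apply/row_matrixP => i; have [d [dP duniq]] := Hb _ (Ub i).
rewrite -(duniq (row i (C *m C'))); last first.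
  have -> : b i - \sum_k row i (C *m C') 0 k *: b k =
      (b i - \sum_j c i 0 j *: b' j) + \sum_j c i 0 j *: (b' j - \sum_k c' j 0 k *: b k).
    rewrite [X in _ = _ + X](eq_bigr (fun j => c i 0 j *: b' j -
      c i 0 j *: \sum_k c' j 0 k *: b k)); last by move=> j _; rewrite scalerBr.
    rewrite sumrB addrA subrK; congr (_ - _).
    under [RHS]eq_bigr do rewrite scaler_sumr.
    rewrite exchange_big; apply: eq_bigr => k _ /=.
    rewrite !mxE scaler_suml; apply: eq_bigr => j _.
    by rewrite !mxE scalerA.
  rewrite -[X in X + _]scale1r; apply: WS.2; first exact: cP.
  by apply: subspace_sum => // j _; apply: subspaceZ.
apply: duniq; rewrite (bigD1 i) //= !mxE eqxx scale1r big1 ?addr0 ?subrr; first exact: WS.1.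
by move=> k ki; rewrite !mxE eq_sym (negPf ki) scale0r.
Qed.

Lemma dim_mod_basis U W n (b : 'I_n -> V) : subspace W -> basis_mod U W b ->
  dim_mod R U W = n%:R%:E.
Proof.
move=> WS Hb; rewrite /dim_mod; have -> : [set n | exists b : 'I_n -> V, basis_mod U W b] = [set n].
  apply/seteqP; split=> [m [b' Hb']|m ->] /=; last by exists b.
  by apply/eqP; rewrite eqn_leq (basis_mod_size WS Hb' Hb) (basis_mod_size WS Hb Hb').
by rewrite image_set1 ereal_inf1.
Qed.

Lemma basis_mod_exists U W n : subspace W -> dim_mod R U W = n%:R%:E ->
  exists b : 'I_n -> V, basis_mod U W b.
Proof.
move=> WS e; case: (pselect (exists m, exists b : 'I_m -> V, basis_mod U W b)) => [[m [b Hb]]|N].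
  move: e; rewrite (dim_mod_basis WS Hb) => -[/eqP]; rewrite eqr_nat => /eqP mn.
  by move: b Hb; rewrite mn => b Hb; exists b.
move: e; rewrite /dim_mod (_ : [set n | _] = set0); last first.
  by apply/seteqP; split=> // m [b Hb]; apply: N; exists m, b.
by rewrite image_set0 ereal_inf0.
Qed.

Lemma basis_mod_coord U W n (l : V -> 'rV[K]_n) (b : 'I_n -> V) :
  (forall u v a, l (u - a *: v) = l u - a *: l v) ->
  (forall a u v, U u -> U v -> U (u - a *: v)) ->
  (forall u, U u -> W u <-> l u = 0) ->
  (forall i, U (b i) /\ l (b i) = delta_mx 0 i) -> basis_mod U W b.
Proof.
move=> lB UB lW bP; split=> [i|u Uu]; first by case: (bP i).
have H (c : 'rV[K]_n) : U (u - \sum_i c 0 i *: b i) /\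
    l (u - \sum_i c 0 i *: b i) = l u - c.
  rewrite {3}[c]row_sum_delta.
  elim: (index_enum _) => [|i r [IH1 IH2]]; first by rewrite !big_nil !subr0.
  rewrite !big_cons ![_ *: _ + _]addrC !opprD !addrA; have [bi li] := bP i.
  by split; [exact: UB|rewrite lB IH2 li].
exists (l u); split=> [|c]; first by rewrite lW ?(H _).2 ?subrr; case: (H (l u)).
by rewrite lW ?(H c).2; [move=> /eqP; rewrite subr_eq0 => /eqP|case: (H c)].
Qed.

End Basis.

Lemma dim_mod_transport (V V' : lmodType K) (F : V -> V') (G : V' -> V) U W U' W' :
  cancel F G -> cancel G F -> additive F -> scalable F ->
  (forall u, U u <-> U' (F u)) -> (forall u, W u <-> W' (F u)) ->
  dim_mod R U W = dim_mod R U' W'.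
Proof.
move=> K1 K2 FB FZ FU FW; rewrite /dim_mod; congr (ereal_inf (_ @` _)).
have F0 : F 0 = 0 by rewrite -(subrr 0) FB subrr.
have FD u v : F (u + v) = F u + F v.
  by rewrite -[v in LHS]opprK -[- v]sub0r !FB F0 sub0r opprK.
have FS n (c : 'rV[K]_n) (b : 'I_n -> V) : F (\sum_i c 0 i *: b i) = \sum_i c 0 i *: F (b i).
  elim: (index_enum _) => [|i r IH]; first by rewrite !big_nil.
  by rewrite !big_cons FD FZ IH.
apply/seteqP; split=> n [b [Ub Hb]].
  exists (fun i => F (b i)); split=> [i|u Uu]; first exact/FU.
  have [c [cP cU]] := Hb (G u) (iffRL (FU _) (eq_ind_r U' Uu (K2 u))).
  exists c; split; first by move/FW: cP; rewrite FB FS K2.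
  by move=> c' Hc'; apply: cU; apply/FW; rewrite FB FS K2.
exists (fun i => G (b i)); split=> [i|u Uu]; first by apply/FU; rewrite K2.
have FSG (c : 'rV[K]_n) : F (\sum_i c 0 i *: G (b i)) = \sum_i c 0 i *: b i.
  by rewrite FS; apply: eq_bigr => i _; rewrite K2.
have [c [cP cU]] := Hb (F u) (iffLR (FU _) Uu).
exists c; split; first by apply/FW; rewrite FB FSG.
by move=> c' /FW; rewrite FB FSG; exact: cU.
Qed.

End Dimension.

Section CorankGen.
Variables (R : realType) (d : nat).
Local Notation K := (R[i]).
Local Notation series := (ncseries K d).
Implicit Types f g : series.

Lemma radical_subspace f k : subspace (@jac_radical_pow R d f k).
Proof.
have IP := @ideal_pow_ideal _ (@jacobson_radical (Jac f)) k.
split; first exact: (ideal0 IP).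
move=> a u v Hu Hv; apply: (idealD IP) => //.
by rewrite -[u]mul1r quotient_scaleAl; apply: (idealMl IP).
Qed.

Lemma corankm_iso f g m : order_ge 2 f -> order_ge 2 g -> Jac_iso f g ->
  corankm m f = corankm m g.
Proof.
move=> f2 g2 /Jac_iso_bij[F [G [FG GF FZ]]]; have [K1 K2 FB _] := FG.
have H k (u : Jac f) : @jac_radical_pow R d f k u <-> @jac_radical_pow R d g k (F u).
  by apply: (Jac_bij_pow (G := G)).
exact: (@dim_mod_transport R K (Jac f) (Jac g) F G _ _ _ _ K1 K2 FB FZ (H m) (H m.+1)).
Qed.

End CorankGen.

(** * Quadratic and cubic parts of a potential *)

Section LinearSubst.
Variables (K : fieldType) (d : nat).
Local Notation series := (ncseries K d).
Local Notation D := cyclic_derivative.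
Implicit Types (f g u v : series) (L : 'M[K]_d).

Definition lin_part u : 'rV[K]_d := \row_j u [:: j].

Lemma lin_partD u v : lin_part (u + v) = lin_part u + lin_part v.
Proof. by apply/rowP => j; rewrite !mxE. Qed.
Lemma lin_partB u v : lin_part (u - v) = lin_part u - lin_part v.
Proof. by apply/rowP => j; rewrite !mxE. Qed.
Lemma mulsE1 u v j : (u * v) [:: j] = u [::] * v [:: j] + u [:: j] * v [::].
Proof. by rewrite mulsE /= !big_ord_recl big_ord0 /= addr0. Qed.

Lemma mulsE2 u v j k : (u * v) [:: j; k] =
  u [::] * v [:: j; k] + u [:: j] * v [:: k] + u [:: j; k] * v [::].
Proof. by rewrite mulsE /= !big_ord_recl big_ord0 /= addr0 addrA. Qed.

Lemma lin_partM u v : lin_part (u * v) = u [::] *: lin_part v + v [::] *: lin_part u.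
Proof. by apply/rowP => j; rewrite !mxE mulsE1 [_ * v [::]]mulrC. Qed.

Definition linvar (a : 'rV[K]_d) : series := \sum_j a 0 j *: var K j.

Lemma linvar_nil a : linvar a [::] = 0.
Proof. by rewrite /linvar sumsE big1 // => j _; rewrite scalesE varE mulr0. Qed.

Lemma linvarE a j : linvar a [:: j] = a 0 j.
Proof.
rewrite /linvar sumsE (bigD1 j) //= scalesE varE eqxx mulr1 big1 ?addr0 // => k kj.
by rewrite scalesE varE eqseq_cons eq_sym (negPf kj) mulr0.
Qed.

Lemma lin_part_linvar a : lin_part (linvar a) = a.
Proof. by apply/rowP => j; rewrite mxE linvarE. Qed.

(** The change of variables is the transpose of [L], so that evaluating the new
    Hessian and cubic form on the coordinate vectors evaluates the old ones on the
    rows of [L]; see [hess_linsub] and [cubic_linsub]. *)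
Definition linsub L (j : 'I_d) : series := linvar (col j L)^T.

Lemma linsub_nocst L : nocst (linsub L).
Proof. by move=> j; rewrite /linsub linvar_nil. Qed.

Lemma lquo_linsub L a j : lquo a (linsub L j) = L a j *: 1.
Proof.
rewrite /linsub /linvar lquo_sum (bigD1 a) //= lquoZ lquo_var eqxx !mxE.
rewrite big1 ?addr0 // => k ka.
by rewrite lquoZ lquo_var eq_sym (negPf ka) scaler0.
Qed.

Lemma lquo_subs_linsub L a u :
  lquo a (subs (linsub L) u) = \sum_j L a j *: subs (linsub L) (lquo j u).
Proof.
rewrite {1}(subsE u (@linsub_nocst L)) lquoD lquoZ lquo1 scaler0 add0r lquo_sum.
apply: eq_bigr => j _; rewrite lquoM lquo_linsub linsub_nocst scale0r addr0.
by rewrite -scalerAl mul1r.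
Qed.

Lemma subs_linsub1 L u a : subs (linsub L) u [:: a] = \sum_j L a j * u [:: j].
Proof.
rewrite -[LHS]/(lquo a (subs (linsub L) u) [::]) lquo_subs_linsub sumsE.
by apply: eq_bigr => j _; rewrite scalesE subs_nil //; exact: linsub_nocst.
Qed.

Lemma subs_linsub2 L u a b :
  subs (linsub L) u [:: a; b] = \sum_j \sum_k L a j * L b k * u [:: j; k].
Proof.
rewrite -[LHS]/(lquo a (subs (linsub L) u) [:: b]) lquo_subs_linsub sumsE.
apply: eq_bigr => j _; rewrite scalesE subs_linsub1 mulr_sumr.
by apply: eq_bigr => k _; rewrite mulrA.
Qed.

Lemma der_linsub L f k :
  D k (subs (linsub L) f) = \sum_j L k j *: subs (linsub L) (D j f).
Proof.
rewrite cyclic_derivative_cder -(rmorph1 (subs (linsub L))) cder_subs; last exact: linsub_nocst.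
apply: eq_bigr => j _; rewrite -cyclic_derivative_cder.
rewrite /linsub /linvar cder_suml (bigD1 k) //= cderZl cder_var eqxx scale1r !mxE.
by rewrite big1 ?addr0 // => i ik; rewrite cderZl cder_var eq_sym (negPf ik) scale0r scaler0.
Qed.

Lemma linsub_comp L L' j : subs (linsub L') (linsub L j) = linsub (L' *m L) j.
Proof.
rewrite {1}/linsub {1}/linvar linear_sum /=.
under eq_bigr => a _ do rewrite linearZ /= (subs_var _ (@linsub_nocst L')) /linsub /linvar scaler_sumr.
rewrite exchange_big /linsub /linvar; apply: eq_bigr => b _ /=.
rewrite !mxE scaler_suml; apply: eq_bigr => a _.
by rewrite !mxE scalerA mulrC.
Qed.

Lemma linsub1 : linsub 1%:M =1 @var K d.
Proof.
move=> j; rewrite /linsub /linvar (bigD1 j) //= !mxE eqxx scale1r big1 ?addr0 // => i ij.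
by rewrite !mxE (negPf ij) scale0r.
Qed.

Lemma linsub_inverse L : L \in unitmx -> inverse_subs (linsub L) (linsub (invmx L)).
Proof.
move=> Lu; split; try exact: linsub_nocst.
  move=> f; rewrite subs_comp; try exact: linsub_nocst.
  by rewrite (eq_subs (linsub_comp L (invmx L))) mulVmx // (eq_subs linsub1) subs_id.
move=> f; rewrite subs_comp; try exact: linsub_nocst.
by rewrite (eq_subs (linsub_comp (invmx L) L)) mulmxV // (eq_subs linsub1) subs_id.
Qed.

Lemma linsub_subs_iso L f : L \in unitmx -> subs_iso f (subs (linsub L) f).
Proof. by move=> /linsub_inverse H; apply: (subs_iso_cyc H). Qed.

(** The quadratic and cubic parts of [f] up to cyclic rotation, as the bilinear
    and trilinear forms given by the linear and quadratic parts of the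
    derivatives.  The first is symmetric, the second only cyclically so. *)
Definition hess f : 'M[K]_d := \matrix_(i, j) D i f [:: j].

Lemma hess_sym f : (hess f)^T = hess f.
Proof.
apply/matrixP => i j; rewrite !mxE !cyclic_derivativeE /= !big_ord_recl !big_ord0 /=.
by rewrite addrC !addr0.
Qed.

Lemma row_hess f i : row i (hess f) = lin_part (D i f).
Proof. by apply/rowP => j; rewrite !mxE. Qed.

Lemma hess_linsub L f : hess (subs (linsub L) f) = L *m hess f *m L^T.
Proof.
apply/matrixP => k a; rewrite !mxE der_linsub sumsE.
under eq_bigr do rewrite scalesE subs_linsub1 mulr_sumr.
rewrite exchange_big; apply: eq_bigr => i _ /=; rewrite !mxE mulr_suml.
by apply: eq_bigr => j _; rewrite !mxE mulrCA mulrC.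
Qed.

Definition cubic f (a b c : 'rV[K]_d) : K :=
  \sum_i \sum_j \sum_k D i f [:: j; k] * a 0 i * b 0 j * c 0 k.

Lemma cubic_linsub L f i j k :
  D i (subs (linsub L) f) [:: j; k] = cubic f (row i L) (row j L) (row k L).
Proof.
rewrite der_linsub sumsE; apply: eq_bigr => i' _; rewrite scalesE subs_linsub2 mulr_sumr.
apply: eq_bigr => j' _; rewrite mulr_sumr; apply: eq_bigr => k' _.
by rewrite !mxE; ring.
Qed.

Lemma cubicC f a b c : cubic f a b c = cubic f b c a.
Proof.
have e i j k : D i f [:: j; k] = D j f [:: k; i].
  rewrite !cyclic_derivativeE /= !big_ord_recl !big_ord0 /= !addr0.
  by ring.
rewrite /cubic exchange_big; apply: eq_bigr => j _ /=.
rewrite exchange_big; apply: eq_bigr => k _ /=; apply: eq_bigr => i _.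
by rewrite e; ring.
Qed.

Lemma cubicP f x a a' b c : cubic f (x *: a + a') b c = x * cubic f a b c + cubic f a' b c.
Proof.
rewrite /cubic mulr_sumr -big_split; apply: eq_bigr => i _ /=.
rewrite mulr_sumr -big_split; apply: eq_bigr => j _ /=.
rewrite mulr_sumr -big_split; apply: eq_bigr => k _ /=.
by rewrite !mxE; ring.
Qed.

Lemma cubicP2 f x a b b' c : cubic f a (x *: b + b') c = x * cubic f a b c + cubic f a b' c.
Proof. by rewrite (cubicC f a) cubicP -!(cubicC f a). Qed.

Lemma cubicP3 f x a b c c' : cubic f a b (x *: c + c') = x * cubic f a b c + cubic f a b c'.
Proof. by rewrite -(cubicC f _ a b) cubicP !(cubicC f _ a b). Qed.

End LinearSubst.

(** * Simultaneous normal form of the quadratic and cubic parts *)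

Section Congruence.
Variables (K : numClosedFieldType) (d : nat).
Implicit Types (H : 'M[K]_d).

(** A symmetric form of rank [r] has an orthonormal family of [r] vectors: on
    the orthogonal complement of a shorter family the form is nonzero, hence
    takes a nonzero value on the diagonal. *)
Lemma sym_orthonormal H k : H^T = H -> (k <= \rank H)%N ->
  exists V : 'M_(k, d), V *m H *m V^T = 1%:M.
Proof.
move=> Hs; elim: k => [|k IH] kr; first by exists 0; apply/matrixP => -[].
have [V VH] := IH (ltnW kr).
have [W [WV Wr]] : exists W : 'M_d, W *m H *m V^T = 0 /\ \rank W = (d - \rank (H *m V^T))%N.
  by exists (kermx (H *m V^T)); rewrite -mulmxA mulmx_ker mxrank_ker.
have VW : V *m H *m W^T = 0.
  by apply: trmx_inj; rewrite !trmx_mul trmxK Hs trmx0 mulmxA WV.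
have [w wW ww] : exists2 w : 'rV[K]_d, (w <= W)%MS & (w *m H *m w^T) 0 0 != 0.
  apply: contrapT => N.
  have q0 (w : 'rV_d) : (w <= W)%MS -> (w *m H *m w^T) 0 0 = 0.
    by move=> wW; apply/eqP; apply: contrapT => /negP ne; apply: N; exists w.
  have WW : W *m H *m W^T = 0.
    apply/matrixP => i j; rewrite [RHS]mxE.
    have rW a : (row a W <= W)%MS by exact: row_sub.
    have E2 (u v : 'rV[K]_d) : ((u + v) *m H *m (u + v)^T) 0 0 =
        (u *m H *m u^T) 0 0 + (u *m H *m v^T) 0 0 + ((v *m H *m u^T) 0 0 + (v *m H *m v^T) 0 0).
      have aE (A B : 'M[K]_1) : (A + B) 0 0 = A 0 0 + B 0 0 by rewrite mxE.
      by rewrite linearD /= !mulmxDl !mulmxDr !aE.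
    have Es (u v : 'rV[K]_d) : (v *m H *m u^T) 0 0 = (u *m H *m v^T) 0 0.
      transitivity ((v *m H *m u^T)^T 0 0); first by rewrite [RHS]mxE.
      by rewrite !trmx_mul trmxK Hs mulmxA.
    have := q0 _ (addmx_sub (rW i) (rW j)).
    rewrite E2 !q0 // addr0 add0r (Es (row i W)).
    move=> /eqP; rewrite -mulr2n -mulr_natl mulf_eq0 pnatr_eq0 /= => /eqP <-.
    by rewrite -!row_mul !mxE; apply: eq_bigr => l _; rewrite !mxE.
  have VWi : (V :&: W <= (0 : 'M_d))%MS.
    apply/rV_subP => u; rewrite sub_capmx => /andP[/submxP[a ua] /submxP[b ub]].
    have : a *m (V *m H *m V^T) = b *m (W *m H *m V^T) by rewrite !mulmxA -ua -ub.
    by rewrite ua VH WV mulmx1 mulmx0 => ->; rewrite mul0mx sub0mx.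
  have WH : (W <= kermx H)%MS.
    apply/sub_kermxP; have full : row_full (V + W)%MS.
      rewrite -col_leq_rank; have := mxrank_sum_cap V W.
      rewrite (_ : \rank (V :&: W) = 0%N); last by apply/eqP; rewrite mxrank_eq0 -submx0.
      rewrite addn0 => ->.
      have -> : \rank V = k.
        have := mxrankM_maxl V (H *m V^T); rewrite mulmxA VH mxrank1 => kV.
        by apply/eqP; rewrite eqn_leq rank_leq_row kV.
      rewrite Wr; have := rank_leq_col (H *m V^T); lia.
    have : (W *m H *m (col_mx V W)^T) = 0.
      by rewrite tr_col_mx mul_mx_row WV WW row_mx0.
    move=> e; apply: trmx_inj; rewrite trmx0.
    move/(congr1 trmx): e; rewrite trmx0 trmx_mul trmxK => e.
    have : row_full (col_mx V W) by move: full; rewrite /row_full addsmxE.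
    by move=> /row_fullP[B BE]; rewrite -[LHS]mul1mx -BE -mulmxA e mulmx0.
  have := mxrankS WH; rewrite Wr mxrank_ker => Hr.
  have h1 : (\rank (H *m V^T) <= k)%N := leq_trans (mxrankM_maxr H V^T) (rank_leq_col _).
  have h2 := rank_leq_row H; exfalso.
  by move: Hr h1 h2 kr; move: (\rank (H *m V^T)) (\rank H) => a b; lia.
pose c := sqrtC ((w *m H *m w^T) 0 0).
have c0 : c != 0 by rewrite sqrtC_eq0.
have /submxP[a wE] := wW.
pose V' := col_mx (c^-1 *: w) V.
have wV : w *m H *m V^T = 0 by rewrite wE -!mulmxA [W *m _]mulmxA WV mulmx0.
have Vw : V *m H *m w^T = 0 by rewrite wE trmx_mul mulmxA VW mul0mx.
have V'H : V' *m H *m V'^T = 1%:M.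
  rewrite /V' tr_col_mx mul_col_mx mul_col_row linearZ /= -!scalemxAr -!scalemxAl wV Vw VH.
  rewrite !scaler0 scalerA [w *m H *m _]mx11_scalar scale_scalar_mx.
  have -> : c^-1 * c^-1 * (w *m H *m w^T) 0 0 = 1.
    by rewrite -[X in _ * X]sqrtCK -/c expr2 mulrACA mulVf // mulr1.
  by rewrite -scalar_mx_block.
by exists V'.
Qed.

End Congruence.

(** * From coranks to the leading part [q + x y^2 + eps x^3] *)

Section FirstCorank.
Variables (R : realType) (d : nat).
Local Notation K := (R[i]).
Local Notation series := (ncseries K d).
Local Notation D := cyclic_derivative.
Implicit Types f u v : series.

Lemma order2_lin u : u [::] = 0 -> lin_part u = 0 -> order_ge 2 u.
Proof.
move=> u0 u1 [|j [|//]] _ //.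
by have := congr1 (fun a : 'rV_d => a 0 j) u1; rewrite !mxE.
Qed.

Lemma der_nil f i : order_ge 2 f -> D i f [::] = 0.
Proof. by move=> f2; rewrite cyclic_derivativeE big1 // => b _; apply: f2; rewrite size_cat. Qed.

(** Modulo [J^2] the Jacobi ideal consists of the linear parts of the derivatives,
    which are the rows of the Hessian. *)
Lemma radical2_hess f u : order_ge 2 f -> u [::] = 0 ->
  @jac_radical_pow R d f 2 (qpr f u) <-> (lin_part u <= hess f)%MS.
Proof.
move=> f2 u0; rewrite /jac_radical_pow radical_pow_qpr //; split.
  move=> [v v2 uv]; suff : (lin_part (u - v) <= hess f)%MS.
    rewrite lin_partB (_ : lin_part v = 0) ?subr0 //.
    by apply/rowP => j; rewrite !mxE v2.
  suff : (u - v) [::] = 0 /\ (lin_part (u - v) <= hess f)%MS by case.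
  move: uv; apply: (@jacobi_min _ _ f (fun w => w [::] = 0 /\ (lin_part w <= hess f)%MS)).
    split.
      split; first split.
      - by split=> //; rewrite (_ : lin_part 0 = 0) ?sub0mx //; apply/rowP => j; rewrite !mxE.
      - move=> a b [a0 aH] [b0 bH]; rewrite addsE a0 b0 addr0 lin_partD; split=> //.
        exact: addmx_sub.
      - move=> a b [b0 bH]; rewrite mulsE_nil b0 mulr0 lin_partM b0 scale0r addr0; split=> //.
        exact: scalemx_sub.
      - move=> b a [b0 bH]; rewrite mulsE_nil b0 mul0r lin_partM b0 scale0r add0r; split=> //.
        exact: scalemx_sub.
    move=> w /(_ 2%N)[s [s0 sH] ws].
    have e : w = (w - s) + s by rewrite subrK.
    rewrite e addsE s0 addr0 lin_partD; split; first by rewrite ws.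
    rewrite (_ : lin_part (w - s) = 0) ?add0r //.
    by apply/rowP => j; rewrite mxE ws // mxE.
  by move=> i; split; [exact: der_nil|rewrite -row_hess row_sub].
move=> /submxP[a ua]; exists (u - \sum_i a 0 i *: D i f); last first.
  rewrite subKr; apply: (ideal_sum (jacobi_two_sided f)) => i _.
  by apply: (idealZ _ (jacobi_two_sided f)); exact: jacobi_der.
apply: order2_lin.
  rewrite addsE oppsE sumsE u0 big1 ?subrr // => i _.
  by rewrite scalesE der_nil ?mulr0.
rewrite lin_partB ua; apply/eqP; rewrite subr_eq0; apply/eqP/rowP => j.
rewrite !mxE sumsE; apply: eq_bigr => i _.
by rewrite scalesE mxE.
Qed.

Lemma corank_hess f : order_ge 2 f -> corank f = (\rank (hess f)^C%MS)%:R%:E.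
Proof.
move=> f2; set n := \rank _.
pose B := row_base (hess f)^C%MS.
have J1 u : u [::] = 0 -> @jac_radical_pow R d f 1 (qpr f u).
  by move=> u0; apply/radical_powP => //; exists u => //; exact: low1_nocst.
apply: (@dim_mod_basis R K (Jac f) _ _ n (fun i => qpr f (linvar (row i B)))).
  exact: radical_subspace.
have key u (c : 'rV[K]_n) : u [::] = 0 ->
    @jac_radical_pow R d f 2 (qpr f u - \sum_i c 0 i *: qpr f (linvar (row i B))) <->
    (lin_part u - c *m B <= hess f)%MS.
  move=> u0; have -> : qpr f u - \sum_i c 0 i *: qpr f (linvar (row i B)) =
      qpr f (u - linvar (c *m B)).
    rewrite qprB; congr (_ - _).
    have -> : linvar (c *m B) = \sum_i c 0 i *: linvar (row i B).
      rewrite /linvar; under eq_bigr => j _ do rewrite mxE scaler_suml.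
      rewrite exchange_big; apply: eq_bigr => i _ /=; rewrite scaler_sumr.
      by apply: eq_bigr => j _; rewrite scalerA [row _ _ _ _]mxE.
    by rewrite qpr_sum; apply: eq_bigr => i _; rewrite qprZ.
  rewrite radical2_hess //; last by rewrite addsE oppsE linvar_nil u0 subrr.
  by rewrite lin_partB lin_part_linvar.
split=> [i|q]; first by apply: J1; exact: linvar_nil.
move=> /radical_powP -/(_ f2)[u -> u1]; have u0 : u [::] = 0 by exact: u1.
have [[a b] e] : exists ab : 'M_(1, d) * 'rV[K]_n, lin_part u = ab.1 *m hess f + ab.2 *m B.
  have /row_fullP[C CE] := addsmx_compl_full (hess f).
  have : (lin_part u <= hess f + (hess f)^C)%MS by rewrite submx_full // addsmx_compl_full.
  move=> /sub_addsmxP[[a b] /= ->].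
  have /submxP[c ->] : (b *m (hess f)^C <= B)%MS by rewrite eq_row_base submxMl.
  by exists (a, c).
exists b; split=> [|c]; first by apply/key => //; rewrite e addrK submxMl.
move=> /(key _ _ u0); rewrite e -addrA -mulmxBl => H.
have H1 : ((b - c) *m B <= hess f)%MS.
  by rewrite -[_ *m B](addKr (a *m hess f)) addmx_sub // -mulNmx submxMl.
have H2 : ((b - c) *m B <= (hess f)^C)%MS by rewrite (submx_trans (submxMl _ _)) // eq_row_base.
have : ((b - c) *m B <= (0 : 'M_d))%MS by rewrite -(capmx_compl (hess f)) sub_capmx H1.
rewrite submx0 => /eqP z; apply/eqP; rewrite -subr_eq0; apply/eqP.
by apply: (row_free_inj (row_base_free _)); rewrite mul0mx.
Qed.

Lemma corank_rank f : order_ge 2 f -> corank f = 2%:E -> \rank (hess f) = (d - 2)%N /\ (2 <= d)%N.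
Proof.
move=> f2; rewrite corank_hess // => -[/eqP]; rewrite (eqr_nat _ _ 2) mxrank_compl => /eqP e.
by have := rank_leq_row (hess f); lia.
Qed.

End FirstCorank.

Section LeadingForm.
Variables (K : numClosedFieldType) (d : nat) (d_ge2 : (2 <= d)%N).
Local Notation series := (ncseries K d).
Local Notation D := cyclic_derivative.
Local Notation ix := (ix d_ge2).
Local Notation iy := (iy d_ge2).
Implicit Types f u v : series.

Definition indep (a b : 'rV[K]_d) := forall x y : K, x *: a + y *: b = 0 -> x = 0 /\ y = 0.

Let cubicZ f x a b c : cubic f (x *: a) b c = x * cubic f a b c.
Proof.
have c0 : cubic f 0 b c = 0.
  have := cubicP f (-1) 0 0 b c; rewrite scaler0 addr0 mulN1r => /eqP.
  by rewrite eq_sym addrC subrr => /eqP.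
by rewrite -[x *: a]addr0 cubicP c0 addr0.
Qed.
Let cubicZ2 f x a b c : cubic f a (x *: b) c = x * cubic f a b c.
Proof. by rewrite (cubicC f a) cubicZ -(cubicC f a). Qed.
Let cubicZ3 f x a b c : cubic f a b (x *: c) = x * cubic f a b c.
Proof. by rewrite -(cubicC f _ a b) cubicZ (cubicC f _ a b). Qed.

(** The form restricted to the line [s w1 + w2] is a cubic polynomial in [s], which
    has a root unless the form vanishes on [w1]. *)
Let cubic_root f (w1 w2 : 'rV[K]_d) : indep w1 w2 -> exists x1 y1 x2 y2,
  [/\ indep (x1 *: w1 + y1 *: w2) (x2 *: w1 + y2 *: w2) &
      cubic f (x2 *: w1 + y2 *: w2) (x2 *: w1 + y2 *: w2) (x2 *: w1 + y2 *: w2) = 0].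
Proof.
move=> w12; case: (eqVneq (cubic f w1 w1 w1) 0) => [z|nz].
  exists 0, 1, 1, 0; rewrite !scale0r !scale1r add0r addr0; split=> // x y.
  by rewrite addrC => /w12[-> ->].
have [s sE] := @solve_monicpoly K 3
  (fun i => - (nth 0 [:: cubic f w2 w2 w2; 3 * cubic f w1 w2 w2; 3 * cubic f w1 w1 w2] i / cubic f w1 w1 w1)) isT.
exists 1, 0, s, 1; rewrite !scale0r !scale1r addr0; split.
  move=> x y; rewrite scalerDr scalerA addrA -scalerDl => /w12[+ y0].
  by rewrite y0 mul0r addr0.
rewrite !(cubicP, cubicP2, cubicP3).
have e1 : cubic f w1 w2 w1 = cubic f w1 w1 w2 by rewrite -cubicC.
have e2 : cubic f w2 w1 w1 = cubic f w1 w1 w2 by rewrite cubicC.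
have e3 : cubic f w2 w1 w2 = cubic f w1 w2 w2 by rewrite cubicC.
have e4 : cubic f w2 w2 w1 = cubic f w1 w2 w2 by rewrite -cubicC.
rewrite e1 e2 e3 e4.
set A := cubic f w1 w1 w1 in nz sE *; set B := cubic f w1 w1 w2 in sE *.
set C := cubic f w1 w2 w2 in sE *; set E := cubic f w2 w2 w2 in sE *.
move: sE; rewrite !big_ord_recl big_ord0 /= /bump /= expr0 expr1 => sE.
have -> : s * (s * (s * A + B) + (s * B + C)) + (s * (s * B + C) + (s * C + E)) =
  s ^+ 3 * A + 3 * B * s ^+ 2 + 3 * C * s + E by ring.
by rewrite sE; field.
Qed.

(** Let [v] be a zero of the form and [X], [Y] the coordinates along [u] and [v],
    so that the form is [uuu X^3 + 3 uuv X^2 Y + 3 uvv X Y^2].  If [uvv] is not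
    zero, [uuv] is removed by completing the square; if only [uuv] is not zero,
    the double line [X^2] takes the place of [Y^2]; otherwise the form is a
    cube. *)
Lemma cubic_plane f (w1 w2 : 'rV[K]_d) : indep w1 w2 -> exists x1 y1 x2 y2,
  let u := x1 *: w1 + y1 *: w2 in let v := x2 *: w1 + y2 *: w2 in
  [/\ indep u v, cubic f v v v = 0, cubic f u u v = 0 &
      cubic f u v v = 1 \/ cubic f u v v = 0].
Proof.
move=> w12; have [x1 [y1 [x2 [y2 []]]]] := cubic_root f w12.
have [u uE] : {u | u = x1 *: w1 + y1 *: w2} by exists (x1 *: w1 + y1 *: w2).
have [v vE] : {v | v = x2 *: w1 + y2 *: w2} by exists (x2 *: w1 + y2 *: w2).
rewrite -uE -vE => uv vvv.
have comb a b c e : a * e - b * c != 0 ->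
    indep (a *: u + b *: v) (c *: u + e *: v).
  move=> nz x y; rewrite !scalerDr !scalerA addrACA -!scalerDl => /uv[h1 h2].
  have H1 : x * (a * e - b * c) = (x * a + y * c) * e - (x * b + y * e) * c by ring.
  have H2 : y * (a * e - b * c) = (x * b + y * e) * a - (x * a + y * c) * b by ring.
  move: H1 H2; rewrite h1 h2 !mul0r subrr => /eqP + /eqP.
  by rewrite !mulf_eq0 (negPf nz) !orbF => /eqP -> /eqP ->.
have expand a b : a *: u + b *: v = (a * x1 + b * x2) *: w1 + (a * y1 + b * y2) *: w2.
  by rewrite uE vE !scalerDr !scalerA addrACA -!scalerDl.
have wrap a b c e : let u' := a *: u + b *: v in let v' := c *: u + e *: v in
    [/\ a * e - b * c != 0, cubic f v' v' v' = 0, cubic f u' u' v' = 0 &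
      cubic f u' v' v' = 1 \/ cubic f u' v' v' = 0] ->
    exists x1 y1 x2 y2,
  let u := x1 *: w1 + y1 *: w2 in let v := x2 *: w1 + y2 *: w2 in
  [/\ indep u v, cubic f v v v = 0, cubic f u u v = 0 &
      cubic f u v v = 1 \/ cubic f u v v = 0].
  move=> u' v' [nz H1 H2 H3]; exists (a * x1 + b * x2), (a * y1 + b * y2),
    (c * x1 + e * x2), (c * y1 + e * y2); rewrite /= -!expand.
  by split=> //; exact: comb.
have s1 : cubic f u v u = cubic f u u v by rewrite -cubicC.
have s2 : cubic f v u u = cubic f u u v by rewrite cubicC.
have s3 : cubic f v u v = cubic f u v v by rewrite cubicC.
have s4 : cubic f v v u = cubic f u v v by rewrite -cubicC.
case: (eqVneq (cubic f u v v) 0) => [uvv|uvv].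
  case: (eqVneq (cubic f u u v) 0) => [uuv|uuv].
    apply: (wrap 1 0 0 1); rewrite /= !scale0r !scale1r !addr0 !add0r mulr1 mul0r subr0.
    by rewrite oner_neq0; split=> //; right.
  (* the form is [X^2 (uuu X + 3 uuv Y)]: [X] becomes the new [y], and the other
     factor the new [x] *)
  apply: (wrap 0 (cubic f u u v)^-1 1 (- (cubic f u u u / (3 * cubic f u u v)))).
  rewrite /= !scale0r !scale1r add0r; split.
  - by rewrite mul0r sub0r mulr1 oppr_eq0 invr_eq0.
  - rewrite ![u + _]addrC !(cubicP, cubicP2, cubicP3, cubicZ, cubicZ2, cubicZ3) ?(s1, s2, s3, s4) ?uvv ?vvv.
    by field.
  - rewrite ![u + _]addrC !(cubicP, cubicP2, cubicP3, cubicZ, cubicZ2, cubicZ3) ?(s1, s2, s3, s4) ?uvv ?vvv.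
    by ring.
  - left; rewrite ![u + _]addrC !(cubicP, cubicP2, cubicP3, cubicZ, cubicZ2, cubicZ3) ?(s1, s2, s3, s4) ?uvv ?vvv.
    by field.
apply: (wrap (cubic f u v v)^-1 (- (cubic f u u v / (2 * cubic f u v v ^+ 2))) 0 1).
rewrite /= !scale0r !scale1r add0r; split=> //.
- by rewrite mulr1 mulr0 subr0 invr_eq0.
- rewrite !(cubicP, cubicP2, cubicP3, cubicZ, cubicZ2, cubicZ3) ?(s1, s2, s3, s4) ?vvv.
  by field.
- left; rewrite !(cubicP, cubicP2, cubicP3, cubicZ, cubicZ2, cubicZ3) ?vvv.
  by field.
Qed.

(** The [z]-rows of [L] are orthogonal for the Hessian, of square [2] as needed for
    [q]; the rows of [x] and [y] span its kernel and bring the cubic form there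
    into shape.  Products of [z]'s with other variables in the cubic part are left
    alone: they have weight at least 7. *)
Lemma leading_coordinates f : \rank (hess f) = (d - 2)%N -> exists L : 'M[K]_d,
  [/\ L \in unitmx,
      forall i j, (L *m hess f *m L^T) i j = if isz i && (i == j) then 2 else 0,
      cubic f (row iy L) (row iy L) (row iy L) = 0,
      cubic f (row ix L) (row ix L) (row iy L) = 0 &
      cubic f (row ix L) (row iy L) (row iy L) = 1 \/
      cubic f (row ix L) (row iy L) (row iy L) = 0].
Proof.
move=> rH; set H := hess f in rH *.
have Hs : H^T = H by exact: hess_sym.
have [V VH] := sym_orthonormal Hs (eq_leq (esym rH)).
have [w1 [w2 [w12 w1H w2H]]] : exists w1 w2 : 'rV_d, [/\ indep w1 w2, w1 *m H = 0 & w2 *m H = 0].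
  have rk : \rank (kermx H) = 2%N by rewrite mxrank_ker rH subKn.
  have : exists B : 'M[K]_(2, d), row_free B /\ (B <= kermx H)%MS.
    by rewrite -rk; exists (row_base (kermx H)); rewrite row_base_free eq_row_base.
  move=> [B [Bf /sub_kermxP BH]]; exists (row 0 B), (row 1 B); split.
  - move=> x y e; have e2 : (\row_(i < 2) (if i == 0 then x else y)) *m B = 0.
      rewrite mulmx_sum_row big_ord_recl big_ord1 !mxE /= -[RHS]e; congr (_ *: _ + _ *: row _ _).
      exact: val_inj.
    have /rowP z : \row_(i < 2) (if i == 0 then x else y) = 0.
      by apply: (row_free_inj Bf); rewrite mul0mx.
    by have := z 0; have := z 1; rewrite !mxE.
  - by rewrite -row_mul BH row0.
  - by rewrite -row_mul BH row0.
have [x1 [y1 [x2 [y2]]]] := cubic_plane f w12.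
set u := x1 *: w1 + y1 *: w2; set v := x2 *: w1 + y2 *: w2 => /= -[uv vvv uuv uvv].
have uH : u *m H = 0 by rewrite /u mulmxDl -!scalemxAl w1H w2H !scaler0 addr0.
have vH : v *m H = 0 by rewrite /v mulmxDl -!scalemxAl w1H w2H !scaler0 addr0.
pose rw (a : 'I_d) : 'rV[K]_d := if insub (a : nat) is Some i then sqrtC 2 *: row (i : 'I_(d - 2)) V
  else if a == ix then u else v.
pose L := \matrix_a rw a.
have rowL a : row a L = rw a by rewrite rowK.
have rx : row ix L = u.
  by rewrite rowL /rw insubN ?eqxx // -/(isz ix) isz_ix.
have ry : row iy L = v.
  by rewrite rowL /rw insubN ?iy_ix // -/(isz iy) isz_iy.
have rz (a : 'I_d) (za : isz a) : row a L = sqrtC 2 *: row (Ordinal za) V.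
  by rewrite rowL /rw insubT.
have LH : forall i j, (L *m H *m L^T) i j = if isz i && (i == j) then 2 else 0.
  have e i j : (L *m H *m L^T) i j = (row i L *m H *m (row j L)^T) 0 0.
    by rewrite -row_mul !mxE; apply: eq_bigr => k _; rewrite !mxE.
  have r0 i : isz i = false -> row i L *m H = 0.
    by case: (xyzP d_ge2 i) => [-> //|-> _|-> _]; rewrite ?rx ?ry.
  have c0 j : isz j = false -> H *m (row j L)^T = 0.
    by move=> /r0 z; apply: trmx_inj; rewrite trmx_mul trmxK Hs z trmx0.
  move=> i j; rewrite e; case zi: (isz i) => /=; last by rewrite r0 // mul0mx mxE.
  case zj: (isz j); last first.
    rewrite -mulmxA c0 // mulmx0 mxE; case: eqP => // ij.
    by move: zi; rewrite ij zj.
  rewrite (rz i zi) (rz j zj) linearZ /= -scalemxAr -!scalemxAl scalerA -expr2 sqrtCK.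
  rewrite mxE; have -> : (row (Ordinal zi) V *m H *m (row (Ordinal zj) V)^T) 0 0 =
      (V *m H *m V^T) (Ordinal zi) (Ordinal zj).
    by rewrite -row_mul !mxE; apply: eq_bigr => k _; rewrite !mxE.
  rewrite VH mxE -val_eqE /= -(val_eqE i j); case: eqP => _; by rewrite ?mulr1 ?mulr0.
exists L; rewrite rx ry; split=> //.
rewrite -row_free_unit; apply: inj_row_free => c cL.
have cz i : isz i -> c 0 i = 0.
  move=> zi; have : (c *m (L *m H *m L^T)) 0 i = 0.
    by rewrite !mulmxA cL !mul0mx mxE.
  rewrite mxE (bigD1 i) //= LH zi eqxx big1 ?addr0.
    by move=> /eqP; rewrite mulf_eq0 pnatr_eq0 orbF => /eqP.
  by move=> j ji; rewrite LH (negPf ji) andbF mulr0.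
have : c 0 ix *: u + c 0 iy *: v = 0.
  rewrite -[RHS]cL mulmx_sum_row (bigD1 ix) //= (bigD1 iy) /=; last by rewrite iy_ix.
  rewrite rx ry big1 ?addr0 // => i /andP[i1 i2].
  by case: (xyzP d_ge2 i) i1 i2 => [/cz -> _ _|-> /eqP//|-> _ /eqP//]; rewrite scale0r.
move=> /uv[cx cy]; apply/rowP => i; rewrite mxE.
by case: (xyzP d_ge2 i) => [/cz|->|->].
Qed.

End LeadingForm.

(** * Existence of a normal form *)

Section NormalFormExistence.
Variables (R : realType) (d : nat) (d_ge2 : (2 <= d)%N).
Local Notation K := (R[i]).
Local Notation series := (ncseries K d).
Local Notation D := cyclic_derivative.
Local Notation ix := (ix d_ge2).
Local Notation iy := (iy d_ge2).
Local Notation x := (varx K d_ge2).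
Local Notation y := (vary K d_ge2).
Implicit Types f u v : series.

Let K2 : (2 : K) != 0. Proof. by rewrite pnatr_eq0. Qed.

Lemma order_subs_linsub (L : 'M[K]_d) k f : order_ge k f -> order_ge k (subs (linsub L) f).
Proof.
move=> /low_order_ge f0; apply/low_order_ge.
apply: (@subs_low _ _ _ (fun=> 1%N)) => //; first exact: linsub_nocst.
by move=> j; apply/low_order_ge; apply: low1_nocst; exact: linsub_nocst.
Qed.

(** If the cubic part of the potential on the kernel of the Hessian is a cube
    [c x^3], then [xy], [yx] and [yy] remain independent in [J^2 / J^3]: each
    gives a linear form vanishing on the Jacobi ideal, the correction terms
    accounting for the elimination of the [z]'s by [2 z_i = - (quadratic terms)].
    Three independent forms contradict dimension 2. *)
Lemma corank2_cube f : order_ge 2 f ->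
  (forall i j, hess f i j = if isz i && (i == j) then 2 else 0) ->
  (forall i j k, ~~ isz i -> ~~ isz j -> ~~ isz k -> (i == iy) || (j == iy) || (k == iy) ->
     D i f [:: j; k] = 0) ->
  corankm 2 f <> 2%:E.
Proof.
move=> f2 hE cE; have xz : ~~ isz ix by rewrite isz_ix.
have yz : ~~ isz iy by rewrite isz_iy.
pose w3 (k : 'I_3) := nth (ix, iy) [:: (ix, iy); (iy, ix); (iy, iy)] k.
have w3z k : ~~ isz (w3 k).1 /\ ~~ isz (w3 k).2 /\ ((w3 k).1 == iy) || ((w3 k).2 == iy).
  by case: k => -[|[|[|//]]] ?; rewrite /w3 /= ?eqxx ?orbT ?xz ?yz.
pose lam (u : series) : 'rV[K]_3 := \row_k (u [:: (w3 k).1; (w3 k).2] -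
  2^-1 * \sum_(j | isz j) u [:: j] * D j f [:: (w3 k).1; (w3 k).2]).
have lamB u v : lam (u - v) = lam u - lam v.
  apply/rowP => k; rewrite !mxE addsE oppsE.
  under eq_bigr do rewrite addsE oppsE mulrDl mulNr.
  by rewrite sumrB; ring.
have lamZ a u : lam (a *: u) = a *: lam u.
  apply/rowP => k; rewrite !mxE scalesE.
  by under eq_bigr do rewrite scalesE -mulrA; rewrite -mulr_sumr; ring.
have lam0 : lam 0 = 0 by rewrite -(subrr 0) lamB subrr.
have lamD u v : lam (u + v) = lam u + lam v.
  by rewrite -[v in LHS]opprK lamB -[- v]sub0r lamB lam0 sub0r opprK.
have lam3 u : order_ge 3 u -> lam u = 0.
  move=> u3; apply/rowP => k; rewrite !mxE u3 // big1 ?mulr0 ?subr0 // => j _.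
  by rewrite u3 // mul0r.
have lamI u : jId f u -> [/\ u [::] = 0, forall j, ~~ isz j -> u [:: j] = 0 & lam u = 0].
  apply: (@jacobi_min _ _ f (fun u => [/\ u [::] = 0, forall j, ~~ isz j -> u [:: j] = 0 & lam u = 0])).
    split.
      split; first split.
      - by split.
      - move=> a b [a0 a1 a2] [b0 b1 b2]; split; first by rewrite addsE a0 b0 addr0.
          by move=> j zj; rewrite addsE a1 ?b1 ?addr0.
        by rewrite -[b]opprK lamB -[- b]sub0r lamB lam0 a2 b2 !subr0.
      - move=> a b [b0 b1 b2]; split; first by rewrite mulsE_nil b0 mulr0.
          by move=> j zj; rewrite mulsE1 b0 b1 // !mulr0 addr0.
        have -> : lam (a * b) = a [::] *: lam b; last by rewrite b2 scaler0.
        apply/rowP => k; have [k1 [k2 _]] := w3z k.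
        rewrite !mxE mulsE2 b0 mulr0 addr0 (b1 _ k2) mulr0 addr0.
        under eq_bigr do rewrite mulsE1 b0 mulr0 addr0 -mulrA.
        by rewrite -mulr_sumr; ring.
      - move=> b a [b0 b1 b2]; split; first by rewrite mulsE_nil b0 mul0r.
          by move=> j zj; rewrite mulsE1 b0 b1 // !mul0r addr0.
        have -> : lam (b * a) = a [::] *: lam b; last by rewrite b2 scaler0.
        apply/rowP => k; have [k1 [k2 _]] := w3z k.
        rewrite !mxE mulsE2 b0 mul0r add0r (b1 _ k1) mul0r add0r.
        under eq_bigr do rewrite mulsE1 b0 mul0r add0r mulrAC.
        by rewrite -mulr_suml; ring.
    move=> v /(_ 3%N)[s [s0 s1 s2] us]; have e : v = (v - s) + s by rewrite subrK.
    split.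
    - by rewrite e addsE us // s0 addr0.
    - by move=> j zj; rewrite e addsE us // s1 // addr0.
    - by rewrite -(subr0 (lam v)) -s2 -lamB lam3.
  move=> i; split; first exact: der_nil.
    move=> j zj; have := hE i j; rewrite mxE => ->.
    by case: eqP => [->|_]; rewrite ?andbF // (negPf zj).
  apply/rowP => k; have [k1 [k2 k3]] := w3z k; rewrite !mxE.
  have hD j : D i f [:: j] = if isz i && (i == j) then 2 else 0 by have := hE i j; rewrite mxE.
  under eq_bigr do rewrite hD.
  case zi: (isz i) => /=.
    rewrite (bigD1 i) //= eqxx big1 ?addr0; first by rewrite mulrA mulVf // mul1r subrr.
    by move=> j /andP[_ /negPf]; rewrite eq_sym => ->; rewrite mul0r.
  rewrite big1 ?mulr0 ?subr0; last by move=> j _; rewrite mul0r.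
  by apply: cE => //; rewrite ?zi //; case/orP: k3 => ->; rewrite ?orbT.
have lamJ u : @jac_radical_pow R d f 3 (qpr f u) -> lam u = 0.
  move=> /radical_powP -/(_ f2)[v /quotient_projP/lamI[_ _ +] v3].
  by rewrite lamB (lam3 v) // subr0.
move=> /(basis_mod_exists (radical_subspace _ _))[b [b2 bP]].
have [g gP] : exists g : 'I_2 -> series, forall j, b j = qpr f (g j).
  by exists (fun j => repr (b j)) => j; rewrite quotient_projK.
pose e (k : 'I_3) : series := var K (w3 k).1 * var K (w3 k).2.
have e2 k : order_ge 2 (e k).
  by rewrite -[2%N]/(1 + 1)%N; apply: low_sizeM; apply: low1_nocst; rewrite varE.
have lame k : lam (e k) = delta_mx 0 k.
  apply/rowP => l; rewrite !mxE big1 ?mulr0 ?subr0.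
    rewrite /e var_mulE varE eqseq_cons andbT -natrM mulnb.
    congr (_%:R); congr nat_of_bool.
    by case: k l => -[|[|[|//]]] ? [[|[|[|//]]] ?]; rewrite /w3 /= ?eqxx ?ix_iy ?iy_ix.
  by move=> j _; rewrite (e2 k) ?mul0r.
have /choice[c cP] k : exists c : 'rV[K]_2, delta_mx 0 k = \sum_j c 0 j *: lam (g j).
  have [c [cP _]] := bP (qpr f (e k)) (iffRL (radical_powP _ f2 _) (ex_intro2 _ _ _ erefl (e2 k))).
  exists c; have : lam (e k - \sum_j c 0 j *: g j) = 0.
    apply: lamJ; rewrite qprB qpr_sum.
    by under eq_bigr do rewrite qprZ -gP.
  rewrite lamB lame => /eqP; rewrite subr_eq0 => /eqP ->.
  by rewrite !big_ord_recl !big_ord0 !addr0 lamD !lamZ.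
have : (\matrix_k c k) *m (\matrix_j lam (g j)) = 1%:M.
  apply/row_matrixP => k; rewrite row_mul rowK mulmx_sum_row row1 cP.
  by apply: eq_bigr => j _; rewrite rowK.
by move/mulmx1_min.
Qed.

(** A word of weight below 7 together with [i] is one of [i j], [i j k]; the
    conditions on the Hessian and on the cubic form on [x] and [y] therefore say
    exactly that [f] has the leading part required by [xy_normalize]. *)
Lemma der_xy_at f (eps : K) i w : (wtw (@wxy d) w + wxy i < 7)%N -> order_ge 2 f ->
  (forall i j, hess f i j = if isz i && (i == j) then 2 else 0) ->
  (forall i j k, ~~ isz i -> ~~ isz j -> ~~ isz k ->
     D i f [:: j; k] = D i (xy_pot d_ge2 (eps *: tvar K ^+ 3)) [:: j; k]) ->
  D i f w = D i (xy_pot d_ge2 (eps *: tvar K ^+ 3)) w.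
Proof.
move=> wi f2 hE cE; set g := xy_pot _ _.
have w2 j : (2 <= @wxy d j)%N by rewrite /wxy; case: ifP.
have g1 : D i g [::] = 0 /\ forall j, D i g [:: j] = if isz i && (i == j) then 2 else 0.
  have x0 : x [::] = 0 by rewrite /varx varE.
  have y0 : y [::] = 0 by rewrite /vary varE.
  have Q u v : u [::] = 0 -> v [::] = 0 -> (u * v) [::] = 0 /\ forall j, (u * v) [:: j] = 0.
    by move=> u0 v0; rewrite mulsE_nil u0 mul0r; split=> // j; rewrite mulsE1 u0 v0 mul0r mulr0 addr0.
  have [q1 q2] := Q _ _ y0 y0; have [q3 q4] := Q _ _ x0 x0.
  have [q5 q6] := Q _ _ x0 y0; have [q7 q8] := Q _ _ y0 x0.
  rewrite der_xy_pot der_cube linearZ /= rmorphXn /= at_x_var !expr2.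
  case: (xyzP d_ge2 i) => [zi|->|->].
  - rewrite zi /= scalesE varE mulr0; split=> // j; rewrite scalesE varE eqseq_cons andbT eq_sym.
    by case: eqP; rewrite ?mulr1 ?mulr0.
  - rewrite isz_ix eqxx /=; split=> [|j]; rewrite addsE scalesE ?q1 ?q2 ?q3 ?q4 mulr0 addr0 //.
  - by rewrite isz_iy iy_ix /=; split=> [|j]; rewrite addsE ?q5 ?q6 ?q7 ?q8 addr0.
case: w wi => [|j [|k [|l w]]]; rewrite ?wtw_cons ?wtw_nil => wi.
- by rewrite g1.1; exact: der_nil.
- by rewrite g1.2 -hE mxE.
- have e2 (a : 'I_d) : (wxy a <= 2)%N -> ~~ isz a by rewrite /wxy; case: ifP.
  by apply: cE; apply: e2; have := w2 i; have := w2 j; have := w2 k; lia.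
- by have := w2 i; have := w2 j; have := w2 k; have := w2 l; lia.
Qed.

(** The coranks give the leading part, the terms of higher weight are eliminated up
    to a series in [x], and that series is normalized by a reparametrization. *)
Theorem normal_form_exists f : order_ge 2 f -> corank f = 2%:E -> corankm 2 f = 2%:E ->
  exists2 L, nf_valid L & Jac_iso f (normal_form K d_ge2 L).
Proof.
move=> f2 c1 c2; have [rH _] := corank_rank f2 c1.
have [L [Lu LH yyy xxy xyy]] := leading_coordinates d_ge2 rH.
pose g := subs (linsub L) f.
have g2 : order_ge 2 g by exact: order_subs_linsub.
have fg : subs_iso f g by exact: linsub_subs_iso.
have hE i j : hess g i j = if isz i && (i == j) then 2 else 0 by rewrite hess_linsub LH.
have cE i j k : D i g [:: j; k] = cubic f (row i L) (row j L) (row k L) by exact: cubic_linsub.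
have yxx : cubic f (row iy L) (row ix L) (row ix L) = 0 by rewrite cubicC xxy.
have xyx : cubic f (row ix L) (row iy L) (row ix L) = 0 by rewrite cubicC yxx.
have yxy : cubic f (row iy L) (row ix L) (row iy L) = cubic f (row ix L) (row iy L) (row iy L).
  by rewrite cubicC.
have yyx : cubic f (row iy L) (row iy L) (row ix L) = cubic f (row ix L) (row iy L) (row iy L).
  by rewrite cubicC yxy.
have xyE i : ~~ isz i -> i = ix \/ i = iy.
  by case: (xyzP d_ge2 i) => [->|->|->] // _; [left|right].
case: xyy => [xyy|xyy]; last first.
  exfalso; apply: (corank2_cube g2 hE); last first.
    by rewrite -(corankm_iso 2 f2 g2) //; exact: subs_iso_Jac_iso.
  move=> i j k /xyE[] -> /xyE[] -> /xyE[] ->; rewrite ?eqxx ?ix_iy ?iy_ix // => _;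
    by rewrite cE ?yyx ?yxy ?yxx ?xyx ?yyy ?xxy ?xyy.
pose eps := cubic f (row ix L) (row ix L) (row ix L) / 3.
have lead i w : (wtw (@wxy d) w + wxy i < 7)%N ->
    D i g w = D i (xy_pot d_ge2 (eps *: tvar K ^+ 3)) w.
  move=> wi; apply: der_xy_at => // {w i wi} i j k zi zj zk.
  have M2 a b : (var K a * var K b : series) [:: j; k] = ((j == a) && (k == b))%:R.
    by rewrite var_mulE varE eqseq_cons andbT -natrM mulnb.
  rewrite cE der_xy_pot der_cube linearZ /= rmorphXn /= at_x_var (negPf zi) !expr2.
  have e3 : 3 * eps = cubic f (row ix L) (row ix L) (row ix L).
    by rewrite /eps mulrC divfK // pnatr_eq0.
  case: (xyE _ zi) => ->; rewrite ?eqxx ?iy_ix addsE ?scalesE !M2;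
  case: (xyE _ zj) => ->; case: (xyE _ zk) => ->; rewrite ?eqxx ?iy_ix ?ix_iy /= ?mulr1 ?mulr0 ?addr0 ?add0r ?e3;
    by rewrite ?yyx ?yxy ?yxx ?xyx ?yyy ?xxy ?xyy.
have [|h h6 hD] := @cyclic_truncate K d (@wxy d) 6 g.
  move=> i w wi; rewrite lead; last by lia.
  exact: (@der_pot0_low K d d_ge2 eps i w wi).
have gh : subs_iso g h by apply: eq_subs_iso => i; rewrite hD.
have h7 i : low (wtw (@wxy d)) (7 - wxy i) (D i h - D i (xy_pot d_ge2 (eps *: tvar K ^+ 3))).
  by move=> w wi; rewrite addsE oppsE hD lead ?subrr //; lia.
have [p p7 hp] := xy_normalize K2 h6 h7.
have p3 : order_ge 3 p.
  have -> : p = (p - eps *: tvar K ^+ 3) + eps *: tvar K ^+ 3 by rewrite subrK.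
  apply: ordD; last by apply: ordZ; exact: ord_tX.
  have W2 (w : seq 'I_1) : wtw (fun=> 2%N) w = (2 * size w)%N.
    by elim: w => [|a w IH]; rewrite ?wtw_nil ?wtw_cons ?IH /=; lia.
  by move=> w wk; apply: p7; rewrite W2; lia.
have [M vM pM] := xy_pot_classify d_ge2 p3.
exists M => //; apply: subs_iso_Jac_iso.
exact: subs_iso_trans fg (subs_iso_trans gh (subs_iso_trans hp pM)).
Qed.

End NormalFormExistence.

(** * Dimensions of the Jacobi algebras of the normal forms *)

(** [None] stands for infinity. *)
Definition below (M : option nat) (i : nat) := if M is Some m then (i < m)%N else true.
Definition capn (M : option nat) (k : nat) := if M is Some m then minn k m else k.

Lemma ltn_capn M k i : (i < capn M k)%N = (i < k)%N && below M i.
Proof. by case: M => [m|] /=; rewrite ?leq_min ?andbT. Qed.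

(** [nf_e] is the order of [p'] (meaningful unless [p' = 0]); [x^M = 0] and
    [x^N y = 0] are the relations between the powers of [x] and the [x^i y], with
    [M] and [N] given by [nf_M] and [nf_N] and infinite when the odd part of [p']
    vanishes. *)
Definition nf_e (L : nf_label) : nat :=
  match nf_n L, nf_m L with
  | Some n, Some m => minn (2 * n - 1) (2 * m)
  | Some n, None => 2 * n - 1
  | None, Some m => 2 * m
  | None, None => 0
  end.
Definition nf_N (L : nf_label) := omap (fun n => 2 * n - 1)%N (nf_n L).
Definition nf_M (L : nf_label) := omap (fun n => 2 * n - 1 + nf_e L)%N (nf_n L).

Section NormalFormDerivative.
Variables (K : numClosedFieldType) (L : nf_label).
Hypothesis L_valid : nf_valid L.
Local Notation pser := (pser K).
Local Notation t := (tvar K).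
Local Notation p := (nf_pot K L).

Lemma nf_n_ge2 n : nf_n L = Some n -> (2 <= n)%N.
Proof.
by case: L L_valid => [|m'|n'|n' m'|n' m'] //= v [<-]; [|case/and3P: v|case/andP: v => *; lia].
Qed.

Lemma nf_m_gt0 m : nf_m L = Some m -> (0 < m)%N.
Proof.
by case: L L_valid => [|m'|n'|n' m'|n' m'] //= v [<-]; [|case/and3P: v => *; lia|case/andP: v => *; lia].
Qed.

Lemma pder_nf_even : pder (nf_even K L) =
  if nf_n L is Some n then (2 * n)%:R *: t ^+ (2 * n - 1) else 0.
Proof.
rewrite /nf_even; case e: (nf_n L) => [n|]; last exact: pder0.
by rewrite pder_even //; have := nf_n_ge2 e; lia.
Qed.

Lemma pder_nf_odd : pder (nf_odd K L) =
  if nf_m L is Some m then (2 * m + 1)%:R *: t ^+ (2 * m) else 0.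
Proof. by rewrite /nf_odd; case: (nf_m L) => [m|]; [exact: pder_odd|exact: pder0]. Qed.

Let conj_even : pconj (pder (nf_even K L)) = - pder (nf_even K L).
Proof.
rewrite pder_nf_even; case e: (nf_n L) => [n|]; last by rewrite (linear0 (@pconj K)) oppr0.
rewrite linearZ /= rmorphXn /= pconj_t exprNn -signr_odd.
have -> : odd (2 * n - 1) by have := nf_n_ge2 e; lia.
by rewrite expr1 mulN1r scalerN.
Qed.

Let conj_odd : pconj (pder (nf_odd K L)) = pder (nf_odd K L).
Proof.
rewrite pder_nf_odd; case: (nf_m L) => [m|]; last exact: (linear0 (@pconj K)).
rewrite linearZ /= rmorphXn /= pconj_t exprNn -signr_odd.
have -> : odd (2 * m) = false by lia.
by rewrite mul1r.
Qed.

Lemma nf_yodd : yodd p = - (2 *: pder (nf_even K L)).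
Proof.
rewrite /yodd /ysq /nf_pot pderD (linearN (@pconj K)) (linearD (@pconj K)) /=.
by rewrite conj_even conj_odd scaler_nat mulr2n; series_ring.
Qed.

Lemma nf_ysq n : nf_n L = Some n -> exists2 u : pser, punit u & ysq p = t ^+ nf_e L * u.
Proof.
move=> e; have n2 := nf_n_ge2 e; rewrite /ysq /nf_pot pderD pder_nf_even pder_nf_odd /nf_e e.
have nz : (2 * n)%:R != 0 :> K by rewrite pnatr_eq0; lia.
have t0 k : (0 < k)%N -> pcoef 0 (t ^+ k) = 0.
  by move=> k0; rewrite pcoef0X /pcoef /tvar varE expr0n; case: k k0.
case: (nf_m L) => [m|]; last first.
  exists (- (2 * n)%:R *: 1); last by rewrite addr0 -scalerAr mulr1 scaleNr.
  by apply/punitP; rewrite pcoefZ pcoef01 mulr1 oppr_eq0.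
have mz : (2 * m + 1)%:R != 0 :> K by rewrite pnatr_eq0; lia.
case: (leqP (2 * n - 1) (2 * m)) => nm.
  exists (- ((2 * n)%:R *: 1 + (2 * m + 1)%:R *: t ^+ (2 * m - (2 * n - 1)))).
    apply/punitP; rewrite pcoefN pcoefD !pcoefZ pcoef01 t0; last by lia.
    by rewrite mulr1 mulr0 addr0 oppr_eq0.
  rewrite mulrN mulrDr -!scalerAr mulr1 -exprD subnKC //.
exists (- ((2 * n)%:R *: t ^+ (2 * n - 1 - 2 * m) + (2 * m + 1)%:R *: 1)).
  apply/punitP; rewrite pcoefN pcoefD !pcoefZ pcoef01 t0; last by lia.
  by rewrite mulr1 mulr0 add0r oppr_eq0.
by rewrite mulrN mulrDr -!scalerAr mulr1 -exprD subnKC // ltnW.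
Qed.

End NormalFormDerivative.

Section NormalFormAlgebra.
Variables (K : numClosedFieldType) (d : nat) (d_ge2 : (2 <= d)%N) (L : nf_label).
Hypothesis L_valid : nf_valid L.
Local Notation series := (ncseries K d).
Local Notation pser := (pser K).
Local Notation t := (tvar K).
Local Notation y := (vary K d_ge2).
Local Notation atx := (at_x d_ge2).
Local Notation p := (nf_pot K L).
Local Notation pot := (xy_pot d_ge2 p).
Local Notation I := (jId pot).
Implicit Types (a b : pser) (u : series).

Let K2 : (2 : K) != 0. Proof. by rewrite pnatr_eq0. Qed.
Let p3 : order_ge 3 p. Proof. exact: nf_pot_order. Qed.

(** For a normal form, [sigma] and [sigma s] are powers of [x] up to units. *)
Lemma nf_rel a b : I (atx a + atx b * y) <->
  (forall i, below (nf_M L) i -> pcoef i a = 0) /\ (forall i, below (nf_N L) i -> pcoef i b = 0).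
Proof.
apply: (iff_trans (jac_nf_eq d_ge2 K2 p3 a b)).
rewrite nf_yodd // /nf_M /nf_N pder_nf_even //; case e: (nf_n L) => [n|] /=; last first.
  rewrite scaler0 oppr0; split.
    by move=> [[a' ->] [b' ->]]; rewrite !mul0r; split=> i _.
  by move=> [a0 b0]; split; exists 0; rewrite mulr0; apply: pserP => i; [exact: a0|exact: b0].
have [u uu ->] := nf_ysq K L_valid e.
have n0 : - (2 * (2 * n)%:R) != 0 :> K.
  by rewrite oppr_eq0 mulf_neq0 // pnatr_eq0; have := nf_n_ge2 L_valid e; lia.
rewrite scalerA -scaleNr.
have cu k (c : K) (v c0 : pser) : c != 0 -> punit v ->
    (exists a', c0 = c *: t ^+ k * v * a') <-> order_ge k c0.
  move=> cn [v' vv]; split=> [[a' ->]|/ord_factor[c1 ->]].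
    by rewrite -!scalerAl -mulrA; apply: ordZ; apply: ordMr; exact: ord_tX.
  exists (c^-1 *: (v' * c1)); rewrite -!scalerAl -scalerAr scalerA mulfV // scale1r.
  by rewrite -mulrA [v * _]mulrA vv mul1r.
have e1 (a0 : pser) : (exists a', a0 = - (2 * (2 * n)%:R) *: t ^+ (2 * n - 1) * (t ^+ nf_e L * u) * a') <->
    order_ge (2 * n - 1 + nf_e L) a0.
  by rewrite mulrA -scalerAl -exprD; exact: cu.
have e2 (b0 : pser) : (exists b', b0 = - (2 * (2 * n)%:R) *: t ^+ (2 * n - 1) * b') <->
    order_ge (2 * n - 1) b0.
  have := cu (2 * n - 1)%N _ 1 b0 n0; rewrite mulr1; apply.
  by apply/punitP; rewrite pcoef01 oner_neq0.
split.
  by move=> [/e1/order_geP h1 /e2/order_geP h2].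
by move=> [h1 h2]; split; [apply/e1/order_geP|apply/e2/order_geP].
Qed.

Let hi k a : pser := fun w => if (size w < k)%N then 0 else a w.

Let hi_ord k a : order_ge k (hi k a). Proof. by move=> w wk; rewrite /hi wk. Qed.
Let hi_coef k a i : pcoef i (hi k a) = if (i < k)%N then 0 else pcoef i a.
Proof. by rewrite /pcoef /hi size_nseq. Qed.

Let pot2 : order_ge 2 pot.
Proof.
rewrite /xy_pot; have y1 : order_ge 1 y by apply: low1_nocst; rewrite /vary varE.
have A (u v : series) : order_ge 2 u -> order_ge 2 v -> order_ge 2 (u + v).
  by move=> u0 v0 w wk; rewrite addsE u0 ?v0 ?addr0.
have M (u v : series) : order_ge 1 u -> order_ge 1 v -> order_ge 2 (u * v).
  by move=> u0 v0; apply: (@low_sizeM K d 1 1).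
have V i : order_ge 1 (var K i : series) by apply: low1_nocst; rewrite varE.
apply: (A); first apply: (A).
- by rewrite /quadz; apply: (big_ind (fun u : series => order_ge 2 u)) => // i _; rewrite expr2; apply: (M); exact: V.
- by apply: (M); [exact: V|rewrite expr2 => w w1; apply: (M _ _ y1 y1); exact: ltnW].
apply/low_order_ge; apply: (@subs_low _ _ _ (fun=> 1%N)) => //.
  by move=> i; apply/low_order_ge; exact: V.
by apply/low_order_ge; move=> w w2; apply: p3; exact: ltnW.
Qed.

Lemma normal_form_pot_order2 : order_ge 2 pot. Proof. exact: pot2. Qed.

Lemma order_atx k a : order_ge k a -> order_ge k (atx a : series).
Proof.
move=> /low_order_ge a0; apply/low_order_ge.
apply: (@subs_low _ _ _ (fun=> 1%N)) => //.
by move=> _; apply/low_order_ge; apply: low1_nocst; rewrite /varx varE.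
Qed.

Lemma radical_nf k a b :
  ideal_pow (@jacobson_radical (Jac pot)) k (qpr pot (atx a + atx b * y)) <->
  (forall i, (i < capn (nf_M L) k)%N -> pcoef i a = 0) /\
  (forall i, (i < capn (nf_N L) k.-1)%N -> pcoef i b = 0).
Proof.
rewrite radical_pow_qpr //; split.
  move=> [v vk Iv]; have [a' [b' [Ivab /(_ k vk)[a'k b'k]]]] := jac_nf d_ge2 K2 p3 v.
  have : I (atx (a - a') + atx (b - b') * y).
    have -> : atx (a - a') + atx (b - b') * y =
        (atx a + atx b * y - v) + (v - (atx a' + atx b' * y)).
      by rewrite !(linearB atx) /= mulrBl; series_ring.
    by apply: (idealD (jacobi_two_sided pot)).
  move=> /nf_rel[h1 h2]; split=> i; rewrite ltn_capn => /andP[ik bi].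
    by have := h1 i bi; rewrite pcoefD pcoefN (pcoef_ord a'k ik) subr0.
  by have := h2 i bi; rewrite pcoefD pcoefN (pcoef_ord b'k ik) subr0.
move=> [h1 h2]; exists (atx (hi k a) + atx (hi k.-1 b) * y).
  move=> w wk; rewrite addsE (order_atx (@hi_ord k a)) // add0r.
  case: k wk h1 h2 => [//|k] wk _ _; rewrite -[k.+1]addn1 in wk.
  apply: (@low_sizeM K d k 1 (atx (hi k b)) y _ _ w wk); first exact: (order_atx (@hi_ord k b)).
  by apply: low1_nocst; rewrite /vary varE.
have -> : atx a + atx b * y - (atx (hi k a) + atx (hi k.-1 b) * y) =
    atx (a - hi k a) + atx (b - hi k.-1 b) * y.
  by rewrite !(linearB atx) /= mulrBl; series_ring.
apply/nf_rel; split=> i bi; rewrite pcoefD pcoefN hi_coef; case: ifP => ik; rewrite ?subrr // subr0.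
  by apply: h1; rewrite ltn_capn ik.
by apply: h2; rewrite ltn_capn ik.
Qed.

(** The classes of [x^i] for [i < min(M, k)] and [x^i y] for [i < min(N, k - 1)],
    [y] lying in the radical. *)
Lemma nf_basis k : exists b : 'I_(capn (nf_M L) k + capn (nf_N L) k.-1) -> Jac pot,
  basis_mod [set: Jac pot] (ideal_pow (@jacobson_radical (Jac pot)) k) b.
Proof.
set A := capn _ k; set B := capn _ k.-1.
have /choice[al /choice[be abP]] q : exists a b, q = qpr pot (atx a + atx b * y).
  have [a [b [ab _]]] := jac_nf d_ge2 K2 p3 (repr q); exists a, b.
  by rewrite -(quotient_projK q); apply/quotient_projP.
pose co a b : 'rV[K]_(A + B) :=
  row_mx (\row_i pcoef (i : 'I_A) a) (\row_i pcoef (i : 'I_B) b).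
have coB a b a' b' c : co (a - c *: a') (b - c *: b') = co a b - c *: co a' b'.
  rewrite /co scale_row_mx opp_row_mx add_row_mx.
  by congr row_mx; apply/rowP => i; rewrite !mxE pcoefD pcoefN pcoefZ.
have co0 a b : co a b = 0 <->
    (forall i, (i < A)%N -> pcoef i a = 0) /\ (forall i, (i < B)%N -> pcoef i b = 0).
  rewrite -row_mx0 /co; split=> [/eq_row_mx[/rowP h1 /rowP h2]|[h1 h2]].
    split=> i ib; first by have := h1 (Ordinal ib); rewrite !mxE.
    by have := h2 (Ordinal ib); rewrite !mxE.
  by congr row_mx; apply/rowP => i; rewrite !mxE; [exact: h1|exact: h2].
have coE a b q : q = qpr pot (atx a + atx b * y) -> co (al q) (be q) = co a b.
  move=> qE; have : I (atx (al q - a) + atx (be q - b) * y).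
    have -> : atx (al q - a) + atx (be q - b) * y =
        (atx (al q) + atx (be q) * y) - (atx a + atx b * y).
      by rewrite !(linearB atx) /= mulrBl; series_ring.
    by apply/quotient_projP; rewrite -abP.
  move=> /nf_rel[h1 h2]; apply/eqP; rewrite -subr_eq0; apply/eqP.
  have -> : co (al q) (be q) - co a b = co (al q - a) (be q - b).
    by have := coB (al q) (be q) a b 1; rewrite !scale1r.
  by apply/co0; split=> i; rewrite ltn_capn => /andP[_]; [exact: h1|exact: h2].
have qB c q r : q - c *: r = qpr pot (atx (al q - c *: al r) + atx (be q - c *: be r) * y).
  rewrite {1}(abP q) {1}(abP r) -qprZ -qprB; congr (qpr pot _).
  by rewrite !(linearB atx) /= mulrBl ![atx (_ *: _)]linearZ /= -[_ *: _ * y]scalerAl; series_ring.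
pose ba (i : 'I_(A + B)) : pser := if fintype.split i is inl j then t ^+ j else 0.
pose bb (i : 'I_(A + B)) : pser := if fintype.split i is inr j then t ^+ j else 0.
exists (fun i => qpr pot (atx (ba i) + atx (bb i) * y)).
apply: (basis_mod_coord (l := fun q => co (al q) (be q))) => //.
- by move=> q r c; rewrite (coE _ _ _ (qB c q r)) coB.
- by move=> q _; rewrite {1}(abP q) radical_nf co0.
move=> i; split=> //; rewrite (coE _ _ _ erefl) /co /ba /bb.
have tc k1 k2 : pcoef k1 (t ^+ k2) = (k1 == k2)%:R.
  elim: k2 k1 => [|k2 IH] [|k1]; rewrite ?expr0.
  - by rewrite pcoef01.
  - by rewrite /pcoef onesE.
  - by rewrite exprS pcoef0M /pcoef /tvar varE mul0r.
  - by rewrite exprS pcoef_tM IH.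
apply/rowP => j; rewrite !mxE eqxx /=.
have := fintype.splitK i.
case: (fintype.splitP j) => j' jj; case: (fintype.split i) => i' /= iE; rewrite mxE ?tc //.
- by rewrite -iE -(inj_eq val_inj) /= jj.
- by rewrite -iE -(inj_eq val_inj) /= jj; case: eqP => // e; have := ltn_ord j'; rewrite e; lia.
- by rewrite -iE -(inj_eq val_inj) /= jj; case: eqP => // e; have := ltn_ord i'; rewrite -e; lia.
- by rewrite -iE -(inj_eq val_inj) /= jj eqn_add2l.
Qed.

End NormalFormAlgebra.

Section Growth.
Variable R : realType.

(** Otherwise [k^(1 - r) <= c] for all [k > 0]. *)
Lemma powR_bound (r c : R) :
  (forall k : nat, k%:R <= c * k%:R `^ r) -> 1 <= r.
Proof.
move=> H; rewrite leNgt; apply/negP => r1.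
have q0 : 0 < 1 - r by rewrite subr_gt0.
pose c' := `|c| + 1; have c'0 : 0 < c' by rewrite /c' ltr_wpDl.
pose z := c' `^ (1 - r)^-1; pose k := (Num.truncn z).+1.
have zk : z < k%:R by apply: truncnS_gt.
have k0 : 0 < k%:R :> R by rewrite ltr0n.
have zr : z `^ (1 - r) = c' by rewrite /z -powRrM mulVf ?gt_eqF // powRr1 // ltW.
have cq : c' < k%:R `^ (1 - r).
  by rewrite -zr; apply: gt0_ltr_powR => //; rewrite nnegrE ?powR_ge0 // ltW.
have kE : k%:R = k%:R `^ r * k%:R `^ (1 - r) :> R.
  rewrite -powRD ?(subrKC, powRr1) ?ler0n //.
  by apply/implyP => _; rewrite gt_eqF.
have := H k; rewrite [X in X <= _]kE mulrC ler_pM2r ?powR_gt0 // => kc.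
by have := lt_le_trans cq kc; rewrite ltNge /c' (le_trans (ler_norm c)) ?lerDl.
Qed.

Lemma dim_mod_radical_nf d (d_ge2 : (2 <= d)%N) L k : nf_valid L ->
  dim_mod R [set: Jac (xy_pot d_ge2 (nf_pot R[i] L))]
    (@jac_radical_pow R d (xy_pot d_ge2 (nf_pot R[i] L)) k) =
  (capn (nf_M L) k + capn (nf_N L) k.-1)%:R%:E.
Proof.
move=> v; set pot := xy_pot _ _.
have [b bP] := @nf_basis R[i] d d_ge2 L v k.
by apply: (@dim_mod_basis R R[i] (Jac pot) _ _ _ b) => //; exact: radical_subspace.
Qed.

(** If [n] is finite the dimensions are bounded; otherwise they grow linearly, the
    powers of [x] being independent. *)
Lemma normal_form_Jdim d (d_ge2 : (2 <= d)%N) L : nf_valid L ->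
  Jdim (normal_form R[i] d_ge2 L) = if nf_n L is Some _ then 0%:E else 1%:E :> \bar R.
Proof.
move=> v; rewrite normal_formE //.
set pot := xy_pot _ _.
have dimE n : dim_mod R [set: Jac pot] (@jac_radical_pow R d pot n) =
    (capn (nf_M L) n + capn (nf_N L) n.-1)%:R%:E.
  exact: dim_mod_radical_nf.
rewrite /Jdim; set S := [set r | _].
have leS r : S r -> (r%:E <= ereal_inf [set r%:E | r in S] -> ereal_inf [set r%:E | r in S] = r%:E)%E.
  move=> Sr le; apply/eqP; rewrite eq_le le andbT.
  by apply: ereal_inf_lbound; exists r.
case e: (nf_n L) => [n|]; apply: leS.
- split=> //; exists (2 * n - 1 + nf_e L + (2 * n - 1))%:R => k.
  rewrite dimE lee_fin powRr0 mulr1 ler_nat /nf_M /nf_N e /=.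
  by apply: leq_add; apply: geq_minr.
- by apply: le_ereal_inf_tmp => _ [r [r0 _] <-]; rewrite lee_fin.
- split=> //; exists 2 => k.
  rewrite dimE lee_fin powRr1 // -natrM ler_nat /nf_M /nf_N e /=; lia.
apply: le_ereal_inf_tmp => _ [r [r0 [c cP]] <-]; rewrite lee_fin.
apply: (@powR_bound r c) => k; rewrite -lee_fin; apply: le_trans (cP k).
by rewrite dimE lee_fin ler_nat /nf_M e /= leq_addr.
Qed.

End Growth.

(** * Pairs and isomorphisms *)

Section Pairs.
Variable K : fieldType.
Local Notation pser := (pser K).
Local Notation pair := (pser * pser)%type.
Implicit Types (u v : pair).

(** The product of [a(x) + b(x) y] and [a'(x) + b'(x) y] when [y ^+ 2] is [s(x)]
    and [y x = - x y].  It is associative only modulo the relations [pzero], so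
    powers have to be bracketed in a definite way. *)
Definition pmul (s : pser) u v : pair :=
  (u.1 * v.1 + u.2 * pconj v.2 * s, u.1 * v.2 + u.2 * pconj v.1).

(** The power [2 k + 1] of [u], multiplying by the square at each step. *)
Fixpoint podd s u k : pair :=
  if k is k'.+1 then pmul s (podd s u k') (pmul s u u) else u.

(** The derivative of the potential of [L] evaluated at [u]. *)
Definition dpair s (L : nf_label) u : pair :=
  (if nf_n L is Some n then (2 * n)%:R *: podd s u n.-1 else 0) +
  (if nf_m L is Some m then (2 * m + 1)%:R *: pmul s (podd s u m.-1) u else 0).

(** The pairs which are zero in the Jacobi algebra, by [jac_nf_eq]. *)
Definition pzero (s : pser) u :=
  (exists a, u.1 = (s - pconj s) * s * a) /\ (exists b, u.2 = (s - pconj s) * b).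

End Pairs.

Section IsoPairs.
Variables (K : numClosedFieldType) (d : nat) (d_ge2 : (2 <= d)%N) (L L' : nf_label).
Hypotheses (L_valid : nf_valid L) (L'_valid : nf_valid L').
Local Notation series := (ncseries K d).
Local Notation pser := (pser K).
Local Notation pair := (pser * pser)%type.
Local Notation t := (tvar K).
Local Notation x := (varx K d_ge2).
Local Notation y := (vary K d_ge2).
Local Notation ix := (ix d_ge2).
Local Notation iy := (iy d_ge2).
Local Notation atx := (at_x d_ge2).
Local Notation f := (xy_pot d_ge2 (nf_pot K L')).
Local Notation g := (xy_pot d_ge2 (nf_pot K L)).
Local Notation s := (ysq (nf_pot K L)).
Implicit Types (u v : pair).

Let K2 : (2 : K) != 0. Proof. by rewrite pnatr_eq0. Qed.
Let p3 : order_ge 3 (nf_pot K L). Proof. exact: nf_pot_order. Qed.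
Let P u : Jac g := qpr g (atx u.1 + atx u.2 * y).

Let PM u v : P u * P v = P (pmul s u v).
Proof. by rewrite /P -qprM; apply/quotient_projP; exact: (jac_nf_mul d_ge2 (nf_pot K L)). Qed.

Let PD u v : P u + P v = P (u + v).
Proof. by rewrite /P -qprD; congr (qpr g _); rewrite !(linearD atx) /= mulrDl; series_ring. Qed.

Let PZ c u : c *: P u = P (c *: u).
Proof.
rewrite /P -qprZ; congr (qpr g _); rewrite ![atx (_ *: _)]linearZ /=.
by rewrite -[_ *: _ * y]scalerAl scalerDr.
Qed.

Let P0 u : P u = 0 <-> pzero s u.
Proof. exact: (iff_trans (qpr_eq0 _ _) (jac_nf_eq d_ge2 K2 p3 u.1 u.2)). Qed.

Let P_surj q : exists u, q = P u.
Proof.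
have [a [b [ab _]]] := jac_nf d_ge2 K2 p3 (repr q); exists (a, b).
by rewrite -(quotient_projK q); apply/quotient_projP.
Qed.

(** The coefficients of [x] and [y] are those modulo the square of the radical: all
    relations between normal forms have higher order. *)
Let P_eq u v : P u = P v -> pcoef 1 u.1 = pcoef 1 v.1 /\ pcoef 0 u.2 = pcoef 0 v.2.
Proof.
move=> e; have s2 := ysq_ord p3; have o2 := ordB s2 (ord_pconj s2).
have : P (u + (-1) *: v) = 0 by rewrite -PD -PZ e scaleN1r subrr.
move=> /P0[[a ea] [b eb]]; split; apply/eqP; rewrite -subr_eq0.
  have <- : pcoef 1 (u + (-1) *: v).1 = pcoef 1 u.1 - pcoef 1 v.1.
    by rewrite pcoefD pcoefZ mulN1r.
  by rewrite ea (@pcoef_ord _ 2) //; apply: ordMr; apply: ordMr.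
have <- : pcoef 0 (u + (-1) *: v).2 = pcoef 0 u.2 - pcoef 0 v.2.
  by rewrite pcoefD pcoefZ mulN1r.
by rewrite eb (@pcoef_ord _ 2) //; apply: ordMr.
Qed.

Variables (F : Jac f -> Jac g) (G : Jac g -> Jac f).
Hypotheses (FG : Jac_bij F G) (GF : Jac_bij G F) (FZ : scalable F).

Let FB : additive F. Proof. by case: FG. Qed.
Let FM q r : F (q * r) = F q * F r. Proof. by case: FG => _ _ _ []. Qed.
Let F0 : F 0 = 0. Proof. by rewrite -(subrr 0) FB subrr. Qed.
Let FD q r : F (q + r) = F q + F r.
Proof. by rewrite -[r in LHS]opprK -[- r]sub0r !FB F0 sub0r opprK. Qed.

Let image_small w : w [::] = 0 -> exists2 u : pair, F (qpr f w) = P u & pcoef 0 u.1 = 0.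
Proof.
move=> w0.
have f2 := @normal_form_pot_order2 K d d_ge2 L' L'_valid.
have g2 := @normal_form_pot_order2 K d d_ge2 L L_valid.
have : ideal_pow (@jacobson_radical (Jac f)) 1 (qpr f w).
  by apply/radical_powP => //; exists w => //; exact: low1_nocst.
move=> /(Jac_bij_pow 1 f2 g2 FG GF)/(radical_powP 1 g2)[w' -> w'1].
have [a [b [ab /(_ 1 w'1)[a1 _]]]] := jac_nf d_ge2 K2 p3 w'.
exists (a, b); last exact: (pcoef_ord a1).
by apply/quotient_projP.
Qed.

Let split_xy w : w [::] = 0 -> exists A B, qpr f w = qpr f x * qpr f A + qpr f y * qpr f B.
Proof.
move=> w0; exists (lquo ix w), (lquo iy w); rewrite -!qprM -qprD; apply/quotient_projP.
have nxy : iy != ix by rewrite iy_ix.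
rewrite {1}[w]lquo_split w0 scale0r add0r (bigD1 ix) //= (bigD1 iy) //=.
rewrite -[x]/(var K ix) -[y]/(var K iy) addrA [X in X - _]addrC addrK.
apply: (ideal_sum (jacobi_two_sided f)) => i /andP[ni1 ni2].
apply: (idealMr (jacobi_two_sided f)).
by case: (xyzP d_ge2 i) ni1 ni2 => [zi _ _|-> /eqP//|-> _ /eqP//]; exact: (jac_z d_ge2 K2 (nf_pot K L') zi).
Qed.

(** What an isomorphism says in coordinates: the images [u] of [x] and [v] of [y]
    lie in the radical, generate it modulo its square, whence the determinant, and
    satisfy the defining relations of the source. *)
Lemma iso_pairs : exists u v : pair,
  [/\ pcoef 0 u.1 = 0 /\ pcoef 0 v.1 = 0,
      pcoef 1 u.1 * pcoef 0 v.2 - pcoef 0 u.2 * pcoef 1 v.1 != 0,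
      pzero s (pmul s u v + pmul s v u) &
      pzero s (pmul s v v + dpair s L' u)].
Proof.
have x0 : (x : series) [::] = 0 by rewrite /varx varE.
have y0 : (y : series) [::] = 0 by rewrite /vary varE.
have [u uE u0] := image_small x0; have [v vE v0] := image_small y0.
have s2 := ysq_ord p3.
have odd_pow k : F (qpr f (x ^+ (2 * k + 1))) = P (podd s u k).
  elim: k => [|k IH] /=; first by rewrite uE.
  rewrite -!PM -IH -uE -!FM -!qprM; congr (F (qpr f _)).
  by rewrite -expr2 -exprD; congr (_ ^+ _); lia.
have c1 (a b : pser) : pcoef 0 a = 0 -> pcoef 1 (a * b) = pcoef 1 a * pcoef 0 b.
  move=> a0; have [a' ->] : exists a', a = t ^+ 1 * a'.
    by apply: ord_factor; apply/order_geP => -[].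
  by rewrite -mulrA -[X in pcoef X]addn0 pcoef_tXM -[1%N in RHS]addn0 pcoef_tXM pcoef0M.
have gen w : (w : series) [::] = 0 -> exists a b u' , [/\ qpr g w = P u',
    pcoef 1 u'.1 = pcoef 1 u.1 * a + pcoef 1 v.1 * b &
    pcoef 0 u'.2 = pcoef 0 u.2 * a + pcoef 0 v.2 * b].
  move=> w0; have f2 := @normal_form_pot_order2 K d d_ge2 L' L'_valid.
  have g2 := @normal_form_pot_order2 K d d_ge2 L L_valid.
  have : ideal_pow (@jacobson_radical (Jac g)) 1 (qpr g w).
    by apply/radical_powP => //; exists w => //; exact: low1_nocst.
  move=> /(Jac_bij_pow 1 g2 f2 GF FG)/(radical_powP 1 f2)[w' e w'1].
  have [A [B AB]] := split_xy (w'1 [::] isT).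
  have [a aE] := P_surj (F (qpr f A)); have [b bE] := P_surj (F (qpr f B)).
  exists (pcoef 0 a.1), (pcoef 0 b.1), (pmul s u a + pmul s v b); split.
  - rewrite -PD -!PM -uE -vE -aE -bE -!FM -FD -AB -e.
    by have [-> _ _ _] := GF.
  - have z e' : pcoef 1 (e' * s) = 0 by apply: (pcoef_ord (k := 2)) => //; exact: ordMl.
    by rewrite /= !pcoefD !z !addr0 !c1.
  - by rewrite /= !pcoefD !pcoef0M u0 v0 !mul0r !add0r !pcoef_pconj !expr0 !mul1r.
exists u, v; split=> //.
- have [a [b [ux [e1 e2 e3]]]] := gen x x0.
  have [a' [b' [uy [e1' e2' e3']]]] := gen y y0.
  have [h1 h2] : pcoef 1 ux.1 = 1 /\ pcoef 0 ux.2 = 0.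
    have := @P_eq ux (t, 0); rewrite -e1 /P /= (linear0 atx) mul0r addr0 at_x_var => /(_ erefl)[-> ->].
    by rewrite /pcoef /tvar varE eqxx.
  have [h1' h2'] : pcoef 1 uy.1 = 0 /\ pcoef 0 uy.2 = 1.
    have := @P_eq uy (0, 1); rewrite -e1' /P /= (linear0 atx) rmorph1 mul1r add0r => /(_ erefl)[-> ->].
    by rewrite pcoef01.
  have : (pcoef 1 u.1 * pcoef 0 v.2 - pcoef 0 u.2 * pcoef 1 v.1) * (a * b' - a' * b) = 1.
    rewrite -[RHS](_ : pcoef 1 ux.1 * pcoef 0 uy.2 - pcoef 0 ux.2 * pcoef 1 uy.1 = 1); last first.
      by rewrite h1 h2 h1' h2'; ring.
    by rewrite e2 e3 e2' e3'; ring.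
  by apply: contra_eq_neq => ->; rewrite mul0r eq_sym oner_neq0.
- apply/P0; rewrite -PD -!PM -uE -vE -!FM -FD -!qprM -qprD.
  by rewrite (iffRL (qpr_eq0 f _) (jac_xy d_ge2 (nf_pot K L'))) F0.
apply/P0; rewrite -PD -PM -vE -FM -qprM.
have -> : P (dpair s L' u) = F (qpr f (atx (pder (nf_pot K L')))).
  rewrite /nf_pot pderD (pder_nf_even K L'_valid) pder_nf_odd (linearD atx) /= qprD FD /dpair -PD.
  have Z : P 0 = 0 by apply/P0; split; exists 0; rewrite mulr0.
  congr (_ + _).
    case e: (nf_n L') => [n|]; last by rewrite (linear0 atx) qpr0 F0.
    rewrite -PZ -odd_pow [atx (_ *: _)]linearZ /= rmorphXn /= at_x_var qprZ FZ.
    by congr (_ *: F (qpr f (_ ^+ _))); have := nf_n_ge2 L'_valid e; lia.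
  case e: (nf_m L') => [m|]; last by rewrite (linear0 atx) qpr0 F0.
  rewrite -PZ -PM -odd_pow -uE -FM -qprM [atx (_ *: _)]linearZ /= rmorphXn /= at_x_var qprZ FZ.
  by rewrite -exprSr; congr (_ *: F (qpr f (_ ^+ _))); have := nf_m_gt0 L'_valid e; lia.
rewrite -FD -qprD (iffRL (qpr_eq0 f _)) // -expr2.
have := jac_yy d_ge2 (nf_pot K L').
by rewrite /ysq (linearN atx) opprK.
Qed.

End IsoPairs.

(** * Distinguishing the normal forms *)

Section PairOrders.
Variable K : fieldType.
Local Notation pser := (pser K).
Local Notation t := (tvar K).
Local Notation conj := (@pconj K).
Implicit Types (a b s : pser) (u v : pser * pser).

Lemma ordM_le k k1 k2 a b : order_ge k1 a -> order_ge k2 b -> (k <= k1 + k2)%N ->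
  order_ge k (a * b).
Proof. by move=> a0 b0 le; apply: (ord_le le); apply: ordM. Qed.

Lemma ordX_le k l n a : order_ge l a -> (k <= n * l)%N -> order_ge k (a ^+ n).
Proof. by move=> a0 le; apply: (ord_le le); apply: ordX. Qed.

Lemma pcoefM_ord k l a b : order_ge k a -> order_ge l b ->
  pcoef (k + l) (a * b) = pcoef k a * pcoef l b.
Proof.
move=> /ord_factor[a' ->] /ord_factor[b' ->].
have -> : t ^+ k * a' * (t ^+ l * b') = t ^+ (k + l) * (a' * b') by rewrite exprD; ring.
have E j c : pcoef j (t ^+ j * c) = pcoef 0 c by rewrite -{1}[j]addn0 pcoef_tXM.
by rewrite !E pcoef0M.
Qed.

Lemma pcoefX_ord k n a : order_ge k a -> pcoef (n * k) (a ^+ n) = pcoef k a ^+ n.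
Proof.
move=> a0; elim: n => [|n IH]; first by rewrite !expr0 pcoef01.
by rewrite !exprS mulSn pcoefM_ord ?IH //; apply: ordX.
Qed.

(** [a(x) + b(x) y] goes to [a(x)] under a ring morphism onto the quotient by [y]
    and [s(x)]. *)
Lemma podd_fst k s u j : order_ge k s -> order_ge k ((podd s u j).1 - u.1 ^+ (2 * j + 1)).
Proof.
move=> s0; elim: j => [|j IH]; first by rewrite subrr.
have e : u.1 ^+ (2 * j.+1 + 1) = u.1 ^+ (2 * j + 1) * u.1 ^+ 2 by rewrite -exprD; congr (_ ^+ _); lia.
rewrite e /=; set a := (podd s u j).1; set b := (podd s u j).2.
set h := u.1 * u.2 + _.
have -> : a * (u.1 * u.1 + u.2 * conj u.2 * s) + b * conj h * s - u.1 ^+ (2 * j + 1) * u.1 ^+ 2 =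
    (a - u.1 ^+ (2 * j + 1)) * u.1 ^+ 2 + (a * (u.2 * conj u.2) + b * conj h) * s by ring.
by apply: ordD; [exact: ordMr|exact: ordMl].
Qed.

End PairOrders.

Section NoEvenPart.
Variable K : numClosedFieldType.
Local Notation pser := (pser K).
Local Notation t := (tvar K).
Local Notation conj := (@pconj K).
Implicit Types (u v : pser * pser).

(** Modulo [x^k] and [y], the images [c] of [x] and [a] of [y] satisfy
    [2 a c = 0] and [a^2 + (2 m + 1) c^(2 m) = 0].  If [c] has order one, then [a]
    has order at least [k - 1] and [c^(2 m) = 0], so that [k <= 2 m].  Otherwise
    [a] has order one and [c] has order at least [k - 1], contradicting the second
    equation. *)
Lemma odd_exponent_bound k (s : pser) L m u v : (3 <= k)%N -> order_ge k s ->
  nf_n L = None -> nf_m L = Some m -> (0 < m)%N ->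
  pcoef 0 u.1 = 0 -> pcoef 0 v.1 = 0 ->
  pcoef 1 u.1 * pcoef 0 v.2 - pcoef 0 u.2 * pcoef 1 v.1 != 0 ->
  pzero s (pmul s u v + pmul s v u) -> pzero s (pmul s v v + dpair s L u) ->
  (k <= 2 * m)%N.
Proof.
case: u v => [c e] [a b] /= k3 s0 Ln Lm m0 c0 a0 det [[r1 E1] _] [[r2 E2] _].
case: k k3 s0 => // k k3 s0.
have o w : pcoef 0 w = 0 -> order_ge 1 (w : pser) by move=> w0; apply/order_geP => -[].
have {c0} c1 := o _ c0; have {a0} a1 := o _ a0.
have nz j : j.+1%:R != 0 :> K by rewrite pnatr_eq0.
have ac : order_ge k.+1 (a * c).
  have -> : a * c = 2^-1 *: (2 *: (a * c)) by rewrite scalerA mulVf ?scale1r.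
  apply: ordZ.
  have -> : 2 *: (a * c) = (s - conj s) * s * r1 - (e * conj b + b * conj e) * s.
    by rewrite -E1 /pmul /= scaler_nat mulr2n; ring.
  by apply: ordB; [apply: ordMr|]; exact: ordMl.
have aa : order_ge k.+1 (a ^+ 2 + (2 * m + 1)%:R *: c ^+ (2 * m)).
  have P := @podd_fst K k.+1 s (c, e) m.-1 s0; rewrite /= in P.
  have e2 : c ^+ (2 * m) = c ^+ (2 * m.-1 + 1) * c by rewrite -exprSr; congr (_ ^+ _); lia.
  move: E2; rewrite /dpair Ln Lm /=; set q := podd _ _ _ in P * => E2.
  have -> : a ^+ 2 + (2 * m + 1)%:R *: c ^+ (2 * m) = (s - conj s) * s * r2 - b * conj b * s
      - (2 * m + 1)%:R *: ((q.1 - c ^+ (2 * m.-1 + 1)) * c + q.2 * conj e * s).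
    rewrite -E2 e2 /pmul /= mulrBl expr2; series_ring.
  apply: ordB; first by apply: ordB; [apply: ordMr|]; exact: ordMl.
  by apply: ordZ; apply: ordD; [exact: ordMr|exact: ordMl].
case: (eqVneq (pcoef 1 c) 0) => [cz|cn].
  have c2 := ordS c1 cz; have an : pcoef 1 a != 0.
    by apply: contraNneq det => az; rewrite cz az; apply/eqP; ring.
  have [a' aE] := ord_factor a1; have ua : punit a'.
    by apply/punitP; rewrite -(pcoef_tXM 1) -aE.
  have ck : order_ge k c.
    move: ac; rewrite aE -mulrA mulrC -[a' * c * _]mulrC -[k.+1]add1n => /ord_tXM.
    by rewrite mulrC => /(ord_unit _ _ ua).
  have : order_ge k.+1 (a ^+ 2).
    have -> : a ^+ 2 = a ^+ 2 + (2 * m + 1)%:R *: c ^+ (2 * m) - (2 * m + 1)%:R *: c ^+ (2 * m).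
      by rewrite addrK.
    apply: ordB => //; apply: ordZ; apply: (@ord_le _ (2 * m * k)); last exact: ordX.
    by nia.
  have := pcoefX_ord 2 a1 => /= e1 /(@pcoef_ord _ _ 2) e2.
  by move: e1; rewrite e2 // => /esym/eqP; rewrite expf_eq0 /= (negPf an).
have [c' cE] := ord_factor c1; have uc : punit c'.
  by apply/punitP; rewrite -(pcoef_tXM 1) -cE.
have ak : order_ge k a.
  move: ac; rewrite cE mulrC -mulrA -[k.+1]add1n => /ord_tXM.
  by rewrite mulrC => /(ord_unit _ _ uc).
rewrite leqNgt; apply/negP => mk.
have : order_ge k.+1 (c ^+ (2 * m)).
  have -> : c ^+ (2 * m) = (2 * m + 1)%:R^-1 *:
      (a ^+ 2 + (2 * m + 1)%:R *: c ^+ (2 * m) - a ^+ 2).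
    by rewrite addrAC subrr add0r scalerA mulVf ?scale1r // addn1.
  apply: ordZ; apply: ordB => //; apply: (@ord_le _ (2 * k)); last exact: ordX.
  by lia.
move=> /pcoef_ord/(_ mk) e2; have := pcoefX_ord (2 * m) c1; rewrite muln1 e2.
by move/esym/eqP; rewrite expf_eq0 (negPf cn) andbF.
Qed.

End NoEvenPart.

Section MixedPart.
Variables (K : numClosedFieldType) (n m : nat).
Hypotheses (n2 : (2 <= n)%N) (nm : (n <= m)%N) (m2n : (m <= 2 * n - 2)%N).
Local Notation pser := (pser K).
Local Notation pair := (pser * pser)%type.
Local Notation t := (tvar K).
Local Notation conj := (@pconj K).
Local Notation c1 := ((2 * n)%:R : K).
Local Notation c2 := ((2 * m + 1)%:R : K).
Local Notation s := (- (c1 *: t ^+ (2 * n - 1) + c2 *: t ^+ (2 * m)) : pser).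

Let pcoef_tX i j : pcoef i (t ^+ j) = (i == j)%:R.
Proof.
case: (leqP i j) => [|ji]; last first.
  rewrite -(subnKC (ltnW ji)) -[t ^+ j]mulr1 pcoef_tXM /pcoef onesE -size_eq0 size_nseq.
  by congr (_%:R); congr nat_of_bool; lia.
rewrite leq_eqVlt => /orP[/eqP ->|ij].
  by rewrite -[t ^+ j]mulr1 -{1}[j]addn0 pcoef_tXM pcoef01 eqxx.
by rewrite (pcoef_ord (@ord_tX K j)) // ltn_eqF.
Qed.

Let s_ord : order_ge (2 * n - 1) s.
Proof.
apply: ordN; apply: ordD; apply: ordZ; first exact: ord_tX.
by apply: ord_le (@ord_tX K _); lia.
Qed.

Let s_conj : conj s = c1 *: t ^+ (2 * n - 1) - c2 *: t ^+ (2 * m).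
Proof.
have sE i : pcoef i s = - (c1 * (i == 2 * n - 1)%N%:R + c2 * (i == 2 * m)%N%:R).
  by rewrite -!pcoef_tX.
apply: pserP => i; rewrite pcoef_pconj sE.
transitivity (c1 * (i == 2 * n - 1)%N%:R - c2 * (i == 2 * m)%N%:R); last by rewrite -!pcoef_tX.
rewrite -signr_odd; case: eqP => [->|_].
  have -> : (2 * n - 1 == 2 * m)%N = false by lia.
  have -> : odd (2 * n - 1) by lia.
  by rewrite expr1 mulr1 mulr0; ring.
case: eqP => [->|_]; last by rewrite !(mulr0, addr0, oppr0).
have -> : odd (2 * m) = false by lia.
by rewrite expr0 mulr1 mulr0; ring.
Qed.

Let s_coef : pcoef (2 * n - 1) s = - c1.
Proof.
transitivity (- (c1 * pcoef (2 * n - 1) (t ^+ (2 * n - 1)) + c2 * pcoef (2 * n - 1) (t ^+ (2 * m)))).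
  by [].
rewrite !pcoef_tX eqxx mulr1.
have -> : (2 * n - 1 == 2 * m)%N = false by lia.
by rewrite mulr0 addr0.
Qed.

Let conj_ord k (a : pser) : order_ge k a -> order_ge k (conj a).
Proof. exact: ord_pconj. Qed.

Let pzero_ord (w : pair) : pzero s w -> order_ge (4 * n - 2) w.1 /\ order_ge (2 * n - 1) w.2.
Proof.
have o := ordB s_ord (conj_ord s_ord).
case=> [[a ->] [b ->]]; split; apply: ordMr => //.
by apply: (ordM_le o s_ord); lia.
Qed.

(** When [c] is odd up to order [2 n - 2], the square of [c(x) + e(x) y] is close to
    [G(x)] with [G] nearly even, so that odd powers are nearly multiples of
    [c(x) + e(x) y] by [G ^+ k].  The error terms carry a factor [s] or
    [c + c^-]. *)
Let podd_mod (c e : pser) k : order_ge 1 c -> order_ge (2 * n - 2) (c + conj c) ->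
  let G := c * c + e * conj e * s in
  order_ge (2 * m + 1) ((podd s (c, e) k).1 - G ^+ k * c) /\
  order_ge (2 * n - 1) ((podd s (c, e) k).2 - G ^+ k * e).
Proof.
move=> c0 cc G.
have G2 : order_ge 2 G.
  apply: ordD; first exact: (ordM c0 c0).
  by apply: ordMl; apply: ord_le s_ord; lia.
have GG : order_ge (2 * n - 1) (G - conj G).
  have -> : G - conj G = (c - conj c) * (c + conj c) + e * conj e * (s - conj s).
    by rewrite /G (linearD conj) /= !rmorphM /= pconjK; ring.
  apply: ordD; last by apply: ordMl; apply: ordB => //; exact: conj_ord.
  by apply: (ordM_le (ordB c0 (conj_ord c0)) cc); lia.
elim: k => [|k [IH1 IH2]]; first by rewrite !expr0 !mul1r /= !subrr.
rewrite /= -/G; set h := c * e + e * conj c.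
have h0 : order_ge (2 * n - 2) h.
  have -> : h = e * (c + conj c) by rewrite /h; ring.
  exact: ordMl.
set q := podd _ _ _ in IH1 IH2 *.
have q1 : order_ge 1 q.1.
  have -> : q.1 = (q.1 - G ^+ k * c) + G ^+ k * c by rewrite subrK.
  apply: ordD; last exact: (ordMl _ c0).
  by apply: ord_le IH1; rewrite addn1.
split.
  have -> : q.1 * G + q.2 * conj h * s - G ^+ k.+1 * c =
      (q.1 - G ^+ k * c) * G + q.2 * (conj h * s) by rewrite exprS; ring.
  apply: ordD; first exact: ordMr.
  by apply: ordMl; apply: (ordM_le (conj_ord h0) s_ord); lia.
have -> : q.1 * h + q.2 * conj G - G ^+ k.+1 * e =
    q.1 * h + (q.2 - G ^+ k * e) * conj G - G ^+ k * e * (G - conj G) by rewrite exprS; ring.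
apply: ordB; last exact: ordMl.
by apply: ordD; [apply: (ordM_le q1 h0); lia|exact: ordMr].
Qed.

(** Here [p' = 2 n x^(2 n - 1) + (2 m + 1) x^(2 m)] with [2 n - 1 < 2 m], while the
    relations of [L] contain [x^(2 n - 1)] but no even power up to [x^(2 m)].  The relation
    [x y + y x = 0] makes [c] odd up to high order and [a] of high order.  Then
    [y^2 + p'(x) = 0], expanded to order [2 m + 1], is odd except for negligible terms and the term
    [b b^- x^(2 m)] coming from [y^2]; hence [b] vanishes at [0], contradicting the
    determinant.  The order [2 n - 2] reached at first is one short; the lowest
    coefficients of the relations, a homogeneous linear system in the values [E]
    and [A] of [e] and of [a / x^(2 n - 2)] at [0], improve it by one. *)
Lemma mixed_contradiction L (u v : pair) : nf_n L = Some n ->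
  (if nf_m L is Some m' then (m < m')%N else true) ->
  pcoef 0 u.1 = 0 -> pcoef 0 v.1 = 0 ->
  pcoef 1 u.1 * pcoef 0 v.2 - pcoef 0 u.2 * pcoef 1 v.1 != 0 ->
  pzero s (pmul s u v + pmul s v u) -> ~ pzero s (pmul s v v + dpair s L u).
Proof.
case: u v => [c e] [a b] /= Ln Lm c00 a00 det.
move=> /pzero_ord[]; rewrite /pmul /= => E1 E2 /pzero_ord[]; rewrite /dpair Ln /= => F1 F2.
have o w : pcoef 0 w = 0 -> order_ge 1 (w : pser) by move=> w0; apply/order_geP => -[].
have {c00} c0 := o _ c00; have {a00} a0 := o _ a00.
have nz j : (0 < j)%N -> j%:R != 0 :> K by rewrite pnatr_eq0 lt0n.
have half (w : pser) k : order_ge k (2 *: w) -> order_ge k w.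
  move=> /(@ordZ K k 2^-1); rewrite scalerA mulVf ?scale1r //; exact: nz.
(* the coefficient of [t^2] in the second relation only sees [a ^+ 2] *)
have ca : pcoef 1 a = 0.
  have P j := @podd_fst K (2 * n - 1) s (c, e) j s_ord; rewrite /= in P.
  have O3 : order_ge 3 (podd s (c, e) n.-1).1.
    rewrite -[X in order_ge _ X](subrK (c ^+ (2 * n.-1 + 1))).
    apply: ordD; first by apply: ord_le (P _); lia.
    by apply: (ordX_le c0); lia.
  have M3 : order_ge 3 (if nf_m L is Some m' then (2 * m' + 1)%:R *: pmul s (podd s (c, e) m'.-1) (c, e) else 0).1.
    case: (nf_m L) Lm => [m'|] //= mm; apply: ordZ; apply: ordD.
      rewrite -[X in X * _](subrK (c ^+ (2 * m'.-1 + 1))) mulrDl.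
      apply: ordD; first by apply: ordMr; apply: ord_le (P _); lia.
      by apply: (@ordM_le _ 3 (2 * m'.-1 + 1) 1) => //; [apply: (ordX_le c0)|]; lia.
    by apply: ordMl; apply: ord_le s_ord; lia.
  have : order_ge 3 (a ^+ 2).
    move: F1 O3 M3; set Q := podd _ _ n.-1; set M := (X in _ *: Q.1 + X) => F1 O3 M3.
    have -> : a ^+ 2 = (a * a + b * conj b * s + (c1 *: Q.1 + M)) -
        (b * conj b * s + (c1 *: Q.1 + M)) by rewrite expr2; series_ring.
    apply: ordB; first by apply: ord_le F1; lia.
    apply: ordD; first by apply: ordMl; apply: ord_le s_ord; lia.
    by apply: ordD => //; exact: ordZ.
  move=> /(@pcoef_ord _ _ 2)/(_ isT) e2; have := pcoefX_ord 2 a0.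
  by rewrite muln1 e2 => /esym/eqP; rewrite expf_eq0 => /andP[_ /eqP].
move: det; rewrite ca mulr0 subr0 mulf_eq0 negb_or => /andP[cn bn].
have ub : punit b by apply/punitP.
have cb : pcoef 0 (conj b) = pcoef 0 b by rewrite pcoef_pconj expr0 mul1r.
have ce : pcoef 0 (conj e) = pcoef 0 e by rewrite pcoef_pconj expr0 mul1r.
have [c' cE] := ord_factor c0.
have uc : punit c' by apply/punitP; rewrite -(pcoef_tXM 1) -cE.
have s0 := s_ord; have sc := s_coef.
have s1 : s + conj s = - (2 * c2) *: t ^+ (2 * m).
  by rewrite s_conj; apply: seriesP => w; rewrite !(addsE, oppsE, scalesE); ring.
have P := @podd_mod c e.
move: s s0 sc s1 P E1 E2 F1 F2 => S s0 sc s1 P E1 E2 F1 F2.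
have a1 : order_ge (2 * n - 2) a.
  have : order_ge (2 * n - 1) (2 *: (a * c)).
    have -> : 2 *: (a * c) = c * a + e * conj b * S + (a * c + b * conj e * S) -
        (e * conj b + b * conj e) * S by rewrite scaler_nat mulr2n; ring.
    by apply: ordB; [apply: ord_le E1; lia|exact: ordMl].
  move=> /half; rewrite cE mulrC -mulrA.
  have -> : (2 * n - 1 = 1 + (2 * n - 2))%N by lia.
  by move=> /ord_tXM; rewrite mulrC => /(ord_unit _ _ uc).
have cc : order_ge (2 * n - 2) (c + conj c).
  have : order_ge (2 * n - 2) ((c + conj c) * b).
    have -> : (c + conj c) * b = c * b + e * conj a + (a * e + b * conj c) - e * (a + conj a) by ring.
    apply: ordB; first by apply: ord_le E2; lia.
    by apply: ordMl; apply: ordD => //; exact: conj_ord.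
  by move=> /(ord_unit _ _ ub).
have {}P k := P k c0 cc; rewrite /= in P.
pose G := c * c + e * conj e * S; rewrite -/G in P.
have G2 : order_ge 2 G.
  apply: ordD; first exact: (ordM c0 c0).
  by apply: ordMl; apply: ord_le s0; lia.
pose g := pcoef 1 c.
have gG : pcoef 2 G = g ^+ 2.
  rewrite pcoefD (@pcoef_ord _ 3 _ (_ * S)) //; last by apply: ordMl; apply: ord_le s0; lia.
  by rewrite addr0 expr2 -(pcoefM_ord c0 c0).
have H : order_ge (2 * m + 1) (a * a + b * conj b * S + c1 *: (G ^+ n.-1 * c)) /\
    order_ge (2 * n - 1) (a * b + b * conj a + c1 *: (G ^+ n.-1 * e)).
  have [P1 P2] := P n.-1; move: F1 F2 P1 P2.
  set Q := podd _ _ n.-1; set M1 := (X in _ *: Q.1 + X); set M2 := (X in _ *: Q.2 + X) => F1 F2 P1 P2.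
  have [o1 o2] : order_ge (2 * m + 1) M1 /\ order_ge (2 * n - 1) M2.
    rewrite /M1 /M2; case: (nf_m L) Lm => [m'|] //= mm.
    have [R1 R2] := P m'.-1; move: R1 R2; set q := podd _ _ m'.-1 => R1 R2.
    have Gm : order_ge (2 * m) (G ^+ m'.-1) by apply: (ordX_le G2); lia.
    split; apply: ordZ.
      have -> : q.1 * c + q.2 * conj e * S = (q.1 - G ^+ m'.-1 * c) * c +
          (q.2 - G ^+ m'.-1 * e) * (conj e * S) + G ^+ m'.-1 * (c * c + e * conj e * S) by ring.
      apply: ordD; first apply: ordD; first exact: ordMr.
        by apply: (ordM_le R2 (ordMl _ s0)); lia.
      by apply: (ordM_le Gm G2); lia.
    have -> : q.1 * e + q.2 * conj c = (q.1 - G ^+ m'.-1 * c) * e +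
        (q.2 - G ^+ m'.-1 * e) * conj c + G ^+ m'.-1 * (c * e + e * conj c) by ring.
    apply: ordD; first apply: ordD; last by apply: ordMr; apply: ord_le Gm; lia.
      by apply: ordMr; apply: ord_le R1; lia.
    exact: ordMr.
  split.
    have -> : a * a + b * conj b * S + c1 *: (G ^+ n.-1 * c) =
        a * a + b * conj b * S + (c1 *: Q.1 + M1) - c1 *: (Q.1 - G ^+ n.-1 * c) - M1.
      by series_ring.
    apply: ordB => //; apply: ordB; first by apply: ord_le F1; lia.
    exact: ordZ.
  have -> : a * b + b * conj a + c1 *: (G ^+ n.-1 * e) =
      a * b + b * conj a + (c1 *: Q.2 + M2) - c1 *: (Q.2 - G ^+ n.-1 * e) - M2.
    by series_ring.
  apply: ordB => //; apply: ordB => //.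
  exact: ordZ.
case: H => H1 H2.
pose A := pcoef (2 * n - 2) a; pose B := pcoef 0 b; pose E := pcoef 0 e.
have c1n : c1 != 0 by apply: nz; lia.
(* [k1], [k2] and [k3] are the lowest coefficients of the two components of
   [y^2 + p'(x)] and of the first component of [x y + y x] *)
have k1 : B ^+ 2 = g ^+ 2 ^+ n.-1 * g.
  have : pcoef (2 * n - 1) (a * a + b * conj b * S + c1 *: (G ^+ n.-1 * c)) = 0.
    by apply: (pcoef_ord H1); lia.
  rewrite !pcoefD pcoefZ (pcoef_ord (ordM a1 a1)); last by lia.
  have -> : pcoef (2 * n - 1) (b * conj b * S) = B ^+ 2 * - c1.
    have := @pcoefM_ord K 0 (2 * n - 1) (b * conj b) S (@ord0n K _) s0.
    by rewrite add0n => ->; rewrite pcoef0M cb sc.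
  have -> : pcoef (2 * n - 1) (G ^+ n.-1 * c) = g ^+ 2 ^+ n.-1 * g.
    have := pcoefM_ord (ordX (n := n.-1) G2) c0; rewrite pcoefX_ord // gG => <-.
    by have -> : (n.-1 * 2 + 1 = 2 * n - 1)%N by lia.
  move=> /eqP; rewrite add0r mulrN addrC subr_eq0 [_ * c1]mulrC => /eqP/(mulfI c1n) -> //.
have k2 : 2 * A * B + c1 * (g ^+ 2 ^+ n.-1 * E) = 0.
  have : pcoef (2 * n - 2) (a * b + b * conj a + c1 *: (G ^+ n.-1 * e)) = 0.
    by apply: (pcoef_ord H2); lia.
  rewrite !pcoefD pcoefZ.
  have e1 w : pcoef (2 * n - 2) (a * w) = A * pcoef 0 w.
    by rewrite -{1}[(2 * n - 2)%N]addn0 (pcoefM_ord a1 (@ord0n K w)).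
  have -> : pcoef (2 * n - 2) (b * conj a) = B * A.
    have := @pcoefM_ord K 0 (2 * n - 2) b (conj a) (@ord0n K _) (conj_ord a1).
    rewrite add0n => ->; rewrite pcoef_pconj -signr_odd.
    have -> : odd (2 * n - 2) = false by lia.
    by rewrite expr0 mul1r.
  have -> : pcoef (2 * n - 2) (G ^+ n.-1 * e) = g ^+ 2 ^+ n.-1 * E.
    have := pcoefM_ord (ordX (n := n.-1) G2) (@ord0n K e); rewrite pcoefX_ord // gG => <-.
    by have -> : (n.-1 * 2 + 0 = 2 * n - 2)%N by lia.
  by rewrite e1 => <-; rewrite -/B; ring.
have k3 : 2 * A * g - 2 * c1 * (E * B) = 0.
  have : pcoef (2 * n - 1) (c * a + e * conj b * S + (a * c + b * conj e * S)) = 0.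
    by apply: (pcoef_ord E1); lia.
  have e1 w : pcoef (2 * n - 1) (w * S) = pcoef 0 w * - c1.
    have := @pcoefM_ord K 0 (2 * n - 1) w S (@ord0n K _) s0.
    by rewrite add0n sc.
  have e2 : pcoef (2 * n - 1) (a * c) = A * g.
    have := pcoefM_ord a1 c0.
    by have -> : (2 * n - 2 + 1 = 2 * n - 1)%N by lia.
  rewrite !pcoefD !e1 [c * a]mulrC e2 !pcoef0M cb ce => <-; rewrite -/B -/E; ring.
have W0 : g ^+ 2 ^+ n.-1 * g != 0 by rewrite mulf_neq0 // !expf_neq0.
have E0 : E = 0.
  have : 3 * c1 * (g ^+ 2 ^+ n.-1 * g) * E = 0.
    transitivity ((2 * A * B + c1 * (g ^+ 2 ^+ n.-1 * E)) * g
      - (2 * A * g - 2 * c1 * (E * B)) * B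
      + 2 * c1 * E * (g ^+ 2 ^+ n.-1 * g - B ^+ 2)); first by ring.
    by rewrite k1 k2 k3; ring.
  by move/eqP; rewrite mulf_eq0 (negPf (mulf_neq0 (mulf_neq0 (nz 3 _) c1n) W0)) //= => /eqP.
have A0 : A = 0.
  move: k3; rewrite E0 => /eqP; rewrite mul0r mulr0 subr0 !mulf_eq0 (negPf (nz 2 _)) //= (negPf cn) orbF.
  by move/eqP.
have a2 : order_ge (2 * n - 1) a.
  by have := ordS a1 A0; have -> : (2 * n - 2).+1 = (2 * n - 1)%N by lia.
have e1 : order_ge 1 e by exact: o.
have cc2 : order_ge (2 * n) (c + conj c).
  have : order_ge (2 * n - 1) ((c + conj c) * b).
    have -> : (c + conj c) * b = c * b + e * conj a + (a * e + b * conj c) - e * (a + conj a) by ring.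
    by apply: ordB => //; apply: ordMl; apply: ordD => //; exact: conj_ord.
  move=> /(ord_unit _ _ ub)/ordS.
  have -> : (2 * n - 1).+1 = (2 * n)%N by lia.
  apply; rewrite pcoefD pcoef_pconj -signr_odd.
  have -> : odd (2 * n - 1) by lia.
  by rewrite expr1 mulN1r subrr.
have GG : order_ge (2 * n + 1) (G - conj G).
  have -> : G - conj G = (c - conj c) * (c + conj c) + e * conj e * (S - conj S).
    by rewrite /G (linearD conj) /= !rmorphM /= pconjK; ring.
  apply: ordD; first by apply: (ordM_le (ordB c0 (conj_ord c0)) cc2); lia.
  apply: (ordM_le (ordM e1 (conj_ord e1)) (ordB s0 (conj_ord s0))); lia.
move: G G2 gG GG H1 {H2 k2} P => G G2 gG GG H1 _.
have powG : order_ge (4 * n - 3) (G ^+ n.-1 - conj G ^+ n.-1).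
  rewrite subrXX; apply: (@ordM_le _ _ (2 * n + 1) (2 * n - 4)) => //; last by lia.
  apply: (big_ind (fun w : pser => order_ge (2 * n - 4) w)) => // [u v|i _]; first exact: ordD.
  apply: (ordM_le (ordX (n := n.-1.-1 - i) G2) (ordX (n := i) (conj_ord G2))).
  by have := ltn_ord i; lia.
(* adding to [T] its conjugate cancels its odd part *)
pose T := a * a + b * conj b * S + c1 *: (G ^+ n.-1 * c).
have TT : order_ge (2 * m + 1) (T + conj T) by apply: ordD => //; exact: conj_ord.
have : order_ge (2 * m + 1) (b * conj b * (S + conj S)).
  have -> : b * conj b * (S + conj S) = T + conj T - (a * a + conj a * conj a) -
      c1 *: ((G ^+ n.-1 - conj G ^+ n.-1) * c + conj G ^+ n.-1 * (c + conj c)).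
    rewrite /T !(linearD conj) /= [conj (_ *: _)]linearZ /= !rmorphM rmorphXn /= pconjK.
    have -> : (G ^+ n.-1 - conj G ^+ n.-1) * c + conj G ^+ n.-1 * (c + conj c) =
        G ^+ n.-1 * c + conj G ^+ n.-1 * conj c by ring.
    by rewrite mulrDr [conj b * b]mulrC; series_ring.
  apply: ordB; first apply: ordB => //.
    apply: ordD; first by apply: (ordM_le a2 a2); lia.
    by apply: (ordM_le (conj_ord a2) (conj_ord a2)); lia.
  apply: ordZ; apply: ordD; first by apply: (ordM_le powG c0); lia.
  by apply: (ordM_le (ordX (n := n.-1) (conj_ord G2)) cc2); lia.
rewrite s1 => /(@pcoef_ord _ _ (2 * m)); rewrite addn1 => /(_ (ltnSn _)).
rewrite -scalerAr pcoefZ [b * conj b * _]mulrC.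
have := pcoef_tXM (2 * m) 0 (b * conj b); rewrite addn0 pcoef0M cb => -> /eqP.
rewrite !mulf_eq0 oppr_eq0 mulf_eq0 (negPf bn) orbF (negPf (nz 2 _)) // (negPf (nz _ _)) // addn1.
Qed.

End MixedPart.

Section Distinct.
Variables (R : realType) (d : nat) (d_ge2 : (2 <= d)%N).
Local Notation K := (R[i]).
Local Notation pot L := (xy_pot d_ge2 (nf_pot K L)).
Local Notation s L := (ysq (nf_pot K L)).

(** A symmetric form of [Jac_iso], so that the roles of two labels can be
    exchanged. *)
Definition Jac_bijZ f g := exists F G,
  [/\ @Jac_bij K d f g F G, @Jac_bij K d g f G F & scalable F].

Lemma Jac_bijZ_sym f g : Jac_bijZ f g -> Jac_bijZ g f.
Proof.
move=> [F [G [FG GF FZ]]]; have [K1 K2 _ _] := FG.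
exists G, F; split; [exact: GF|exact: FG|move=> a q].
by apply: (can_inj K1); rewrite K2 (FZ a (G q)) K2.
Qed.

Lemma capn_iso L L' k : nf_valid L -> nf_valid L' -> Jac_bijZ (pot L) (pot L') ->
  (capn (nf_M L) k + capn (nf_N L) k.-1 = capn (nf_M L') k + capn (nf_N L') k.-1)%N.
Proof.
move=> v v' [F [G [FG GF FZ]]]; have [K1 K2 FB _] := FG.
have : (capn (nf_M L) k + capn (nf_N L) k.-1)%:R%:E =
    (capn (nf_M L') k + capn (nf_N L') k.-1)%:R%:E :> \bar R.
  rewrite -(@dim_mod_radical_nf R d d_ge2 L k v) -(@dim_mod_radical_nf R d d_ge2 L' k v').
  have o2 := @normal_form_pot_order2 K d d_ge2 L v.
  have o2' := @normal_form_pot_order2 K d d_ge2 L' v'.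
  have FJ (q : Jac (pot L)) :
      @jac_radical_pow R d (pot L) k q <-> @jac_radical_pow R d (pot L') k (F q).
    exact: (Jac_bij_pow (G := G)).
  exact: (@dim_mod_transport R K (Jac (pot L)) (Jac (pot L')) F G _ _ _ _ K1 K2 FB FZ (fun=> conj id id) FJ).
by move=> [] /eqP; rewrite eqr_nat => /eqP.
Qed.

Lemma nf_e_ge2 L n : nf_valid L -> nf_n L = Some n -> (2 <= nf_e L)%N.
Proof.
move=> v e; rewrite /nf_e e; have := nf_n_ge2 v e.
by case e': (nf_m L) => [m|]; [have := nf_m_gt0 v e'|]; lia.
Qed.

(** As [M >= N + 2], the number [min(k, M) + min(k - 1, N)] grows by two exactly up
    to [k = N + 1]; so these numbers determine [N], then [M]. *)
Lemma capn_inj L L' : nf_valid L -> nf_valid L' ->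
  (forall k, capn (nf_M L) k + capn (nf_N L) k.-1 = capn (nf_M L') k + capn (nf_N L') k.-1)%N ->
  nf_n L = nf_n L' /\ (nf_n L != None -> nf_e L = nf_e L').
Proof.
move=> v v'; rewrite /nf_M /nf_N.
have := @nf_e_ge2 L; have := @nf_e_ge2 L'.
have := @nf_n_ge2 L v; have := @nf_n_ge2 L' v'.
case e: (nf_n L) => [n|]; case e': (nf_n L') => [n'|] //= a' a b' b H.
- have {}a := a _ erefl; have {}a' := a' _ erefl.
  have {}b := b _ v erefl; have {}b' := b' _ v' erefl.
  have nn : n = n'.
    by case: (ltngtP n n') => // lt; [have := H (2 * n + 1)%N|have := H (2 * n' + 1)%N]; clear H; lia.
  split=> [|_]; first by rewrite nn.
  by have := H (6 * n + nf_e L + nf_e L')%N; clear H; rewrite -nn; lia.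
- by exfalso; have := H (4 * n + nf_e L + 2)%N; have := a _ erefl; clear H; lia.
- by exfalso; have := H (4 * n' + nf_e L' + 2)%N; have := a' _ erefl; clear H; lia.
Qed.

Lemma odd_exponent_le L L' m' : nf_valid L -> nf_valid L' ->
  nf_n L = None -> nf_n L' = None -> nf_m L' = Some m' -> Jac_bijZ (pot L') (pot L) ->
  exists2 m, nf_m L = Some m & (m <= m')%N.
Proof.
move=> v v' e e' em' [F [G [FG GF FZ]]]; have m'0 := nf_m_gt0 v' em'.
have [u [w [[u0 w0] det z1 z2]]] := @iso_pairs K d d_ge2 L L' v v' F G FG GF FZ.
have bound k : (3 <= k)%N -> order_ge k (s L) -> (k <= 2 * m')%N.
  by move=> k3 sk; exact: (odd_exponent_bound k3 sk e' em' m'0 u0 w0 det z1 z2).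
have sE : s L = - pder (nf_odd K L).
  by rewrite /ysq /nf_pot pderD (pder_nf_even K v) e add0r.
case em: (nf_m L) => [m|].
  exists m => //; case: (leqP m 1) => m1; first exact: leq_trans m'0.
  have : (2 * m <= 2 * m')%N.
    apply: bound; first by lia.
    by rewrite sE pder_nf_odd em; apply: ordN; apply: ordZ; exact: ord_tX.
  by lia.
have : (2 * m' + 1 <= 2 * m')%N.
  apply: bound; first by lia.
  by rewrite sE pder_nf_odd em oppr0.
by lia.
Qed.

Lemma mixed_exponent_le L L' n m : nf_valid L -> nf_valid L' ->
  nf_n L = Some n -> nf_n L' = Some n -> nf_m L = Some m -> (n <= m)%N ->
  (if nf_m L' is Some m' then (m < m')%N else true) -> ~ Jac_bijZ (pot L') (pot L).
Proof.
move=> v v' e e' em nm mm' [F [G [FG GF FZ]]].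
have [u [w [[u0 w0] det z1 z2]]] := @iso_pairs K d d_ge2 L L' v v' F G FG GF FZ.
have n2 := nf_n_ge2 v e.
have m2n : (m <= 2 * n - 2)%N.
  by move: v e em nm; case: (L) => //= n0 m0 V [<-] [<-]; [case/and3P: V|lia].
have sE : s L = - ((2 * n)%:R *: tvar K ^+ (2 * n - 1) + (2 * m + 1)%:R *: tvar K ^+ (2 * m)).
  by rewrite /ysq /nf_pot pderD (pder_nf_even K v) pder_nf_odd e em.
rewrite sE in z1 z2.
exact: (mixed_contradiction n2 nm m2n e' mm' u0 w0 det z1 z2).
Qed.

(** The dimensions of the [Jac / J^k] give [n] and, if [n] is finite, the order of
    [p'].  This leaves [m] open when [n] is infinite, and when [n] is finite and
    [2 m > 2 n - 1]. *)
Lemma normal_form_inj L L' : nf_valid L -> nf_valid L' ->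
  Jac_iso (normal_form K d_ge2 L) (normal_form K d_ge2 L') -> L = L'.
Proof.
move=> v v'; rewrite !normal_formE // => /Jac_iso_bij H.
have {}H : Jac_bijZ (pot L) (pot L') by [].
have H' := Jac_bijZ_sym H.
have [en ee] := capn_inj v v' (fun k => capn_iso k v v' H).
apply: nf_label_inj => //.
case e: (nf_n L) en ee => [n|] /esym e'; last first.
  move=> _; case em: (nf_m L) => [m|].
    have [m' em' mm'] := odd_exponent_le v' v e' e em H.
    have [m1 em1 m1m'] := odd_exponent_le v v' e e' em' H'.
    by rewrite em'; move: em1; rewrite em => -[me]; congr Some; lia.
  case em': (nf_m L') => [m'|] //.
  by have [m1] := odd_exponent_le v v' e e' em' H'; rewrite em.
move=> /(_ isT); rewrite /nf_e e e' => ee; have n2 := nf_n_ge2 v e.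
have A L1 L2 m1 : nf_valid L1 -> nf_valid L2 -> nf_n L1 = Some n -> nf_n L2 = Some n ->
    nf_m L1 = Some m1 -> Jac_bijZ (pot L2) (pot L1) -> (n <= m1)%N ->
    exists2 m2, nf_m L2 = Some m2 & (m2 <= m1)%N.
  move=> w1 w2 e1 e2 em1 B nm; have := mixed_exponent_le w1 w2 e1 e2 em1 nm.
  case: (nf_m L2) => [m2|] C; last by case: (C isT B).
  by exists m2 => //; rewrite leqNgt; apply/negP => lt; exact: (C lt B).
case em: (nf_m L) ee => [m|]; case em': (nf_m L') => [m'|] // ee.
- case: (leqP n m) => nm; last by congr Some; lia.
  have nm' : (n <= m')%N by lia.
  have [m2] := A _ _ _ v v' e e' em H' nm; rewrite em' => -[<-] le1.
  have [m3] := A _ _ _ v' v e' e em' H nm'; rewrite em => -[<-] le2.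
  by congr Some; lia.
- have [|m2] := A _ _ _ v v' e e' em H' _; first by lia.
  by rewrite em'.
have [|m2] := A _ _ _ v' v e' e em' H _; first by lia.
by rewrite em.
Qed.

End Distinct.

Theorem theorem1p3 (R : realType) (d : nat) (d_ge2 : (2 <= d)%N) :
  [/\ forall f : ncseries R[i] d,
        order_ge 2 f -> corank f = 2%:E -> corankm 2 f = 2%:E ->
        exists2 L : nf_label, nf_valid L & Jac_iso f (normal_form R[i] d_ge2 L),
      forall L L' : nf_label, nf_valid L -> nf_valid L' -> L <> L' ->
        ~ Jac_iso (normal_form R[i] d_ge2 L) (normal_form R[i] d_ge2 L')
    & forall L : nf_label, nf_valid L ->
        Jdim (normal_form R[i] d_ge2 L) =
          match L with
          | DInfInf | DInfM _ => 1%:E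
          | DNInf _ | DNM_even _ _ | DNM_odd _ _ => 0%:E
          end].
Proof.
split=> [f f2 c1 c2|L L' v v' LL' iso|L v].
- exact: normal_form_exists.
- by apply: LL'; exact: normal_form_inj iso.
by rewrite normal_form_Jdim //; case: L v.
Qed.
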